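(* Let $d\ge3$ be a fixed odd integer. Then there exists $n_0=n_0(d)$ such that every extremal graph $G\in\mathcal G(n,d)$ with $n\ge n_0$ has degree sequence $$\pi(G)=\begin{cases}(d,\ldots,d,d-1),& n\text{ is odd},\\ (d,\ldots,d,1),& n\text{ is even}.\end{cases}$$
   Context: All graphs are finite, undirected, simple and connected. For positive integers $n,d$, $\mathcal G(n,d)$ is the family of connected nonregular graphs of order $n$ and maximum degree $d$. For a graph $G$, $\lambda_1(G)$ is the largest eigenvalue of its adjacency matrix. Whenever $\mathcal G(n,d)\neq\varnothing$, $\rho(n,d):=\max\{\lambda_1(G):G\in\mathcal G(n,d)\}$, and $G\in\mathcal G(n,d)$ is called extremal if $\lambda_1(G)=\rho(n,d)$. The degree sequence $\pi(G)=(d_1,\ldots,d_n)$ lists the vertex degrees in nonincreasing order. *)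

(* Defs.v *)
From mathcomp Require Import all_boot all_order all_algebra.
From mathcomp Require Import all_classical all_reals.

Set Implicit Arguments.
Unset Strict Implicit.
Unset Printing Implicit Defensive.

Import Order.TTheory GRing.Theory Num.Theory.

Local Open Scope classical_set_scope.
Local Open Scope ring_scope.

Record sgraph (n : nat) := SGraph {
  adj :> rel 'I_n;
  adj_sym : symmetric adj;
  adj_irrefl : irreflexive adj
}.

Definition degree (n : nat) (G : sgraph n) (x : 'I_n) : nat :=
  #|[pred y | G x y]|.

Definition max_degree (n : nat) (G : sgraph n) : nat :=
  (\max_(x < n) degree G x)%N.

Definition connected (n : nat) (G : sgraph n) : Prop :=
  forall x y : 'I_n, connect G x y.

Definition regular (n : nat) (G : sgraph n) : Prop :=
  exists k : nat, forall x : 'I_n, degree G x = k.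

(* The empty graph (n = 0) is regular in this sense, so graph_family 0 d is
   empty. *)
Definition graph_family (n d : nat) : set (sgraph n) :=
  [set G | [/\ connected G, ~ regular G & max_degree G = d]].

Arguments graph_family : clear implicits.

Definition degree_sequence (n : nat) (G : sgraph n) : seq nat :=
  sort geq [seq degree G x | x <- enum 'I_n].

Definition adjacency_matrix (R : realType) (n : nat) (G : sgraph n) :
    'M[R]_n :=
  \matrix_(i, j) (G i j)%:R.

(* The largest element of A; the junk value 0 if A has none.  Below, A is
   finite, and it is nonempty as soon as 0 < n (for lambda1) or graph_family
   n d is nonempty (for rho). *)
Definition largest (R : realType) (A : set R) : R :=
  xget 0 [set a | A a /\ ubound A a].

Definition lambda1 (R : realType) (n : nat) (G : sgraph n) : R :=
  largest [set a : R | eigenvalue (adjacency_matrix R G) a].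

Definition rho (R : realType) (n d : nat) : R :=
  largest [set lambda1 R G | G in graph_family n d].

Definition extremal (R : realType) (n d : nat) (G : sgraph n) : Prop :=
  graph_family n d G /\ lambda1 R G = rho R n d.

(* Main.v *)
Require Import Defs.
From mathcomp Require Import all_classical all_reals.
From mathcomp Require Import all_boot all_order all_algebra.
From mathcomp Require Import zify lra.

Set Implicit Arguments.
Unset Strict Implicit.
Unset Printing Implicit Defensive.
Import Order.TTheory GRing.Theory Num.Theory.
Local Open Scope ring_scope.

(* Let G be extremal, x its Perron vector with largest entry X, mu = d - lambda_1 and
   F = mu sum_v x_v, which equals sum_v (d - deg v) x_v. Every connected competitor of the same
   order satisfies mu |y|^2 <= d |y|^2 - <y, A y>, so test vectors on surgically modified copies
   of G give inequalities between x, X, mu and F.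
   (1) Hanging a long chain of near-cliques on the deficient vertices, at the cost of the flat
   top part of x, gives F^2 / (d - 1) <= (1 + o(1)) mu X^2.
   (2) List the vertices by increasing x. The cut c_k above the k lowest vertices (deficiencies
   count as edges) carries a flow at most F, so a large c_k forces a small gap between
   consecutive entries. Since d is odd, c_k and c_(k+1) differ in parity, and since few vertices
   cannot absorb all edges, c_i + c_j is large for nearby i and j. Hence, as long as no c_k
   equals 1, x grows by definitely less than F / (d - 1) per vertex.
   (3) If the first k with c_k = 1 is at least 2, or if there is none in a bounded range, delete
   the low vertices and return them to the flat top, up to a leaf for parity. By (2) this costs
   less than (1) says it gains, a contradiction. So c_0 = 1, one vertex of degree d - 1, or
   c_1 = 1, one leaf; the parity of n decides which. *)

(** * Graphs and the energy form *)

(** Electrically, every vertex [v] is a source of strength [mu * x v], its missing degree is a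
    bundle of edges to a ground of potential 0, and F is the total current. A near-clique on d + 1
    vertices with one joining edge raises the potential by d + 1 when it carries the current d - 1,
    so F / (d - 1) per vertex is the rate of a chain. Deleting the K lowest vertices moves the
    ground up to their top level t, at a price of at most t F, while K new vertices at the top are
    worth about K mu X^2. If t were K F / (d - 1), then (1) would only give break-even to leading
    order, so everything rests on a definite saving eps in (2) that depends on d alone. All other
    errors carry a factor mu or F / X, which tends to 0 as n grows, provided that the number of
    levels involved stays bounded; this is why a bridge has to be found in a bounded range.
    Competitors must moreover be simple, connected and of order exactly n. The parity of degree sums
    restricts the order of every gadget, and this accounts for the extra leaves and for the choices
    of odd and even sizes. *)

Record graph := Graph {
  vertex :> finType;
  edge : rel vertex;
  edge_sym : symmetric edge;
  edge_irr : irreflexive edge }.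
Arguments edge {g} : rename.

Definition deg (g : graph) (v : g) : nat := (\sum_(w : g) edge v w)%N.

Definition conn (g : graph) : Prop := forall u v : g, connect edge u v.

(* [energy d] is the quadratic form of [d I - A]; [mu] below plays the role of [d - lambda_1]. *)
Definition energy (R : realFieldType) (d : nat) (g : graph) (y : g -> R) : R :=
  d%:R * (\sum_v y v ^+ 2) - \sum_v \sum_w (edge v w)%:R * (y v * y w).

(** The three degree conditions say that [g] is nonregular of maximum degree [d]. Competitors live
    on arbitrary finite types, so that disjoint sums and subtypes can be used without
    renumbering. *)
Definition minimal (R : realFieldType) (d n : nat) (mu : R) : Prop :=
  forall g : graph, #|g| = n -> conn g -> (forall v : g, (deg v <= d)%N) ->
  (exists v : g, (deg v < d)%N) -> (exists v : g, deg v = d) ->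
  forall y : g -> R, mu * (\sum_v y v ^+ 2) <= energy d y.

Lemma edge_connect_sym (g : graph) : connect_sym (@edge g).
Proof. by apply: sym_connect_sym; exact: edge_sym. Qed.

(** The rows of [d I - A] sum to [d - deg v], so a constant shift only interacts with the deficient
    vertices. *)
Lemma energy_shift (R : realFieldType) (d : nat) (g : graph) (y : g -> R) (h : R) :
  energy d (fun v => y v + h) =
    energy d y + 2 * h * (\sum_v (d%:R - (deg v)%:R) * y v)
      + h ^+ 2 * (\sum_(v : g) (d%:R - (deg v)%:R)).
Proof.
have E1 : \sum_(v : g) (y v + h) ^+ 2 =
    \sum_v y v ^+ 2 + 2 * h * (\sum_v y v) + h ^+ 2 * \sum_(v : g) 1.
  rewrite !mulr_sumr -!big_split /=; apply: eq_bigr => v _; lra.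
have E2 : \sum_(v : g) \sum_w (edge v w)%:R * ((y v + h) * (y w + h)) =
    \sum_v \sum_w (edge v w)%:R * (y v * y w) + 2 * h * (\sum_v (deg v)%:R * y v)
     + h ^+ 2 * (\sum_(v : g) (deg v)%:R).
  have H1 : \sum_v \sum_w (edge v w)%:R * y v = \sum_(v : g) (deg v)%:R * y v.
    by apply: eq_bigr => v _; rewrite -mulr_suml /deg natr_sum.
  have H2 : \sum_v \sum_w (edge v w)%:R * y w = \sum_(v : g) (deg v)%:R * y v.
    rewrite exchange_big /= -H1; apply: eq_bigr => v _; apply: eq_bigr => w _.
    by rewrite edge_sym.
  transitivity (\sum_(v : g) \sum_w (edge v w)%:R * (y v * y w)
    + h * (\sum_v \sum_w (edge v w)%:R * y v)
    + h * (\sum_v \sum_w (edge v w)%:R * y w)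
    + h ^+ 2 * (\sum_(v : g) \sum_(w : g) (edge v w)%:R)).
    rewrite !mulr_sumr -!big_split /=; apply: eq_bigr => v _.
    rewrite !mulr_sumr -!big_split /=; apply: eq_bigr => w _; lra.
  rewrite H1 H2; under [X in _ + h ^+ 2 * X]eq_bigr => v _ do rewrite -natr_sum -/(deg v).
  lra.
rewrite /energy E1 E2.
have -> : \sum_v (d%:R - (deg v)%:R) * y v = d%:R * (\sum_v y v) - \sum_v (deg v)%:R * y v.
  by rewrite mulr_sumr -sumrB; apply: eq_bigr => v _; rewrite mulrBl.
have -> : \sum_(v : g) (d%:R - (deg v)%:R) = d%:R * (\sum_(v : g) 1) - \sum_(v : g) (deg v)%:R :> R.
  by rewrite mulr_sumr -sumrB; apply: eq_bigr => v _; rewrite mulr1.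
lra.
Qed.

Lemma energy_cst (R : realFieldType) (d : nat) (g : graph) (h : R) :
  energy d (fun _ : g => h) = h ^+ 2 * (\sum_(v : g) (d%:R - (deg v)%:R)).
Proof.
have := energy_shift d (fun _ : g => 0 : R) h.
have -> : energy d (fun _ : g => 0 : R) = 0.
  rewrite /energy big1 => [|v _]; last by rewrite expr0n.
  rewrite big1 ?mulr0 ?subr0 // => v _; rewrite big1 // => w _.
  by rewrite !mulr0.
have -> : \sum_(v : g) (d%:R - (deg v)%:R) * (0 : R) = 0.
  by rewrite big1 // => v _; rewrite mulr0.
by rewrite mulr0 !add0r => <-.
Qed.

Lemma energy_scale (R : realFieldType) (d : nat) (g : graph) (y : g -> R) (h : R) :
  energy d (fun v => h * y v) = h ^+ 2 * energy d y.
Proof.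
rewrite /energy mulrBr; congr (_ - _).
  rewrite [RHS]mulrCA; congr (_ * _); rewrite mulr_sumr; apply: eq_bigr => v _; lra.
rewrite mulr_sumr; apply: eq_bigr => v _.
rewrite mulr_sumr; apply: eq_bigr => w _; lra.
Qed.

(** The Dirichlet form with a ground: the missing degree of [v] acts as that many edges to a vertex
    of potential 0. *)
Lemma energy_edges (R : realFieldType) (d : nat) (g : graph) (y : g -> R) :
  energy d y = \sum_v (d%:R - (deg v)%:R) * y v ^+ 2
    + 2^-1 * \sum_v \sum_w (edge v w)%:R * (y v - y w) ^+ 2.
Proof.
have H1 : \sum_v \sum_w (edge v w)%:R * y v ^+ 2 = \sum_(v : g) (deg v)%:R * y v ^+ 2.
  by apply: eq_bigr => v _; rewrite -mulr_suml /deg natr_sum.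
have H2 : \sum_v \sum_w (edge v w)%:R * y w ^+ 2 = \sum_(v : g) (deg v)%:R * y v ^+ 2.
  rewrite exchange_big /= -H1; apply: eq_bigr => v _; apply: eq_bigr => w _.
  by rewrite edge_sym.
have -> : \sum_v \sum_w (edge v w)%:R * (y v - y w) ^+ 2 =
   \sum_v \sum_w (edge v w)%:R * y v ^+ 2 + \sum_v \sum_w (edge v w)%:R * y w ^+ 2
   - 2 * \sum_v \sum_w (edge v w)%:R * (y v * y w).
  rewrite !mulr_sumr -big_split -sumrB /=; apply: eq_bigr => v _.
  rewrite !mulr_sumr -big_split -sumrB /=; apply: eq_bigr => w _; lra.
rewrite H1 H2 /energy.
have -> : \sum_v (d%:R - (deg v)%:R) * y v ^+ 2 = d%:R * (\sum_v y v ^+ 2) - \sum_v (deg v)%:R * y v ^+ 2.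
  by rewrite mulr_sumr -sumrB; apply: eq_bigr => v _; rewrite mulrBl.
lra.
Qed.

(* [attach] joins the i-th entry of [p] to the i-th entry of [r]. *)
Section Attach.
Variables (g1 g2 : graph) (p : seq g1) (r : seq g2).

Definition attach_edge (a b : g1 + g2) : bool :=
  match a, b with
  | inl a, inl b => edge a b
  | inr a, inr b => edge a b
  | inl a, inr b => (a, b) \in zip p r
  | inr b, inl a => (a, b) \in zip p r
  end.

Lemma attach_edge_sym : symmetric attach_edge.
Proof. by case=> a [] b //=; rewrite edge_sym. Qed.

Lemma attach_edge_irr : irreflexive attach_edge.
Proof. by case=> a /=; rewrite edge_irr. Qed.

Definition attach := Graph attach_edge_sym attach_edge_irr.

Hypotheses (ur : uniq r) (spr : size p = size r).

(** The pairs in [zip p r] are distinct because their second components are, even where [p] repeats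
    a vertex; so [attach] loses no multiplicity. *)
Lemma big_zip (S : nmodType) (F : g1 -> g2 -> S) :
  \sum_a \sum_b (F a b *+ ((a, b) \in zip p r)) = \sum_(ab <- zip p r) F ab.1 ab.2.
Proof.
have uz : uniq (zip p r).
  by apply: (@map_uniq _ _ snd); rewrite -/unzip2 unzip2_zip // spr.
rewrite pair_big /= [RHS](big_uniq _ uz) [RHS]big_mkcond /=.
by apply: eq_bigr => -[a b] _ /=; case: ifP; rewrite ?mulr1n ?mulr0n.
Qed.

Lemma deg_attach_l (a : g1) : deg (inl a : attach) = (deg a + count_mem a p)%N.
Proof.
rewrite /deg big_sumType /=; congr (_ + _)%N.
have := big_zip (fun a' b => (a' == a : nat)).
have -> : (\sum_(ab <- zip p r) (ab.1 == a : nat) = count_mem a p)%N.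
  rewrite -[RHS](_ : count_mem a (unzip1 (zip p r)) = _); last by rewrite unzip1_zip // spr.
  by rewrite count_map -sum1_count [RHS]big_mkcond /=; apply: eq_bigr => i _ /=; case: eqP.
move=> <-; rewrite (bigD1 a) //= [X in _ + X]big1 ?addr0.
  by apply: eq_bigr => b _; rewrite eqxx; case: (_ \in _).
by move=> a' /negbTE ->; rewrite big1 // => b _; rewrite mul0rn.
Qed.

Lemma deg_attach_r (b : g2) : deg (inr b : attach) = (deg b + (b \in r))%N.
Proof.
rewrite /deg big_sumType /= addnC; congr (_ + _)%N.
have := big_zip (fun a b' => (b' == b : nat)).
have -> : (\sum_(ab <- zip p r) (ab.2 == b : nat) = (b \in r))%N.
  rewrite -(count_uniq_mem _ ur) -[RHS](_ : count_mem b (unzip2 (zip p r)) = _).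
    by rewrite count_map -sum1_count [RHS]big_mkcond /=; apply: eq_bigr => i _ /=; case: eqP.
  by rewrite unzip2_zip // spr.
move=> <-; apply: eq_bigr => a _; rewrite (bigD1 b) //= big1 ?addr0.
  by rewrite eqxx; case: (_ \in _).
by move=> b' /negbTE ->; rewrite mul0rn.
Qed.

Lemma energy_attach (R : realFieldType) (d : nat) (y : attach -> R) (w : R) :
  (forall b, b \in r -> y (inr b) = w) ->
  energy d y = energy d (fun a => y (inl a)) + energy d (fun b => y (inr b))
     - 2 * w * \sum_(a <- p) y (inl a).
Proof.
move=> yw; rewrite /energy !big_sumType /=.
under [X in _ - (X + _)]eq_bigr => v _ do rewrite big_sumType /=.
under [X in _ - (_ + X)]eq_bigr => v _ do rewrite big_sumType /=.
rewrite !big_split /=.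
have H1 : \sum_(i : g1) \sum_(j : g2) ((i, j) \in zip p r)%:R * (y (inl i) * y (inr j))
    = w * \sum_(a <- p) y (inl a).
  transitivity (\sum_(a : g1) \sum_b ((y (inl a) * y (inr b)) *+ ((a, b) \in zip p r))).
    by apply: eq_bigr => a _; apply: eq_bigr => b _; rewrite mulr_natl.
  rewrite (big_zip (fun a b => y (inl a) * y (inr b))).
  transitivity (\sum_(ab <- zip p r) w * y (inl ab.1)).
    rewrite !big_seq; apply: eq_bigr => -[a b] /= /(map_f snd).
    by rewrite -/unzip2 -/(unzip2 _) unzip2_zip ?spr //= => /yw ->; rewrite mulrC.
  rewrite -mulr_sumr; congr (_ * _).
  by rewrite -[in RHS](@unzip1_zip _ _ p r) ?spr // big_map.
have H2 : \sum_(i : g2) \sum_(j : g1) ((j, i) \in zip p r)%:R * (y (inr i) * y (inl j))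
    = w * \sum_(a <- p) y (inl a).
  rewrite -H1 exchange_big /=; apply: eq_bigr => a _; apply: eq_bigr => b _.
  by rewrite [y (inr _) * _]mulrC.
rewrite H1 H2; lra.
Qed.

(** [g1] may be disconnected as long as each of its vertices reaches the list [p], since [g2] links
    the pieces. [insert_gadget] uses this after deleting an edge that may be a bridge. *)
Lemma conn_attach : conn g2 -> (forall v : g1, exists2 u, u \in p & connect edge v u) ->
  (0 < size p)%N -> conn attach.
Proof.
move=> c2 c1 p0.
have [b0 _] : exists b, b \in r.
  by case: r spr p0 => [|b ?] -> // _; exists b; rewrite mem_head.
have inrP (a b : g2) : @connect attach edge (inr a) (inr b).
  have /connectP[s ps ->] := c2 a b.
  elim: s a ps => [|c s IH] a /=; first by move=> _; exact: connect0.
  by case/andP=> ac /IH; apply: connect_trans; apply: connect1.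
have inlP (a b : g1) : connect edge a b -> @connect attach edge (inl a) (inl b).
  move=> /connectP[s ps ->].
  elim: s a ps => [|c s IH] a /=; first by move=> _; exact: connect0.
  by case/andP=> ac /IH; apply: connect_trans; apply: connect1.
suff H (v : attach) : connect edge v (inr b0).
  by move=> u v; apply: (connect_trans (H u)); rewrite edge_connect_sym.
case: v => v; last exact: inrP.
have [u up /inlP vu] := c1 v; apply: (connect_trans vu).
have ip : (index u p < size p)%N by rewrite index_mem.
have : (u, nth b0 r (index u p)) \in zip p r.
  rewrite -[u in (u, _)](nth_index u up) -nth_zip //; apply: mem_nth.
  by rewrite size_zip -spr minnn.
move=> e; apply: (connect_trans (connect1 _) (inrP (nth b0 r (index u p)) b0)).
exact: e.
Qed.

End Attach.

(** * Gadgets with prescribed degrees *)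

Section EvenGadget.
Variables (h d m : nat).
Let T := 'I_h.+1.

(* A [d]-regular bipartite circulant from which [m] of the edges [i -- i + 2] are removed. *)
Definition circ_edge (i j : T) : bool :=
  ((j - i)%R < d)%N && ~~ ((j - i == inord 2) && (i < m)%N).

Definition bip_edge (a b : bool * T) : bool :=
  match a, b with
  | (false, i), (true, j) => circ_edge i j
  | (true, j), (false, i) => circ_edge i j
  | _, _ => false
  end.

Lemma bip_edge_sym : symmetric bip_edge.
Proof. by move=> [[] i] [[] j]. Qed.

Lemma bip_edge_irr : irreflexive bip_edge.
Proof. by move=> [[] i]. Qed.

Definition bip := Graph bip_edge_sym bip_edge_irr.

Hypotheses (d3 : (3 <= d)%N) (dh : (d <= h.+1)%N) (mh : (m <= h.+1)%N).

Definition bip_slots : seq bip :=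
  [seq (false, i) | i : T <- enum T & (i < m)%N] ++ [seq (true, i + inord 2) | i : T <- enum T & (i < m)%N].

Lemma bip_count (b : bool) :
  (\sum_(k : T) ((k < d) && ~~ ((k == inord 2) && b) : nat) + b = d)%N.
Proof.
have E : (\sum_(k : T) (k < d : nat) = d)%N.
  transitivity (\sum_(k < h.+1 | (k < d)%N) 1)%N.
    by rewrite [RHS]big_mkcond /=; apply: eq_bigr => i _; case: (_ < _)%N.
  by rewrite -(big_ord_widen h.+1 (fun=> 1%N) dh) sum1_card card_ord.
have i2 : (inord 2 : T) = 2 :> nat by rewrite inordK //; lia.
case: b; last by rewrite addn0 -[RHS]E; apply: eq_bigr => i _; rewrite andbF andbT.
rewrite -[RHS]E (bigD1 (inord 2)) //= [in RHS](bigD1 (inord 2)) //= eqxx andbF i2 d3.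
rewrite add0n addn1 add1n; congr _.+1; apply: eq_bigr => i /negbTE ->.
by rewrite /= andbT.
Qed.

Lemma deg_bip (v : bip) : (deg v + (v \in bip_slots) = d)%N.
Proof.
rewrite mem_cat; case: v => -[] i.
- have -> : ((true, i) \in [seq (false, i) | i : T <- enum T & (i < m)%N]) = false.
    by apply/negP => /mapP[].
  have -> : ((true, i) \in [seq (true, i0 + inord 2) | i0 : T <- enum T & (i0 < m)%N]) =
      ((i - inord 2)%R < m)%N.
    apply/mapP/idP => [[j]|H].
      by rewrite mem_filter => /andP[jm _] [->]; rewrite addrK.
    by exists (i - inord 2); [rewrite mem_filter mem_enum /= H | rewrite subrK].
  rewrite -[RHS](bip_count ((i - inord 2)%R < m)%N) orFb; congr (_ + _)%N.
  have -> : deg ((true, i) : bip) = (\sum_(a : bool) \sum_(j : T) bip_edge (true, i) (a, j))%N.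
    by rewrite pair_bigA; apply: eq_bigr => -[].
  rewrite big_bool /= big1_eq add0n (reindex_inj (subrI i)) /=.
  apply: eq_bigr => k _; rewrite /circ_edge subKr; congr (nat_of_bool _).
  by case: eqP => [->|].
- have -> : ((false, i) \in [seq (true, i0 + inord 2) | i0 : T <- enum T & (i0 < m)%N]) = false.
    by apply/negP => /mapP[].
  have -> : ((false, i) \in [seq (false, i0) | i0 : T <- enum T & (i0 < m)%N]) = (i < m)%N.
    apply/mapP/idP => [[j]|H].
      by rewrite mem_filter => /andP[jm _] [->].
    by exists i; rewrite // mem_filter mem_enum /= H.
  rewrite -[RHS](bip_count (i < m)%N) orbF; congr (_ + _)%N.
  have -> : deg ((false, i) : bip) = (\sum_(a : bool) \sum_(j : T) bip_edge (false, i) (a, j))%N.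
    by rewrite pair_bigA; apply: eq_bigr => -[].
  rewrite big_bool /= big1_eq addn0 (reindex_inj (addrI i)) /=.
  apply: eq_bigr => k _; rewrite /circ_edge; congr (nat_of_bool _).
  by rewrite addrC addKr.
Qed.

(** The edges with differences 0 and 1 are never removed, and they alone form a Hamiltonian
    cycle. *)
Lemma bip_conn : conn bip.
Proof.
have i2 : (inord 2 : T) = 2 :> nat by rewrite inordK //; lia.
have e0 (i : T) : @edge bip (false, i) (true, i).
  rewrite /= /circ_edge subrr /=; apply/andP; split; first by lia.
  apply/negP => /andP[/eqP H _]; have : (0 : T) = 2 :> nat by rewrite H i2.
  by [].
have e1 (i : T) : @edge bip (false, i) (true, i + inord 1).
  have i1 : (inord 1 : T) = 1 :> nat by rewrite inordK //; lia.
  rewrite /= /circ_edge addrC addKr i1; apply/andP; split; first by lia.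
  apply/negP => /andP[/eqP H _]; have : (inord 1 : T) = 2 :> nat by rewrite H i2.
  by rewrite i1.
have H (n : nat) (i : T) : i = n :> nat -> @connect bip edge (false, i) (false, ord0).
  elim: n i => [|n IH] i Hi.
    by rewrite (_ : i = ord0) //; apply: val_inj.
  have lt : (n < h.+1)%N by have := ltn_ord i; lia.
  apply: connect_trans (IH (Ordinal lt) erefl).
  have Ei : i = Ordinal lt + inord 1.
    apply: val_inj; rewrite /= inordK; last by lia.
    by rewrite Hi modn_small ?addn1 // -Hi ltn_ord.
  apply: (connect_trans (connect1 (e0 i))).
  by rewrite (@edge_connect_sym bip); apply: connect1; rewrite [in X in edge _ X]Ei; exact: e1.
have H' (v : bip) : connect edge v (false, ord0).
  case: v => -[] i; last exact: (H i).
  apply: connect_trans (H i _ erefl).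
  by rewrite (@edge_connect_sym bip); apply: connect1; exact: e0.
by move=> u v; apply: (connect_trans (H' u)); rewrite (@edge_connect_sym bip).
Qed.

Lemma bip_slots_uniq : uniq bip_slots.
Proof.
rewrite cat_uniq; apply/and3P; split.
- by rewrite map_inj_uniq; [apply: filter_uniq; exact: enum_uniq | move=> i j []].
- by apply/hasPn => _ /mapP[i _ ->]; apply/negP => /mapP[].
- by rewrite map_inj_uniq; [apply: filter_uniq; exact: enum_uniq | move=> i j /(congr1 snd); exact: addIr].
Qed.

Lemma size_bip_slots : size bip_slots = m.*2.
Proof.
have E : (count (fun i : T => (i < m)%N) (enum T) = m)%N.
  rewrite -sum1_count big_enum_cond /=.
  by rewrite -(big_ord_widen h.+1 (fun=> 1%N) mh) sum1_card card_ord.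
by rewrite size_cat !size_map !size_filter E addnn.
Qed.

End EvenGadget.

(** The degree sum [s * d - c] must be even, which for odd [d] is the parity condition. For even [c]
    the graph [bip] with [c./2] removed edges has the required slots. For odd [c] one takes [c + d]
    slots, an even number, and joins [d] of them to one further vertex. *)
Lemma gadget (d c s : nat) : (3 <= d)%N -> odd d -> odd s = odd c ->
  (2 * d + c + 1 <= s)%N ->
  exists (g : graph) (r : seq g), [/\ #|g| = s, conn g, uniq r, size r = c &
    forall v : g, (deg v + (v \in r) = d)%N].
Proof.
move=> d3 od os sl.
have [oc|oc] := boolP (odd c); last first.
  have Es : s = (s./2.-1).+1.*2 by lia.
  have Ec : c = c./2.*2 by lia.
  exists (bip s./2.-1 d c./2), (bip_slots s./2.-1 d c./2); split.
  - rewrite /= card_prod card_bool card_ord; lia.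
  - apply: bip_conn; lia.
  - exact: bip_slots_uniq.
  - rewrite size_bip_slots; lia.
  - apply: deg_bip; lia.
set m := (c + d)./2; set h := (s./2.-1).
have dh : (d <= h.+1)%N by rewrite /h; lia.
have mh : (m <= h.+1)%N by rewrite /h /m; lia.
pose g2 := bip h d m; pose r := bip_slots h d m.
have sr : size r = (c + d)%N by rewrite size_bip_slots // /m; lia.
have ur : uniq r := bip_slots_uniq _ _ _.
have us : symmetric (fun _ _ : unit => false) by [].
have ui : irreflexive (fun _ : unit => fun _ : unit => false) by [].
pose g1 := Graph us ui.
pose p : seq g1 := nseq d tt.
have spr : size p = size (take d r).
  by rewrite size_nseq size_takel // sr leq_addl.
have utr : uniq (take d r) by rewrite take_uniq.
exists (attach p (take d r)), [seq inr b | b <- drop d r]; split.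
- rewrite /= card_sum card_unit card_prod card_bool card_ord /h; lia.
- apply: conn_attach => //.
  + by apply: bip_conn.
  + by case; exists tt; rewrite ?connect0 // mem_nseq eqxx andbT; lia.
  + by rewrite size_nseq; lia.
- by rewrite map_inj_uniq ?drop_uniq // => a b [].
- rewrite size_map size_drop sr; lia.
- have := ur; rewrite -{1}(cat_take_drop d r) cat_uniq => /and3P[_ /hasPn nd _].
  case=> v.
  + rewrite deg_attach_l // /deg (eq_bigr (fun=> 0%N)) // big1_eq add0n.
    have -> : (inl v \in [seq inr b | b <- drop d r]) = false by apply/negP => /mapP[].
    by rewrite addn0 count_nseq /=; case: v; rewrite mul1n.
  + rewrite deg_attach_r // mem_map; last by move=> a b [].
    have := deg_bip d3 dh mh v; rewrite -/r -{1}(cat_take_drop d r) mem_cat => H.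
    rewrite -[RHS]H.
    rewrite -addnA; congr (_ + _)%N.
    case: (boolP (v \in drop d r)) => [vd|_]; last by rewrite orbF addn0.
    by rewrite (negbTE (nd _ vd)).
Qed.

Section CliqueUnit.
Variable d : nat.
Let T := 'I_d.+1.

(* [kunit] is the complete graph on [d.+1] vertices minus the edge between its first and
   last vertices, which are the ports of the chain. *)
Definition unit_edge (i j : T) : bool :=
  [&& i != j, ~~ ((i == ord0) && (j == ord_max)) & ~~ ((i == ord_max) && (j == ord0))].

Lemma unit_edge_sym : symmetric unit_edge.
Proof.
move=> i j; rewrite /unit_edge eq_sym.
by case: (i == ord0); case: (j == ord0); case: (i == ord_max); case: (j == ord_max).
Qed.

Lemma unit_edge_irr : irreflexive unit_edge.
Proof. by move=> i; rewrite /unit_edge eqxx. Qed.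

Definition kunit := Graph unit_edge_sym unit_edge_irr.

Hypothesis d3 : (3 <= d)%N.

Lemma unit_edgeE (i j : T) :
  (unit_edge i j + ((i == ord0) && (j == ord_max)) + ((i == ord_max) && (j == ord0))
    = (i != j))%N.
Proof.
have om : (ord0 : T) != ord_max by rewrite -val_eqE /=; lia.
rewrite /unit_edge; case: (eqVneq i ord0) => [->|i0] /=.
  by rewrite (negbTE om) /= andbT addn0; case: (eqVneq j ord_max) => [->|_]; rewrite ?om ?andbF ?andbT ?addn0.
case: (eqVneq i ord_max) => [->|im] /=; last by rewrite andbT !addn0.
by rewrite addn0; case: (eqVneq j ord0) => [->|_]; rewrite ?(eq_sym ord_max) ?om ?andbF ?andbT ?addn0.
Qed.

Lemma deg_kunit (i : kunit) : (deg i + (i == ord0) + (i == ord_max) = d)%N.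
Proof.
have H : (\sum_(j : T) (i != j) = d)%N.
  rewrite (bigD1 i) //= eqxx add0n.
  under eq_bigr => j ij do rewrite eq_sym ij.
  by rewrite sum1_card cardC1 card_ord.
rewrite -[RHS]H -(eq_bigr _ (fun j _ => unit_edgeE i j)) !big_split /=.
congr (_ + _ + _)%N.
  by rewrite (bigD1 ord_max) //= eqxx andbT big1 ?addn0 // => j /negbTE ->; rewrite andbF.
by rewrite (bigD1 ord0) //= eqxx andbT big1 ?addn0 // => j /negbTE ->; rewrite andbF.
Qed.

Lemma conn_kunit : conn kunit.
Proof.
have i1 : (inord 1 : T) = 1 :> nat by rewrite inordK //; lia.
have H (i : T) : @connect kunit edge i (inord 1).
  case: (eqVneq i (inord 1)) => [->|i1n]; first exact: connect0.
  apply: connect1; rewrite /= /unit_edge i1n /=.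
  rewrite -[_ == ord_max]val_eqE -[inord 1 == ord0]val_eqE /= i1 !andbF andbT.
  by rewrite (_ : (1 == d)%N = false) ?andbF //; lia.
by move=> u v; apply: (connect_trans (H u)); rewrite (@edge_connect_sym kunit).
Qed.

Variables (R : realFieldType) (b : R).

(** A rise of 1 from the first port to the [d - 1] middle vertices and again to the last port, hence
    a current [d - 1] through the unit. The edge to the next unit must then drop by [d - 1], which
    makes [d + 1] in all. *)
Definition kunit_pot (i : kunit) : R := b + (i == ord_max)%:R - (i == ord0)%:R.

Lemma kunit_pot_sums :
  (\sum_i kunit_pot i = d.+1%:R * b) *
  (\sum_i kunit_pot i ^+ 2 = d.+1%:R * b ^+ 2 + 2).
Proof.
have om : (ord0 : T) != ord_max by rewrite -val_eqE /=; lia.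
have S1 (k : T) : \sum_(i : T) (i == k)%:R = 1 :> R.
  by rewrite (bigD1 k) //= eqxx big1 ?addr0 // => i /negbTE ->.
have Sc (x : R) : \sum_(i : T) x = d.+1%:R * x.
  by rewrite sumr_const card_ord mulr_natl.
split.
  by rewrite /kunit_pot sumrB big_split /= !S1 Sc addrK.
transitivity (\sum_(i : T) (b ^+ 2 + 2 * b * (i == ord_max)%:R - 2 * b * (i == ord0)%:R
   + (i == ord_max)%:R + (i == ord0)%:R)).
  apply: eq_bigr => i _; rewrite /kunit_pot.
  case: (eqVneq i ord0) => [->|_]; first by rewrite (negbTE om) /=; lra.
  by case: (i == ord_max) => /=; lra.
rewrite !big_split /= sumrN -!mulr_sumr !S1 Sc; lra.
Qed.

Lemma energy_kunit : energy d kunit_pot = 2 * d.+1%:R + 2 * (b ^+ 2 - 1).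
Proof.
have om : (ord0 : T) != ord_max by rewrite -val_eqE /=; lia.
have [S1 S2] := kunit_pot_sums.
have E : \sum_v \sum_w (edge v w)%:R * (kunit_pot v * kunit_pot w) =
   (\sum_i kunit_pot i) ^+ 2 - \sum_i kunit_pot i ^+ 2 - 2 * (b - 1) * (b + 1).
  have -> : (\sum_i kunit_pot i) ^+ 2 - \sum_i kunit_pot i ^+ 2 =
     \sum_v \sum_w (v != w)%:R * (kunit_pot v * kunit_pot w).
    rewrite expr2 mulr_suml -sumrB; apply: eq_bigr => v _.
    rewrite mulr_sumr (bigD1 v) //= [in RHS](bigD1 v) //= eqxx mul0r add0r expr2 addrAC subrr add0r.
    by apply: eq_bigr => w wv; rewrite eq_sym wv mul1r.
  have P (k l : T) : \sum_(v : kunit) \sum_(w : kunit) ((v == k) && (w == l))%:R * (kunit_pot v * kunit_pot w)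
     = kunit_pot k * kunit_pot l.
    rewrite (bigD1 k) //= [X in _ + X]big1 ?addr0.
      rewrite (bigD1 l) //= !eqxx big1 ?addr0 ?mul1r // => w /negbTE ->.
      by rewrite mul0r.
    by move=> v /negbTE ->; rewrite big1 // => w _; rewrite mul0r.
  have p0 : kunit_pot ord0 = b - 1 by rewrite /kunit_pot eqxx (negbTE om) addr0.
  have pm : kunit_pot ord_max = b + 1.
    by rewrite /kunit_pot eqxx eq_sym (negbTE om) subr0.
  have -> : 2 * (b - 1) * (b + 1) = kunit_pot ord0 * kunit_pot ord_max
      + kunit_pot ord_max * kunit_pot ord0 by rewrite p0 pm; lra.
  rewrite -!P -big_split -sumrB /=; apply: eq_bigr => v _.
  rewrite -big_split -sumrB /=; apply: eq_bigr => w _.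
  rewrite -unit_edgeE !natrD; lra.
rewrite /energy E S1 S2 (_ : d.+1%:R = d%:R + 1 :> R); [lra | by rewrite natr1].
Qed.

End CliqueUnit.

(** [phi] is the potential of a current [d - 1] that leaves through the missing edge of [b]; over a
    rise of L it has energy [(d - 1) L]. The term [c L^2] only pays for the free slots and
    disappears once these are attached at potential L. The shift [h] in the last clause serves the
    induction, which raises the old chain. *)
Lemma chain_gadget (R : realFieldType) (d c J s : nat) :
  (3 <= d)%N -> odd d -> odd s = ~~ odd c -> (2 * d + c + 2 <= s)%N ->
  exists (g : graph) (r : seq g) (b : g) (phi : g -> R),
  [/\ [/\ #|g| = (s + J * d.+1)%N, conn g, uniq (b :: r) & size r = c],
      forall v : g, (deg v + (v \in r) + (v == b) = d)%N,
      (forall v, v \in r -> phi v = (d.-1 + J * d.+1)%:R) /\ phi b = d.-1%:R,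
      energy d phi = d.-1%:R * (d.-1 + J * d.+1)%:R + c%:R * (d.-1 + J * d.+1)%:R ^+ 2
    & forall h : R, 0 <= h -> s%:R * ((d.-1 + J * d.+1)%:R + h) ^+ 2 <= \sum_v (phi v + h) ^+ 2].
Proof.
move=> d3 od os sl.
have d1 : d.+1%:R = d%:R + 1 :> R by rewrite natr1.
have d2 : d.-1%:R = d%:R - 1 :> R by rewrite -[in RHS](prednK (n := d)) -?natr1 ?addrK //; lia.
elim: J => [|J [g [r [b [phi [[cg cong ur sr] dg [phir phib] en ms]]]]]].
  have [||g [[|b r] [cg cong ur sr dg]]] := @gadget d c.+1 s d3 od; rewrite //; try lia.
  exists g, r, b, (fun _ => d.-1%:R); rewrite mul0n !addn0; split => //.
  - by split => //; case: sr.
  - move=> v; rewrite -[RHS](dg v) -addnA in_cons; congr (_ + _)%N.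
    move: ur => /= /andP[br _]; case: (eqVneq v b) => [->|]; last by rewrite addn0.
    by rewrite (negbTE br).
  - rewrite energy_cst.
    have -> : \sum_(v : g) (d%:R - (deg v)%:R) = \sum_(v in b :: r) 1 :> R.
      rewrite [RHS]big_mkcond /=; apply: eq_bigr => v _.
      by rewrite -[in d%:R](dg v) natrD addrAC subrr add0r; case: (_ \in _).
    rewrite -(big_uniq _ ur) /= big_const_seq count_predT iter_addr_0 sr -natr1; lra.
  - by move=> h _; rewrite sumr_const (_ : #|_| = s) // mulr_natl.
have ub : uniq [:: b] by [].
(* The new unit goes below the old chain: its upper port meets [b], its lower port is the new
   bottom, and the old potential is raised by [d.+1]. *)
pose H := kunit d; pose p : seq H := [:: ord_max].
have spb : size p = size [:: b] by [].
pose G := attach p [:: b].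
pose phi' (v : G) : R := match v with inl i => kunit_pot d%:R i | inr v => phi v + d.+1%:R end.
have L : (d.-1 + J.+1 * d.+1)%:R = (d.-1 + J * d.+1)%:R + d.+1%:R :> R.
  by rewrite -natrD; congr (_%:R); lia.
have om : (ord0 : 'I_d.+1) != ord_max by rewrite -val_eqE /=; lia.
have [br ur'] : b \notin r /\ uniq r by move: ur => /= /andP.
exists G, [seq inr v | v <- r], (inl (ord0 : H)), phi'; split.
- split.
  + rewrite /= card_sum card_ord cg; lia.
  + apply: conn_attach => // v; exists ord_max; rewrite ?mem_head //.
    exact: conn_kunit.
  + rewrite cons_uniq map_inj_uniq ?ur' ?andbT; last by move=> ? ? [].
    by apply/negP => /mapP[].
  + by rewrite size_map.
- case=> v.
  + rewrite deg_attach_l // (_ : (_ \in _) = false) ?addn0; last by apply/negP => /mapP[].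
    rewrite -[RHS](deg_kunit d3 v) /= addn0 (eq_sym ord_max) -!addnA; congr (_ + _)%N.
    by rewrite addnC.
  + rewrite deg_attach_r // mem_map; last by move=> ? ? [].
    by rewrite addn0 mem_seq1 addnAC dg.
- split; first by move=> _ /mapP[v vr ->]; rewrite /= phir // L.
  by rewrite /= /kunit_pot eqxx (negbTE om) addr0 d2.
- have -> : energy d phi' = energy d (fun i : H => kunit_pot d%:R i)
     + energy d (fun v => phi v + d.+1%:R) - 2 * (d.-1%:R + d.+1%:R) * kunit_pot d%:R (ord_max : H).
    rewrite (@energy_attach _ _ p [:: b] ub spb R d phi' (d.-1%:R + d.+1%:R)).
      by rewrite /= big_seq1.
    by move=> v; rewrite mem_seq1 => /eqP ->; rewrite /= phib.
  rewrite energy_kunit // energy_shift en.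
  have dE v : d%:R - (deg v)%:R = (v \in r)%:R + (v == b)%:R :> R.
    by rewrite -[in d%:R](dg v) !natrD; lra.
  have S1 (F : g -> R) : \sum_v (d%:R - (deg v)%:R) * F v = \sum_(v <- r) F v + F b.
    under eq_bigr => v _ do rewrite dE mulrDl.
    rewrite big_split /= (big_uniq _ ur') [in RHS]big_mkcond /=; congr (_ + _).
      by apply: eq_bigr => v _; case: (_ \in _); rewrite ?mul1r ?mul0r.
    by rewrite (bigD1 b) //= eqxx mul1r big1 ?addr0 // => v /negbTE ->; rewrite mul0r.
  rewrite S1 phib.
  have -> : \sum_(v <- r) phi v = c%:R * (d.-1 + J * d.+1)%:R.
    rewrite big_seq (eq_bigr _ phir) -big_seq big_const_seq count_predT iter_addr_0 sr.
    by rewrite mulr_natl.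
  have -> : \sum_(v : g) (d%:R - (deg v)%:R) = c%:R + 1 :> R.
    under eq_bigr => v _ do rewrite -[_ - _]mulr1.
    by rewrite (S1 (fun=> 1)) big_const_seq count_predT iter_addr_0 sr.
  have -> : kunit_pot d%:R (ord_max : H) = d%:R + 1 :> R.
    by rewrite /kunit_pot eqxx eq_sym (negbTE om) subr0.
  rewrite L d2 d1; lra.
- move=> h h0; rewrite big_sumType /= L.
  have := ms (d.+1%:R + h); rewrite addr_ge0 // => /(_ isT).
  rewrite addrA => H1; apply: (le_trans H1).
  rewrite -[X in X <= _]add0r; apply: lerD; first by apply: sumr_ge0 => i _; rewrite sqr_ge0.
  by rewrite (eq_bigr (fun v => (phi v + d.+1%:R + h) ^+ 2)) // => v _; rewrite addrA.
Qed.

(** A leaf of potential 0 hung on [b] takes the role of the ground, so it adjusts the order by one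
    without changing the energy. *)
Lemma bottom_gadget (R : realFieldType) (d c J s : nat) (k : bool) :
  (3 <= d)%N -> odd d -> odd s = ~~ odd c -> (2 * d + c + 2 <= s)%N ->
  exists (g : graph) (r : seq g) (phi : g -> R),
  [/\ [/\ #|g| = (s + J * d.+1 + k)%N, conn g, uniq r & size r = c],
      (forall v : g, (deg v + (v \in r) <= d)%N),
      (exists2 v : g, v \notin r & (deg v < d)%N) /\ (exists v : g, (deg v + (v \in r))%N = d),
      (forall v, v \in r -> phi v = (d.-1 + J * d.+1)%:R) /\
      energy d phi = d.-1%:R * (d.-1 + J * d.+1)%:R + c%:R * (d.-1 + J * d.+1)%:R ^+ 2
    & s%:R * (d.-1 + J * d.+1)%:R ^+ 2 <= \sum_v phi v ^+ 2].
Proof.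
move=> d3 od os sl.
have [g [r [b [phi [[cg cong ur sr] dg [phir phib] en ms]]]]] := chain_gadget R J d3 od os sl.
have ms0 : s%:R * (d.-1 + J * d.+1)%:R ^+ 2 <= \sum_v phi v ^+ 2.
  have := ms 0 (lexx 0); rewrite addr0 => /le_trans -> //.
  by under eq_bigr => v _ do rewrite addr0.
have [br ur'] : b \notin r /\ uniq r by move: ur => /= /andP.
have [v0 v0b] : exists v0, v0 != b.
  apply/existsP; rewrite -[X in is_true X]negbK negb_exists; apply/negP => /forallP H.
  have : (#|g| <= 1)%N by apply/fintype_le1P => u v; move/eqP: (negbNE (H u)) (H v) => -> /negbNE/eqP.
  rewrite cg; lia.
have d0 : (deg v0 + (v0 \in r))%N = d by rewrite -[RHS](dg v0) (negbTE v0b) addn0.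
case: k; last first.
  exists g, r, phi; split => //; first by rewrite addn0.
    by move=> v; rewrite -[X in (_ <= X)%N](dg v) leq_addr.
  split; last by exists v0.
  by exists b => //; rewrite -[X in (_ < X)%N](dg b) eqxx (negbTE br) addn0 addn1.
have us : symmetric (fun _ _ : unit => false) by [].
have ui : irreflexive (fun _ : unit => fun _ : unit => false) by [].
pose g1 := Graph us ui; pose p : seq g1 := [:: tt].
have ub : uniq [:: b] by [].
have spb : size p = size [:: b] by [].
pose G := attach p [:: b].
pose phi' (v : G) : R := match v with inl i => 0 | inr v => phi v end.
exists G, [seq inr v | v <- r], phi'; split.
- split.
  + rewrite /= card_sum card_unit cg; lia.
  + by apply: conn_attach => // -[]; exists tt; rewrite ?connect0.
  + by rewrite map_inj_uniq // => ? ? [].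
  + by rewrite size_map.
- case=> v.
  + rewrite deg_attach_l // (_ : (_ \in _) = false) ?addn0; last by apply/negP => /mapP[].
    by rewrite /deg (eq_bigr (fun=> 0%N)) // big1_eq add0n; case: v => /=; lia.
  + rewrite deg_attach_r // mem_map; last by move=> ? ? [].
    by rewrite mem_seq1 addnAC dg.
- split.
    exists (inl tt); first by apply/negP => /mapP[].
    rewrite deg_attach_l // /deg (eq_bigr (fun=> 0%N)) // big1_eq /=; lia.
  exists (inr v0); rewrite deg_attach_r // mem_map; last by move=> ? ? [].
  by rewrite mem_seq1 addnAC dg.
- split; first by move=> _ /mapP[v vr ->]; rewrite /= phir.
  rewrite -en (@energy_attach _ _ p [:: b] ub spb R d phi' d.-1%:R).
    by rewrite /= big_seq1 mulr0 subr0 energy_cst expr0n mul0r add0r.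
  by move=> v; rewrite mem_seq1 => /eqP ->; rewrite /= phib.
- by rewrite big_sumType /= big1 ?add0r // => v _; rewrite expr0n.
Qed.

(** * Surgery on graphs *)

Section AddEdge.
Variables (g : graph) (u v : g).
Hypotheses (uv : u != v) (nuv : ~~ edge u v).

Definition add_edge_rel (a b : g) : bool :=
  [|| edge a b, (a == u) && (b == v) | (a == v) && (b == u)].

Lemma add_edge_sym : symmetric add_edge_rel.
Proof.
move=> a b; rewrite /add_edge_rel edge_sym; congr (_ || _).
by rewrite orbC andbC (andbC (a == u)).
Qed.

Lemma add_edge_irr : irreflexive add_edge_rel.
Proof.
move=> a; rewrite /add_edge_rel edge_irr /=.
case: (eqVneq a u) => [->|_] /=; first by rewrite (negbTE uv).
by rewrite andbF.
Qed.

Definition add_edge := Graph add_edge_sym add_edge_irr.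

Lemma add_edgeE (a b : g) :
  (add_edge_rel a b = edge a b + ((a == u) && (b == v)) + ((a == v) && (b == u)) :> nat)%N.
Proof.
rewrite /add_edge_rel.
case: (eqVneq a u) => [->|_] /=.
  rewrite (negbTE uv) /= orbF addn0.
  by case: (eqVneq b v) => [->|_]; rewrite ?(negbTE nuv) ?orbF ?addn0.
case: (eqVneq a v) => [->|_] /=; last by rewrite orbF !addn0.
by case: (eqVneq b u) => [->|_]; rewrite ?orbF ?addn0 // edge_sym (negbTE nuv).
Qed.

Lemma deg_add_edge (a : g) : deg (a : add_edge) = (deg a + (a == u) + (a == v))%N.
Proof.
rewrite /deg; under eq_bigr => b _ do rewrite /= add_edgeE.
rewrite !big_split /=; congr (_ + _ + _)%N.
  by rewrite (bigD1 v) //= eqxx andbT big1 ?addn0 // => b /negbTE ->; rewrite andbF.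
by rewrite (bigD1 u) //= eqxx andbT big1 ?addn0 // => b /negbTE ->; rewrite andbF.
Qed.

Lemma conn_add_edge : conn g -> conn add_edge.
Proof.
move=> cg a b; apply: (connect_sub _ (cg a b)) => c e ce.
by apply: connect1; rewrite /= /add_edge_rel ce.
Qed.

Lemma energy_add_edge (R : realFieldType) (d : nat) (y : g -> R) :
  energy (g := add_edge) d y = energy d y - 2 * (y u * y v).
Proof.
rewrite /energy.
have -> : \sum_(a : add_edge) \sum_b (edge a b)%:R * (y a * y b) =
  \sum_(a : g) \sum_b (edge a b)%:R * (y a * y b) + y u * y v + y v * y u.
  have P (k l : g) : \sum_(a : g) \sum_(b : g) ((a == k) && (b == l))%:R * (y a * y b)
     = y k * y l.
    rewrite (bigD1 k) //= [X in _ + X]big1 ?addr0.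
      rewrite (bigD1 l) //= !eqxx big1 ?addr0 ?mul1r // => w /negbTE ->.
      by rewrite mul0r.
    by move=> a /negbTE ->; rewrite big1 // => w _; rewrite mul0r.
  rewrite -!P -!big_split /=; apply: eq_bigr => a _.
  rewrite -!big_split /=; apply: eq_bigr => b _.
  by rewrite add_edgeE !natrD !mulrDl.
lra.
Qed.

End AddEdge.

Lemma size_sum_count (T : finType) (p : seq T) :
  size p = (\sum_(v : T) count_mem v p)%N.
Proof.
elim: p => [|a p IH] /=; first by rewrite big1.
rewrite big_split /= -IH (bigD1 a) //= eqxx big1 ?addn0 // => b.
by rewrite eq_sym => /negbTE ->.
Qed.

(* [p] lists the vertices that need more edges, with multiplicity. Edges are added inside [p]
   until the vertices still needing edges form a clique, hence a bounded list [q]. *)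
Lemma fill_slots (R : realFieldType) (d : nat) (g : graph) (p : seq g) (y : g -> R) (w h : R) :
  (0 < d)%N -> conn g -> (forall v : g, (deg v + count_mem v p <= d)%N) -> (0 < size p)%N ->
  (forall v, v \in p -> `|y v - w| <= h) ->
  exists (e : rel g) (es : symmetric e) (ei : irreflexive e) (q : seq g),
  [/\ conn (Graph es ei),
      forall v : g, (deg (v : Graph es ei) + count_mem v q = deg v + count_mem v p)%N,
      (0 < size q <= d.+1 * d)%N /\ odd (size q) = odd (size p),
      (size q <= size p)%N /\ {subset q <= p}
    & energy (g := Graph es ei) d y - \sum_(v <- q) y v ^+ 2 <=
      energy d y - \sum_(v <- p) y v ^+ 2 + 2 * h ^+ 2 * (size p - size q)%:R].
Proof.
move=> d0; move: {2}(size p) (leqnn (size p)) => N.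
elim: N g p y => [|N IH] g p y sN cg dp p0 yp; first by lia.
have [sp|sp] := leqP (size p) (d.+1 * d).
  exists edge, (@edge_sym g), (@edge_irr g), p; split => //.
  - by rewrite p0 sp.
  - by split.
  - by rewrite subnn mulr0 addr0.
have [u up] : exists u, u \in p by case: (p) p0 => // u *; exists u; rewrite mem_head.
(* Otherwise every entry of [p] is [u] or a neighbour of [u]. These are at most [d.+1] vertices,
   each listed at most [d] times, so [p] would already be short. *)
have [v /and3P[vp uv nuv]] : exists v, [&& v \in p, u != v & ~~ edge u v].
  apply/existsP; apply: contraLR sp; rewrite negb_exists -leqNgt => /forallP H.
  have sub v : v \in p -> (u == v) || edge u v.
    by move=> vp; have := H v; rewrite vp /= negb_and !negbK.
  rewrite size_sum_count.
  apply: (@leq_trans (\sum_(v : g) ((u == v) + edge u v) * d)%N).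
    apply: leq_sum => v _; have [vp|vp] := boolP (v \in p); last first.
      by rewrite (count_memPn vp).
    have := dp v; have := sub v vp; case: (u == v); case: (edge u v) => //= _; lia.
  rewrite -big_distrl /= leq_mul2r; apply/orP; right.
  rewrite big_split /= -/(deg u) (bigD1 u) //= eqxx big1.
    by have := dp u; lia.
  by move=> v; rewrite eq_sym => /negbTE ->.
pose g' := add_edge uv.
have vr : v \in rem u p.
  by rewrite -has_pred1 has_count count_rem up /= (negbTE uv) subn0 -has_count has_pred1.
pose p' := rem v (rem u p).
have pp : perm_eq p (u :: v :: p').
  by apply: (perm_trans (perm_to_rem up)); rewrite perm_cons; apply: perm_to_rem.
have spp : size p = (size p').+2 by rewrite (perm_size pp).
have cp a : count_mem a p = ((u == a) + (v == a) + count_mem a p')%N.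
  by rewrite (permP pp) /= addnA.
have sub' a : a \in p' -> a \in p by move=> ap; rewrite (perm_mem pp) !in_cons ap !orbT.
have d2 : (2 <= d.+1 * d)%N by case: (d) d0 => // k _; rewrite mulnS mulSn; lia.
have cg' : conn g' by exact: conn_add_edge.
have sN' : (size p' <= N)%N by lia.
have s0' : (0 < size p')%N by lia.
have dp' a : (deg (a : g') + count_mem a p' <= d)%N.
  by have := dp a; rewrite (deg_add_edge uv nuv) cp (eq_sym u) (eq_sym v) !addnA.
have yp' a : a \in p' -> `|y a - w| <= h by move=> /sub'; exact: yp.
have [e [es [ei [q [c1 c2 [c3 c3'] [c4 c4'] c5]]]]] :=
  IH g' p' y sN' cg' dp' s0' yp'.
exists e, es, ei, q; split => //.
- by move=> a; rewrite c2 (deg_add_edge uv nuv) cp (eq_sym u) (eq_sym v) !addnA.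
- by split; rewrite // c3' spp /= negbK.
- split; last by move=> a /c4'/sub'.
  by rewrite spp (leq_trans c4) // ltnW.
apply: (le_trans c5); rewrite (energy_add_edge uv nuv) (perm_big _ pp) /= !big_cons.
have -> : (size p - size q)%:R = (size p' - size q)%:R + 2 :> R.
  by rewrite -natrD spp -addn2 addnBAC.
(* The new edge and the two used slots together change the left side by exactly [(y u - y v) ^+ 2].
   Two entries leave the list, hence the allowance [2 * h ^+ 2] for each. *)
have : (y u - y v) ^+ 2 <= 4 * h ^+ 2.
  have := yp u up; have := yp v (mem_rem vr).
  rewrite !ler_norml => /andP[H1 H2] /andP[H3 H4].
  have H0 : 0 <= h by lra.
  rewrite -[4 * _](_ : (2 * h) ^+ 2 = _); last by lra.
  nra.
lra.
Qed.

Lemma count_mem_seq (T : finType) (s : T -> nat) :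
  exists p : seq T, forall v, count_mem v p = s v.
Proof.
exists (flatten [seq nseq (s v) v | v <- enum T]) => v.
rewrite count_flatten -map_comp sumnE big_map big_enum /= (bigD1 v) //=.
rewrite count_nseq /= eqxx mul1n big1 ?addn0 // => w /negbTE wv.
by rewrite count_nseq /= wv.
Qed.

Lemma big_count_mem (R : pzRingType) (T : finType) (p : seq T) (F : T -> R) :
  \sum_(v <- p) F v = \sum_v (count_mem v p)%:R * F v.
Proof.
elim: p => [|a p IH] /=; first by rewrite big_nil big1 // => v _; rewrite mul0r.
under [RHS]eq_bigr => v _ do rewrite natrD mulrDl.
rewrite big_cons big_split /= -IH; congr (_ + _).
by rewrite (bigD1 a) //= eqxx mul1r big1 ?addr0 // => v; rewrite eq_sym => /negbTE ->; rewrite mul0r.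
Qed.

Section Induced.
Variables (g : graph) (A : {set g}).

Definition induced_edge (a b : {v | v \in A}) : bool := edge (val a) (val b).

Lemma induced_edge_sym : symmetric induced_edge.
Proof. by move=> a b; rewrite /induced_edge edge_sym. Qed.

Lemma induced_edge_irr : irreflexive induced_edge.
Proof. by move=> a; rewrite /induced_edge edge_irr. Qed.

Definition induced := Graph induced_edge_sym induced_edge_irr.

Lemma card_induced : #|induced| = #|A|.
Proof. by rewrite card_sig; apply: eq_card. Qed.

Lemma deg_induced (a : induced) : (deg a + \sum_(w in ~: A) edge (val a) w)%N = deg (val a).
Proof.
rewrite /deg -(big_sub A (fun w => edge (val a) w : nat)).
rewrite [RHS](bigID (mem A)) /=; congr (_ + _)%N.
by apply: eq_bigl => w; rewrite inE.
Qed.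

Lemma sum_induced (R : nmodType) (F : g -> R) :
  \sum_(v : induced) F (val v) = \sum_(v in A) F v.
Proof. by rewrite [RHS]big_sub. Qed.

Lemma energy_induced (R : realFieldType) d (y : g -> R) :
  energy d (fun v : induced => y (val v)) =
    d%:R * (\sum_(v in A) y v ^+ 2) - \sum_(v in A) \sum_(w in A) (edge v w)%:R * (y v * y w).
Proof.
rewrite /energy (sum_induced (fun v => y v ^+ 2)); congr (_ - _).
rewrite -(sum_induced (fun v => \sum_(w in A) (edge v w)%:R * (y v * y w))).
by apply: eq_bigr => v _; rewrite -(sum_induced (fun w => (edge (val v) w)%:R * (y (val v) * y w))).
Qed.

(** Connectivity is phrased by exits from sets because this is what [escape] supplies. *)
Lemma conn_induced (a0 : g) : a0 \in A ->
  (forall S : {set g}, S \subset A -> S != set0 -> a0 \notin S ->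
     exists u v, [/\ u \in S, v \in A :\: S & edge u v]) ->
  conn induced.
Proof.
move=> a0A H.
pose b0 : induced := exist _ a0 a0A.
suff K (v : induced) : connect edge v b0.
  by move=> u v; apply: (connect_trans (K u)); rewrite edge_connect_sym.
apply: contraT => nv.
pose S := [set val w | w : induced & ~~ connect edge w b0].
have [|||u [w [uS]]] := H S.
- by apply/subsetP => _ /imsetP[w _ ->]; exact: (valP w).
- by apply/set0Pn; exists (val v); apply: imset_f; rewrite inE.
- apply/imsetP => -[w]; rewrite inE => nw e; case/negP: nw.
  by rewrite (_ : w = b0) ?connect0 //; apply: val_inj.
case/imsetP: uS => a; rewrite inE => na ->; rewrite inE => /andP[wS wA] e.
case/negP: wS; apply/imsetP; exists (exist _ w wA) => //; rewrite inE.
apply: contra na => /(connect_trans _); apply.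
by apply: connect1.
Qed.

End Induced.

(** In the energy of the induced graph the lost edges count as edges to the ground. Once these are
    subtracted, only some of the nonnegative terms of [energy_edges] for [g] remain. *)
Lemma energy_induced_le (R : realFieldType) d (g : graph) (A : {set g}) (y : g -> R) :
  (forall v : g, (deg v <= d)%N) ->
  energy d (fun v : induced A => y (val v))
    - \sum_(v in A) (\sum_(w in ~: A) edge v w)%:R * y v ^+ 2 <= energy d y.
Proof.
move=> dd; rewrite !energy_edges.
set S := 2^-1 * _; set S' := 2^-1 * _.
have h2 : (0 : R) <= 2^-1 by rewrite invr_ge0.
have SS : S <= S'.
  rewrite /S /S' ler_wpM2l //.
  rewrite (sum_induced A (fun v => \sum_(w : induced A) (edge v (val w))%:R * (y v - y (val w)) ^+ 2)).
  rewrite [leRHS](bigID (mem A)) /= -[leLHS]addr0 lerD //; last first.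
    by do 2! (apply: sumr_ge0 => ? _); rewrite mulr_ge0 ?ler0n ?sqr_ge0.
  apply: ler_sum => v _.
  rewrite (sum_induced A (fun w => (edge v w)%:R * (y v - y w) ^+ 2)).
  rewrite [leRHS](bigID (mem A)) /= -[leLHS]addr0 lerD //.
  by apply: sumr_ge0 => ? _; rewrite mulr_ge0 ?ler0n ?sqr_ge0.
suff : \sum_(v : induced A) (d%:R - (deg v)%:R) * y (val v) ^+ 2
   - \sum_(v in A) (\sum_(w in ~: A) edge v w)%:R * y v ^+ 2
   <= \sum_v (d%:R - (deg v)%:R) * y v ^+ 2 by lra.
rewrite -(sum_induced A (fun v => (\sum_(w in ~: A) edge v w)%:R * y v ^+ 2)) -sumrB.
rewrite [leRHS](bigID (mem A)) /= -[leLHS]addr0 lerD //; last first.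
  by apply: sumr_ge0 => v _; rewrite mulr_ge0 ?sqr_ge0 // subr_ge0 ler_nat.
rewrite -(sum_induced A (fun v => (d%:R - (deg v)%:R) * y v ^+ 2)).
by apply: ler_sum => v _; rewrite -mulrBl -deg_induced natrD opprD addrA.
Qed.

(* The plateau [U] of a potential is replaced by a gadget with [j] vertices. *)
Lemma top_replace (R : realFieldType) (d : nat) (g : graph) (U : {set g}) (v0 : g)
    (y : g -> R) (w h : R) (j : nat) :
  (3 <= d)%N -> odd d -> conn g -> (forall v : g, (deg v <= d)%N) ->
  U != set0 -> ~: U != set0 -> conn (induced (~: U)) ->
  (forall u v, u \in U -> v \notin U -> edge u v -> `|y v - w| <= h) ->
  odd j = odd (\sum_(v in ~: U) \sum_(u in U) edge v u) ->
  (2 * d + d.+1 * d + 1 <= j)%N ->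
  v0 \notin U -> (deg v0 < d)%N ->
  exists (g' : graph) (y' : g' -> R),
  [/\ #|g'| = (#|~: U| + j)%N, conn g', forall v : g', (deg v <= d)%N,
      (exists v : g', deg v = deg v0 /\ y' v = y v0) /\ (exists v : g', deg v = d)
    & \sum_v y' v ^+ 2 = \sum_(v in ~: U) y v ^+ 2 + j%:R * w ^+ 2 /\
      energy d y' <= energy d y + 3 * h ^+ 2 * (d * #|U|)%:R].
Proof.
move=> d3 od cg dg U0 U1 cA yU oj jl v0U v0d.
pose A := ~: U; pose H := induced A.
pose c (v : H) : nat := (\sum_(u in U) edge (val v) u)%N.
have [p pc] := count_mem_seq c.
have degH v : (deg v + c v)%N = deg (val v).
  by rewrite -deg_induced; congr (_ + _)%N; apply: eq_bigl => u; rewrite !inE negbK.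
have sp : size p = (\sum_(v in ~: U) \sum_(u in U) edge v u)%N.
  by rewrite size_sum_count -(sum_induced A (fun v => (\sum_(u in U) edge v u)%N)); apply: eq_bigr => v _.
have spU : (size p <= d * #|U|)%N.
  rewrite sp exchange_big /= mulnC -sum_nat_const; apply: leq_sum => u _.
  apply: leq_trans (dg u); rewrite /deg [leqRHS](bigID (mem (~: U))) /=.
  by rewrite -[leqLHS]addn0 leq_add // leq_eqVlt; apply/orP; left; apply/eqP; apply: eq_bigr => v _; rewrite edge_sym.
have yp v : v \in p -> `|y (val v) - w| <= h.
  rewrite -has_pred1 has_count pc /c => H1.
  have [u uU e] : exists2 u, u \in U & edge (val v) u.
    apply/exists_inP; apply: contraLR H1 => /exists_inPn H1; rewrite -leqNgt leqn0.
    by rewrite big1 // => u /H1/negbTE ->.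
  by apply: (yU u) => //; [have := valP v; rewrite inE | rewrite edge_sym].
have p0 : (0 < size p)%N.
  have [u0 u0U] := set0Pn _ U0; have [a0 a0A] := set0Pn _ U1.
  have /connectP[s ps las] := cg a0 u0.
  have [b [e [bA eU be]]] : exists b e, [/\ b \in A, e \in U & edge b e].
    elim: s a0 a0A ps las => [|b s IH] a aA /=.
      by move=> _ e; move: aA; rewrite inE -e u0U.
    case/andP=> ab ps las; have [bU|bU] := boolP (b \in U); first by exists a, b.
    by apply: (IH b) => //; rewrite inE.
  by rewrite sp (bigD1 b) //= (bigD1 e) //= be ltn_addr // ltn_addr.
have h0 : 0 <= h by case: (p) p0 yp => // v s _ H1; exact: le_trans (normr_ge0 _) (H1 v (mem_head _ _)).
have d0 : (0 < d)%N by apply: leq_trans d3.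
have dc v : (deg v + count_mem v p <= d)%N by rewrite pc degH.
(* The number of cut edges may be as large as [d * #|U|], too many for a gadget on [j] vertices. So
   slots are first joined to each other until at most [d.+1 * d] are left; the parity of their
   number survives, and the gadget exists. *)
have [e [es [ei [q [c1 c2 [/andP[c3 c3'] c3''] [c4 qp] c5]]]]] :=
  fill_slots (y := fun v : H => y (val v)) d0 cA dc p0 yp.
pose H' := Graph es ei.
have [||t [r [ct cont ur sr dt]]] := @gadget d (size q) j d3 od; first by rewrite c3'' sp.
  by lia.
have sqr : @size H' q = size r by rewrite sr.
pose G' := attach (q : seq H') r.
pose y' (v : G') : R := match v with inl v => y (val v) | inr _ => w end.
have dl (v : H) : deg (inl v : G') = deg (val v).
  by rewrite (deg_attach_l ur sqr) [LHS]c2 pc degH.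
exists G', y'; split.
- by rewrite /= card_sum card_induced ct.
- apply: conn_attach => // v; case: (q) c3 => // a q' _; exists a; first by rewrite mem_head.
  exact: c1.
- by case=> v; [rewrite dl | rewrite (deg_attach_r ur sqr) dt].
- split.
    have v0A : v0 \in A by rewrite inE.
    by exists (inl (exist _ v0 v0A)); rewrite dl.
  have b : t by case: (pickP (mem t)) => // t0; move: ct; rewrite (eq_card0 t0); lia.
  by exists (inr b); rewrite (deg_attach_r ur sqr) dt.
- split.
    rewrite big_sumType /= (sum_induced A (fun v => y v ^+ 2)) sumr_const.
    by rewrite (_ : #|_| = j) // mulr_natl.
  rewrite (@energy_attach _ _ _ _ ur sqr R d y' w) //= energy_cst.
  have -> : \sum_(v : t) (d%:R - (deg v)%:R) = (size q)%:R :> R.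
    rewrite -sr -sum1_size natr_sum (big_uniq _ ur) [RHS]big_mkcond /=; apply: eq_bigr => v _.
    by rewrite -[in d%:R](dt v) natrD addrAC subrr add0r; case: (_ \in _).
  have := energy_induced_le A y dg.
  have -> : \sum_(v in A) (\sum_(w0 in ~: A) edge v w0)%:R * y v ^+ 2 = \sum_(v <- p) y (val v) ^+ 2.
    rewrite -(sum_induced A (fun v => (\sum_(w0 in ~: A) edge v w0)%:R * y v ^+ 2)) [RHS]big_count_mem.
    apply: eq_bigr => v _; rewrite pc; congr (_%:R * _); rewrite /c.
    by rewrite setCK.
  move=> E1.
  have E2 : \sum_(v <- q) (y (val v) - w) ^+ 2 <= (size q)%:R * h ^+ 2.
    rewrite -[in leRHS]sum1_size natr_sum mulr_suml !big_seq; apply: ler_sum => v /qp /yp.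
    by rewrite mul1r -(real_normK (num_real _)) => H1; rewrite ler_sqr ?nnegrE.
  have E3 : \sum_(v <- q) (y (val v) - w) ^+ 2 = \sum_(v <- q) y (val v) ^+ 2
     - 2 * w * (\sum_(v <- q) y (val v)) + w ^+ 2 * (size q)%:R.
    rewrite -[in (size q)%:R]sum1_size natr_sum !mulr_sumr -sumrB -big_split /=.
    by apply: eq_bigr => v _; lra.
  have E4 : (size q)%:R + (size p - size q)%:R = (size p)%:R :> R by rewrite -natrD subnKC.
  have E5 : h ^+ 2 * (size p)%:R <= h ^+ 2 * (d * #|U|)%:R.
    by rewrite ler_wpM2l ?sqr_ge0 // ler_nat.
  have E6 : 0 <= h ^+ 2 * (size q)%:R by rewrite mulr_ge0 ?sqr_ge0.
  have E7 : 0 <= h ^+ 2 * (size p - size q)%:R by rewrite mulr_ge0 ?sqr_ge0.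
  have E8 : h ^+ 2 * (size p)%:R = h ^+ 2 * (size q)%:R + h ^+ 2 * (size p - size q)%:R.
    by rewrite -E4 mulrDr.
  rewrite (_ : 2 * h ^+ 2 * _ = 2 * (h ^+ 2 * (size p - size q)%:R)) in c5; last by lra.
  lra.
Qed.

(** * The eigenvector of an extremal graph *)

Lemma conn_crossing (g : graph) (S : {set g}) : conn g -> S != set0 -> ~: S != set0 ->
  exists u v, [/\ u \in S, v \notin S & edge u v].
Proof.
move=> cg /set0Pn[a0 a0S] /set0Pn[u0]; rewrite inE => u0S.
have /connectP[s ps las] := cg a0 u0.
elim: s a0 a0S ps las => [|b s IH] a aS /= ps las; first by rewrite las aS in u0S.
case/andP: ps => ab ps; have [bS|bS] := boolP (b \in S); first exact: (IH b).
by exists a, b.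
Qed.

Lemma odd_degree_sum (g : graph) (S : {set g}) :
  odd (\sum_(u in S) \sum_(v in S) edge u v) = false.
Proof.
pose lt (u v : g) := (enum_rank u < enum_rank v)%N.
have -> : (\sum_(u in S) \sum_(v in S) edge u v =
  \sum_(u in S) \sum_(v in S) (edge u v && lt u v) + \sum_(u in S) \sum_(v in S) (edge u v && lt v u))%N.
  rewrite -big_split /=; apply: eq_bigr => u _; rewrite -big_split /=; apply: eq_bigr => v _.
  rewrite /lt; have [e|e|e] := ltngtP (enum_rank u) (enum_rank v); rewrite ?andbT ?andbF ?addn0 //.
  by move/val_inj/enum_rank_inj: e => ->; rewrite edge_irr.
rewrite [X in (_ + X)%N]exchange_big /=.
have -> : (\sum_(v in S) \sum_(u in S) (edge u v && lt v u) = \sum_(u in S) \sum_(v in S) (edge u v && lt u v))%N.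
  by apply: eq_bigr => u _; apply: eq_bigr => v _; rewrite edge_sym.
by rewrite addnn odd_double.
Qed.

(** A handshake count inside [S]. It verifies the parity hypothesis of [top_replace], where the
    order of the new plateau must match the number of cut edges. *)
Lemma odd_boundary (g : graph) (S : {set g}) :
  odd (\sum_(v in ~: S) \sum_(u in S) edge v u) = odd (\sum_(u in S) deg u).
Proof.
have -> : (\sum_(u in S) deg u = \sum_(u in S) \sum_(v in S) edge u v + \sum_(v in ~: S) \sum_(u in S) edge v u)%N.
  rewrite [X in (_ + X)%N]exchange_big /= -big_split /=; apply: eq_bigr => u _.
  rewrite /deg (bigID (mem S)) /=; congr (_ + _)%N.
  by apply: eq_big => [v|v _]; rewrite ?inE // edge_sym.
by rewrite oddD odd_degree_sum.
Qed.

Lemma add_leaf (R : realFieldType) (d : nat) (g : graph) (v0 : g) (y : g -> R) (c : R) :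
  (3 <= d)%N -> conn g -> (forall v : g, (deg v <= d)%N) -> (deg v0 < d)%N ->
  (exists v : g, deg v = d) ->
  exists (g' : graph) (y' : g' -> R),
  [/\ #|g'| = #|g|.+1, conn g', forall v : g', (deg v <= d)%N,
      (exists v : g', (deg v < d)%N) /\ (exists v : g', deg v = d)
    & \sum_v y' v ^+ 2 = c ^+ 2 + \sum_v y v ^+ 2 /\
      energy d y' = energy d y + d%:R * c ^+ 2 - 2 * c * y v0].
Proof.
move=> d3 cg dg v0d [v1 v1d].
have us : symmetric (fun _ _ : unit => false) by [].
have ui : irreflexive (fun _ : unit => fun _ : unit => false) by [].
pose g1 := Graph us ui; pose p : seq g1 := [:: tt].
have ub : uniq [:: v0] by [].
have spb : size p = size [:: v0] by [].
pose G := attach p [:: v0].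
pose y' (v : G) : R := match v with inl i => c | inr v => y v end.
have d1 (i : g1) : deg i = 0%N by rewrite /deg big1.
have dl i : deg (inl i : G) = 1%N by rewrite deg_attach_l // d1; case: i.
have dr v : deg (inr v : G) = (deg v + (v == v0))%N by rewrite deg_attach_r // mem_seq1.
exists G, y'; split.
- by rewrite /= card_sum card_unit.
- by apply: conn_attach => // -[]; exists tt; rewrite ?connect0.
- case=> v; first by rewrite dl; lia.
  by rewrite dr; case: eqP => [->|_]; rewrite ?addn1 ?addn0.
- split; first by exists (inl tt); rewrite dl; lia.
  exists (inr v1); rewrite dr; case: eqP => [e|_]; rewrite ?addn0 //.
  by move: v0d; rewrite -e v1d ltnn.
- split; first by rewrite big_sumType /= sumr_const card_unit mulr1n.
  rewrite (@energy_attach _ _ p [:: v0] ub spb R d y' (y v0)); last first.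
    by move=> v; rewrite mem_seq1 => /eqP ->.
  rewrite /= big_seq1 energy_cst; under eq_bigr => v _ do rewrite d1 subr0.
  rewrite sumr_const card_unit mulr1n; lra.
Qed.

(** The whole gadget sits at potential [y u], so the drop of the old edge reappears on the edge into
    [v] and the energy is unchanged, while [j] vertices of value [y u] are gained. *)
Lemma insert_gadget (R : realFieldType) (d : nat) (g : graph) (u v v0 : g) (y : g -> R) (j : nat) :
  (3 <= d)%N -> odd d -> conn g -> (forall v : g, (deg v <= d)%N) -> edge u v ->
  ~~ odd j -> (2 * d + 3 <= j)%N ->
  exists (g' : graph) (y' : g' -> R),
  [/\ #|g'| = (#|g| + j)%N, conn g', forall v : g', (deg v <= d)%N,
      (exists v : g', deg v = deg v0 /\ y' v = y v0) /\ (exists v : g', deg v = d)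
    & \sum_v y' v ^+ 2 = \sum_v y v ^+ 2 + j%:R * y u ^+ 2 /\ energy d y' = energy d y].
Proof.
move=> d3 od cg dg uv oj jl.
have nuv : u != v by apply: contraTneq uv => ->; rewrite edge_irr.
pose e (a b : g) := [&& edge a b, ~~ ((a == u) && (b == v)) & ~~ ((a == v) && (b == u))].
have es : symmetric e.
  move=> a b; rewrite /e edge_sym; congr (_ && _).
  by case: (a == u); case: (b == v); case: (a == v); case: (b == u).
have ei : irreflexive e by move=> a; rewrite /e edge_irr.
pose H := Graph es ei.
have huv : ~~ @edge H u v by rewrite /= /e !eqxx andbF.
have eE (a b : g) : edge a b = add_edge_rel (u : H) v a b.
  rewrite /add_edge_rel /= /e.
  case: (eqVneq a u) => [->|_] /=.
    by case: (eqVneq b v) => [->|_] /=; rewrite ?uv ?(negbTE nuv) ?orbT ?orbF ?andbT.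
  case: (eqVneq a v) => [->|_] /=; last by rewrite orbF andbT.
  by case: (eqVneq b u) => [->|_] /=; rewrite ?orbT ?orbF ?andbT // edge_sym uv.
have dE (a : g) : deg a = (deg (a : H) + (a == u) + (a == v))%N.
  rewrite -(deg_add_edge (g := H) nuv huv a) /deg; apply: eq_bigr => b _.
  by rewrite eE.
have enE : energy d y = energy (g := H) d y - 2 * (y u * y v).
  rewrite -(energy_add_edge (g := H) nuv huv) /energy; congr (_ - _).
  by apply: eq_bigr => a _; apply: eq_bigr => b _; rewrite eE.
have [||t [r [ct cont ur sr dt]]] := @gadget d 2 j d3 od; first exact: negbTE.
  by rewrite -addnA.
pose p : seq H := [:: u; v].
have spr : size p = size r by rewrite sr.
pose G' := attach p r.
pose y' (a : G') : R := match a with inl a => y a | inr _ => y u end.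
have dl (a : H) : deg (inl a : G') = deg (a : g).
  by rewrite (deg_attach_l ur spr) dE /= addn0 (eq_sym u) (eq_sym v) addnA.
exists G', y'; split.
- by rewrite /= card_sum ct.
- apply: conn_attach => // a.
  have /connectP[s ps las] := cg a u.
  elim: s a ps las => [|b s IH] a /=.
    by move=> _ <-; exists u; rewrite ?mem_head ?connect0.
  case/andP=> ab ps las; have [c cp bc] := IH b ps las.
  have [e1|] := boolP (e a b).
    by exists c => //; apply: connect_trans bc; exact: connect1.
  rewrite /e ab /= negb_and !negbK => /orP[/andP[/eqP -> _]|/andP[/eqP -> _]].
    by exists u; rewrite ?mem_head ?connect0.
  by exists v; rewrite ?connect0 // !inE eqxx orbT.
- by case=> a; [rewrite dl | rewrite (deg_attach_r ur spr) dt].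
- split; first by exists (inl v0); rewrite dl.
  have b : t by case: (pickP (mem t)) => // t0; move: ct; rewrite (eq_card0 t0); lia.
  by exists (inr b); rewrite (deg_attach_r ur spr) dt.
- split; first by rewrite big_sumType /= sumr_const (_ : #|_| = j) // mulr_natl.
  rewrite (@energy_attach _ _ _ _ ur spr R d y' (y u)) //= energy_cst.
  have -> : \sum_(v : t) (d%:R - (deg v)%:R) = 2 :> R.
    rewrite -sr -sum1_size natr_sum (big_uniq _ ur) [RHS]big_mkcond /=; apply: eq_bigr => a _.
    by rewrite -[in d%:R](dt a) natrD addrAC subrr add0r; case: (_ \in _).
  rewrite enE !big_cons big_nil; lra.
Qed.

Section Eigen.
Variables (R : realFieldType) (d : nat) (G : graph) (x : G -> R) (mu : R) (z : G).
Hypotheses (xpos : forall v, 0 < x v) (dG : forall v : G, (deg v <= d)%N) (cG : conn G).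
Hypothesis eig : forall v, d%:R * x v - \sum_w (edge v w)%:R * x w = mu * x v.
Hypotheses (mu0 : 0 < mu) (zmax : forall v, x v <= x z).

(** Sum the eigenvalue equation over [S]: edges inside [S] cancel in pairs, so what the sources in
    [S] produce leaves through missing edges or across the boundary. *)
Lemma flow (S : {set G}) :
  mu * \sum_(v in S) x v = \sum_(v in S) (d%:R - (deg v)%:R) * x v
    + \sum_(v in S) \sum_(w in ~: S) (edge v w)%:R * (x v - x w).
Proof.
have E v : mu * x v = (d%:R - (deg v)%:R) * x v + \sum_w (edge v w)%:R * (x v - x w).
  rewrite -eig; under [in RHS]eq_bigr => w _ do rewrite mulrBr.
  rewrite sumrB -mulr_suml -natr_sum -/(deg v); lra.
rewrite mulr_sumr; under eq_bigr => v _ do rewrite E.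
rewrite big_split /=; congr (_ + _).
have -> : \sum_(v in S) \sum_w (edge v w)%:R * (x v - x w) =
   \sum_(v in S) \sum_(w in S) (edge v w)%:R * (x v - x w) + \sum_(v in S) \sum_(w in ~: S) (edge v w)%:R * (x v - x w).
  rewrite -big_split /=; apply: eq_bigr => v _; rewrite (bigID (mem S)) /=; congr (_ + _).
  by apply: eq_bigl => w; rewrite inE.
set Z := (X in X + _ = _); suff -> : Z = 0 by rewrite add0r.
have : Z = - Z.
  rewrite {1}/Z exchange_big /= /Z -sumrN; apply: eq_bigr => v _.
  rewrite -sumrN; apply: eq_bigr => w _; rewrite edge_sym; lra.
lra.
Qed.

Definition outflow := mu * \sum_v x v.
Local Notation F0 := outflow.

Lemma outflowE : F0 = \sum_v (d%:R - (deg v)%:R) * x v.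
Proof.
have := flow setT; rewrite (_ : \sum_(v in setT) x v = \sum_v x v); last first.
  by apply: eq_bigl => v; rewrite inE.
rewrite -/outflow => ->; rewrite [X in _ + X]big1 ?addr0; last first.
  by move=> v _; rewrite big1 // => w; rewrite setCT inE.
by apply: eq_bigl => v; rewrite inE.
Qed.

Lemma outflow_ge0 : 0 <= F0.
Proof. by rewrite mulr_ge0 ?(ltW mu0) // sumr_ge0 // => v _; rewrite ltW. Qed.

Lemma sub_outflow (S : {set G}) : mu * \sum_(v in S) x v <= F0.
Proof.
rewrite /outflow ler_wpM2l ?(ltW mu0) // [leRHS](bigID (mem S)) /= -[leLHS]addr0 lerD //.
by apply: sumr_ge0 => v _; rewrite ltW.
Qed.

Lemma deficient_le_outflow v : (deg v < d)%N -> x v <= F0.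
Proof.
move=> dv; rewrite outflowE (bigD1 v) //= -[leLHS]addr0 lerD //.
  have d1 : 1 <= d%:R - (deg v)%:R :> R by rewrite -natrB ?(ltnW dv) // ler1n subn_gt0.
  by apply: ler_peMl => //; exact: ltW.
by apply: sumr_ge0 => w _; rewrite mulr_ge0 ?(ltW (xpos _)) // subr_ge0 ler_nat.
Qed.

Lemma flow_edge (S : {set G}) u v : u \in S -> v \notin S -> edge u v ->
  (forall a b, a \in S -> b \notin S -> edge a b -> x b <= x a) ->
  x u - x v <= mu * \sum_(a in S) x a.
Proof.
move=> uS vS uv H; rewrite flow -[leLHS]add0r lerD //.
  by apply: sumr_ge0 => w _; rewrite mulr_ge0 ?(ltW (xpos _)) // subr_ge0 ler_nat.
have T a b : a \in S -> b \in ~: S -> 0 <= (edge a b)%:R * (x a - x b).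
  move=> aS; rewrite inE => bS; case e : (edge a b); rewrite ?mul0r // mul1r subr_ge0.
  exact: H.
rewrite (bigD1 u) //= -[leLHS]addr0 lerD //; last first.
  by apply: sumr_ge0 => a /andP[aS _]; apply: sumr_ge0 => b bS; exact: T.
rewrite (bigD1 v) ?inE //= uv mul1r -[leLHS]addr0 lerD //.
by apply: sumr_ge0 => b /andP[bS _]; exact: T.
Qed.

(** Vertices of full degree have no direct way to the ground, so the current they produce leaves [S]
    along a descending edge. From outside a set of top vertices such an edge cannot enter it, and
    therefore cutting out that set keeps the rest connected. *)
Lemma escape (S : {set G}) : S != set0 -> (forall v, v \in S -> deg v = d) ->
  exists u v, [/\ u \in S, v \notin S, edge u v & x v < x u].
Proof.
move=> /set0Pn[s sS] dS.
have pos : 0 < \sum_(v in S) \sum_(w in ~: S) (edge v w)%:R * (x v - x w).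
  have := flow S; rewrite [X in _ = X + _]big1 ?add0r; last by move=> v /dS ->; rewrite subrr mul0r.
  move=> <-; rewrite mulr_gt0 // (bigD1 s) //= ltr_pwDl // sumr_ge0 // => v _.
  exact: ltW.
have [/exists_inP[u uS /exists_inP[v vS /andP[e l]]]|] :=
    boolP [exists u in S, exists v in ~: S, edge u v && (x v < x u)].
  by exists u, v; split => //; rewrite inE in vS.
move/exists_inPn => H; move: pos; rewrite ltNge => /negP[].
apply: sumr_le0 => u uS; apply: sumr_le0 => v vS.
have /exists_inPn /(_ v vS) := H u uS; case: (edge u v) => /=; rewrite ?mul0r // mul1r.
by rewrite -leNgt subr_le0.
Qed.

(** Some edge leaves the set of the [j] top vertices, and its drop is at most the current produced
    inside, [mu * j * x z]. Adding up these losses stays below [mu * x z * j ^ 2], so a plateau of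
    bounded size is almost flat. *)
Lemma top_set (j : nat) : (j < #|G|)%N -> exists U : {set G},
  [/\ #|U| = j, forall u v, u \in U -> v \notin U -> x v <= x u
   & forall u, u \in U -> x z - x u <= mu * x z * (j ^ 2)%:R].
Proof.
elim: j => [|j IH] jn.
  by exists set0; rewrite cards0; split => // u; rewrite inE.
have [U [cU topU etaU]] := IH (ltnW jn).
have mx : 0 <= mu * x z by rewrite mulr_ge0 ?ltW.
have [c0 c0U] : exists c0, c0 \in ~: U.
  by apply/set0Pn; rewrite -card_gt0 cardsCs setCK cU; lia.
have c0U' : c0 \notin U by rewrite inE in c0U.
have [v vU vmax] : exists2 v, v \notin U & forall w, w \notin U -> x w <= x v.
  have [v vU vmax] := @Order.TotalTheory.arg_maxP _ _ _ c0 (fun c => c \notin U) x c0U'.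
  by exists v.
exists (v |: U); split.
- by rewrite cardsU1 vU cU.
- move=> u w; rewrite !inE negb_or => /orP[/eqP ->|uU] /andP[wv wU]; first exact: vmax.
  exact: topU.
move=> u; rewrite !inE => /orP[/eqP {u}->|uU]; last first.
  by apply: le_trans (etaU u uU) _; rewrite ler_wpM2l // ler_nat leq_exp2r.
have [zU|zU] := boolP (z \in U); last first.
  have := vmax z zU; have : 0 <= mu * x z * (j.+1 ^ 2)%:R by rewrite mulr_ge0.
  lra.
have [||a [b [aU bU ab]]] := @conn_crossing G U cG.
- by apply/set0Pn; exists z.
- by apply/set0Pn; exists c0.
have := flow_edge aU bU ab (fun a b aS bS _ => topU a b aS bS).
have Us : \sum_(a in U) x a <= j%:R * x z.
  by rewrite -cU -sum1_card natr_sum mulr_suml; apply: ler_sum => c _; rewrite mul1r.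
have := ler_wpM2l (ltW mu0) Us; have := etaU a aU; have := vmax b bU.
have -> : (j.+1 ^ 2)%:R = (j ^ 2)%:R + 2 * j%:R + 1 :> R.
  by rewrite !natrX -natr1; lra.
have : 0 <= mu * x z * j%:R by rewrite mulr_ge0.
nra.
Qed.

Lemma top_set_nbr (j : nat) (U : {set G}) :
  #|U| = j -> (forall u v, u \in U -> v \notin U -> x v <= x u) ->
  (forall u, u \in U -> x z - x u <= mu * x z * (j ^ 2)%:R) ->
  forall u v, u \in U -> v \notin U -> edge u v -> x z - x v <= mu * x z * (j.+1 ^ 2)%:R.
Proof.
move=> cU topU etaU u v uU vU uv.
have mx : 0 <= mu * x z by rewrite mulr_ge0 ?ltW.
have := flow_edge uU vU uv (fun a b aS bS _ => topU a b aS bS).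
have Us : \sum_(a in U) x a <= j%:R * x z.
  by rewrite -cU -sum1_card natr_sum mulr_suml; apply: ler_sum => c _; rewrite mul1r.
have := ler_wpM2l (ltW mu0) Us; have := etaU u uU.
have -> : (j.+1 ^ 2)%:R = (j ^ 2)%:R + 2 * j%:R + 1 :> R.
  by rewrite !natrX -natr1; lra.
have : 0 <= mu * x z * j%:R by rewrite mulr_ge0.
nra.
Qed.

(** A neighbour outside [T], or a missing edge, contributes at most [t] at a vertex of [T]. So by
    the eigenvalue equation [d I - A], restricted to [T], maps [x - t] to at most [mu * x v]. The
    right side is the price of raising the ground to [t]. *)
Lemma delete (T : {set G}) (t : R) : 0 <= t ->
  (forall v, v \in T -> t <= x v) ->
  (forall v w, v \in T -> w \notin T -> edge v w -> x w <= t) ->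
  energy d (fun v : induced T => x (val v) - t) - mu * \sum_(v in T) (x v - t) ^+ 2
    <= t * (mu * \sum_(v in T) (x v - t)).
Proof.
move=> t0 tT bT.
rewrite (energy_induced T d (fun v => x v - t)).
have dT v : (\sum_(w in T) edge v w + \sum_(w in ~: T) edge v w = deg v)%N.
  rewrite [RHS](bigID (mem T)) /=; congr (_ + _)%N.
  by apply: eq_bigl => w; rewrite inE.
suff H v : v \in T -> d%:R * (x v - t) ^+ 2
     - \sum_(w in T) (edge v w)%:R * ((x v - t) * (x w - t)) <= mu * x v * (x v - t).
  rewrite mulr_sumr -sumrB; apply: (@le_trans _ _ (\sum_(v in T) mu * x v * (x v - t) - mu * \sum_(v in T) (x v - t) ^+ 2)).
    by rewrite lerB //; apply: ler_sum.
  rewrite !mulr_sumr -sumrB le_eqVlt; apply/orP; left; apply/eqP; apply: eq_bigr => v _; lra.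
move=> vT; rewrite -eig.
have -> : \sum_w (edge v w)%:R * x w = \sum_(w in T) (edge v w)%:R * x w + \sum_(w in ~: T) (edge v w)%:R * x w.
  by rewrite (bigID (mem T)) /=; congr (_ + _); apply: eq_bigl => w; rewrite inE.
have -> : \sum_(w in T) (edge v w)%:R * ((x v - t) * (x w - t)) =
   (x v - t) * (\sum_(w in T) (edge v w)%:R * x w - t * (\sum_(w in T) edge v w)%:R).
  rewrite natr_sum !mulr_sumr -sumrB mulr_sumr; apply: eq_bigr => w _; lra.
have H1 : \sum_(w in ~: T) (edge v w)%:R * x w <= t * (\sum_(w in ~: T) edge v w)%:R.
  rewrite natr_sum mulr_sumr; apply: ler_sum => w; rewrite inE => wT.
  by case e : (edge v w); rewrite ?mul0r ?mulr0 // mul1r mulr1; apply: (bT v).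
have H2 : (\sum_(w in T) edge v w)%:R + (\sum_(w in ~: T) edge v w)%:R <= d%:R :> R.
  by rewrite -natrD dT ler_nat.
have H3 : 0 <= x v - t by rewrite subr_ge0 tT.
set A := \sum_(w in T) _; set B := \sum_(w in ~: T) (edge v w)%:R * x w in H1 *.
set a := (\sum_(w in T) edge v w)%:R in H2 *; set b := (\sum_(w in ~: T) edge v w)%:R in H1 H2.
have H4 : 0 <= (x v - t) * (t * (d%:R - a - b)).
  by rewrite !mulr_ge0 //; lra.
have H5 : 0 <= (x v - t) * (t * b - B) by rewrite mulr_ge0 // subr_ge0.
nra.
Qed.

Lemma energy_eig : energy d x = mu * \sum_v x v ^+ 2.
Proof.
rewrite /energy !mulr_sumr -sumrB; apply: eq_bigr => v _.
under eq_bigr => w _ do rewrite mulrCA.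
rewrite -mulr_sumr expr2 mulrA (mulrA mu) -eig; lra.
Qed.

Variable n : nat.
Hypotheses (hmin : minimal d n mu) (cardG : #|G| = n) (d3 : (3 <= d)%N) (od : odd d).
Hypothesis hasd : exists v : G, deg v = d.

Definition deficit := (\sum_(v : G) (d - deg v))%N.

(** Joining two nonadjacent deficient vertices would lower the energy of [x] by [2 * x u * x v],
    against minimality; for deficit at least 3 the enlarged graph is still nonregular. So the
    deficient vertices form a clique. *)
Lemma deficit_le : (deficit <= d.+1 * d)%N.
Proof.
have [D2|D3] := leqP deficit 2; first by apply: leq_trans D2 _; apply: (@leq_mul 1 2); lia.
have [v0 v0d] : exists v0 : G, (deg v0 < d)%N.
  apply/existsP; apply: contraLR D3; rewrite negb_exists -leqNgt => /forallP H.
  rewrite /deficit big1 // => v _; apply/eqP; have := H v; rewrite -leqNgt.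
  by rewrite subn_eq0.
have clique (u v : G) : (deg u < d)%N -> (deg v < d)%N -> (u == v) || edge u v.
  move=> ud vd; apply: contraT; rewrite negb_or => /andP[uv nuv].
  pose g := add_edge uv.
  have dgE (a : G) : deg (a : g) = (deg a + (a == u) + (a == v))%N := deg_add_edge uv nuv a.
  have g1 (a : g) : (deg a <= d)%N.
    rewrite dgE; have := dG a; case: eqP => [->|_]; case: eqP => [e|_]; rewrite ?addn0 ?addn1 //.
    by move: (uv); rewrite e eqxx.
    by rewrite e.
  have g2 : exists a : g, (deg a < d)%N.
    apply/existsP; apply: contraLR D3; rewrite negb_exists -leqNgt => /forallP H.
    have -> : deficit = (\sum_(a : G) ((a == u) + (a == v)))%N.
      apply: eq_bigr => a _; have := H a; have := g1 a; rewrite dgE -leqNgt; lia.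
    rewrite big_split /= (bigD1 u) //= eqxx big1 => [|a /negbTE ->] //.
    by rewrite (bigD1 v) //= eqxx big1 => [|a /negbTE ->].
  have g3 : exists a : g, deg a = d.
    have [a ad] := hasd; exists a; rewrite dgE.
    case: eqP => [e|_]; first by move: ud; rewrite -e ad ltnn.
    by case: eqP => [e|_]; [move: vd; rewrite -e ad ltnn | rewrite !addn0].
  have cg : conn g by exact: conn_add_edge.
  have := @hmin g cardG cg g1 g2 g3 x.
  rewrite (energy_add_edge uv nuv) energy_eig.
  have : 0 < x u * x v by rewrite mulr_gt0.
  lra.
rewrite /deficit; apply: (@leq_trans (\sum_(v : G) ((v0 == v) + edge v0 v) * d)%N).
  apply: leq_sum => v _; have [vd|] := ltnP (deg v) d; last first.
    by rewrite -subn_eq0 => /eqP ->.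
  have := clique v0 v v0d vd; case: (v0 == v); case: (edge v0 v) => //= _; lia.
rewrite -big_distrl /= leq_mul2r; apply/orP; right.
rewrite big_split /= -/(deg v0) (bigD1 v0) //= eqxx big1.
  by rewrite addn0 add1n ltnS; exact: dG.
by move=> v; rewrite eq_sym => /negbTE ->.
Qed.

Lemma odd_deficit : odd deficit = odd n.
Proof.
have H : (\sum_(v : G) deg v + deficit = n * d)%N.
  by rewrite -big_split /= (eq_bigr (fun=> d)) ?sum_nat_const ?cardG // => v _; rewrite subnKC.
have H2 : odd (\sum_(v : G) deg v) = false.
  rewrite -[RHS](odd_degree_sum [set: G]); congr odd.
  by apply: eq_big => [v|v _]; rewrite ?inE // /deg; apply: eq_bigl => w; rewrite inE.
by have := congr1 odd H; rewrite oddD H2 oddM od andbT.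
Qed.

(* A chain hung on the deficient vertices, compensated by shortening the plateau. *)
Lemma extend_bottom (J s j j' : nat) (k : bool) (L Y h : R) :
  (0 < deficit)%N -> odd s = ~~ odd deficit -> (2 * d + deficit + 2 <= s)%N ->
  (2 * d + d.+1 * d + 1 <= j')%N -> (j = j' + s + J * d.+1 + k)%N -> odd j = odd j' ->
  (j < n)%N -> (forall v, (deg v < d)%N -> x v < x z - mu * x z * (j ^ 2)%:R) ->
  L = (d.-1 + J * d.+1)%:R -> Y = F0 / d.-1%:R * L -> h = mu * x z * (j.+1 ^ 2)%:R ->
  F0 / d.-1%:R * F0 * L <=
    3 * h ^+ 2 * (d * j)%:R + mu * (j%:R * (x z + Y) ^+ 2 - j'%:R * (x z + Y - h) ^+ 2).
Proof.
move=> D0 os sl j'l jE ojj jn defl LE YE hE.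
have [t [r [phi [[ct cont ur sr] dt [[b0 b0r b0d] _] [phir en] _]]]] :=
  bottom_gadget R J k d3 od os sl.
have jG : (j < #|G|)%N by rewrite cardG.
have [U [cU topU etaU]] := top_set jG.
have nbrU := top_set_nbr cU topU etaU.
have dU v : v \in U -> deg v = d.
  move=> vU; apply/eqP; rewrite eqn_leq dG leqNgt; apply/negP => /defl.
  by have := etaU v vU; lra.
have [p pc] := count_mem_seq (fun v : G => (d - deg v)%N).
have sp : size p = deficit by rewrite size_sum_count; apply: eq_bigr => v _.
have spr : size p = size r by rewrite sr.
pose g := attach p r.
have dl (v : G) : deg (inl v : g) = d by rewrite deg_attach_l // pc subnKC.
have dr (v : t) : deg (inr v : g) = (deg v + (v \in r))%N by rewrite deg_attach_r.
have d1 : (0 : R) < d.-1%:R by rewrite ltr0n; lia.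
(* [f * phi] carries the current [f * (d - 1)], equal to the F that leaves [G], and [G] is lifted by
   the total rise [Y = f * L] of the chain. *)
pose f := F0 / d.-1%:R.
pose y (v : g) : R := match v with inl v => x v + Y | inr v => f * phi v end.
have cg : conn g.
  apply: conn_attach => //; last by rewrite sp.
  move=> v; case: (p) sp => [|a q] sp'; first by rewrite -sp' in D0.
  by exists a; rewrite ?mem_head //; exact: cG.
have eng : energy d y = mu * (\sum_v x v ^+ 2) + 2 * Y * F0 - f * F0 * L.
  rewrite (@energy_attach _ _ _ _ ur spr R d y Y); last by move=> v vr; rewrite /= phir // YE LE.
  have -> : energy d (fun b : t => y (inr b)) = f ^+ 2 * energy d phi by rewrite -energy_scale.
  have dE (v : G) : d%:R - (deg v)%:R = (d - deg v)%:R :> R by rewrite natrB ?dG.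
  have -> : \sum_(v <- p) y (inl v) = F0 + deficit%:R * Y.
    rewrite big_count_mem outflowE /deficit natr_sum mulr_suml -big_split /=; apply: eq_bigr => v _.
    by rewrite pc dE mulrDr.
  rewrite energy_shift -outflowE energy_eig en.
  have -> : \sum_(v : G) (d%:R - (deg v)%:R) = deficit%:R :> R.
    by rewrite /deficit natr_sum; apply: eq_bigr => v _; rewrite dE.
  rewrite -LE YE -/f.
  have fd : f * d.-1%:R = F0 by rewrite /f divfK // gt_eqF.
  have -> : f ^+ 2 * (d.-1%:R * L + deficit%:R * L ^+ 2) = f * (f * d.-1%:R) * L + deficit%:R * (f * L) ^+ 2.
    lra.
  rewrite fd; lra.
pose U' : {set g} := inl @: U.
have inlU (v : G) : (inl v \in U') = (v \in U) by rewrite mem_imset // => a b [].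
have inrU (v : t) : (inr v \in U') = false by apply/negP => /imsetP[].
have cU' : #|U'| = j by rewrite card_imset // => a b [].
have L0 : 0 <= L by rewrite LE ler0n.
have F00 : 0 <= F0 by exact: outflow_ge0.
have h0 : 0 <= h by rewrite hE !mulr_ge0 // ltW.
(* A set avoiding [b0] is left, inside the complement of the plateau, in one of three ways: within
   the chain, through a deficient vertex joined to the chain, or along a descending edge of [G]. *)
have cind : conn (induced (~: U')).
  apply: (@conn_induced _ _ (inr b0 : g)); first by rewrite inE inrU.
  move=> S SU S0 b0S.
  have [b /andP[bS _]|nob] := pickP (fun b : t => (inr b \in S) && true).
    have [||u [v [uS vS uv]]] := @conn_crossing t [set b | (inr b : g) \in S] cont.
    - by apply/set0Pn; exists b; rewrite inE.
    - by apply/set0Pn; exists b0; rewrite !inE.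
    exists (inr u), (inr v); rewrite !inE in uS vS *; rewrite inrU uS vS; split => //.
  have [v0 v0S] : exists v0 : G, inl v0 \in S.
    have [[v0|b] vS] := set0Pn _ S0; first by exists v0.
    by have := nob b; rewrite vS.
  have inU v : inl v \in S -> v \notin U.
    by move=> /(subsetP SU); rewrite inE inlU.
  have [v /andP[vS vd]|nod] := pickP (fun v : G => (inl v \in S) && (deg v < d)%N).
    have vp : v \in p by rewrite -has_pred1 has_count pc subn_gt0.
    have ip : (index v p < size p)%N by rewrite index_mem.
    have : (v, nth b0 r (index v p)) \in zip p r.
      rewrite -[v in (v, _)](nth_index v vp) -nth_zip //; apply: mem_nth.
      by rewrite size_zip -spr minnn.
    move=> e; exists (inl v), (inr (nth b0 r (index v p))); split => //.
    by rewrite !inE inrU andbT; apply/negP => H; have := nob (nth b0 r (index v p)); rewrite H.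
  have [||u [v [uS vS uv luv]]] := @escape [set v | (inl v : g) \in S].
  - by apply/set0Pn; exists v0; rewrite inE.
  - move=> v; rewrite inE => vS; apply/eqP; rewrite eqn_leq dG leqNgt /=.
    by have := nod v; rewrite vS /= => ->.
  rewrite !inE in uS vS; exists (inl u), (inl v); split => //.
  rewrite !inE vS inlU /=; apply/negP => vU.
  by have := topU v u vU (inU u uS); lra.
have slotsE : odd j' = odd (\sum_(v in ~: U') \sum_(u in U') @edge g v u).
  rewrite odd_boundary (eq_bigr (fun=> d)); last by move=> _ /imsetP[v _ ->]; rewrite dl.
  by rewrite sum_nat_const cU' oddM od andbT ojj.
have hdg (v : g) : (deg v <= d)%N by case: v => v; rewrite ?dl // dr.
have j0 : (0 < j)%N.
  by rewrite jE -!addnA ltn_addr // (leq_trans _ j'l) // addn1.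
have yU (u v : g) : u \in U' -> v \notin U' -> edge u v -> `|y v - (x z + Y - h)| <= h.
  case/imsetP=> u' u'U ->; case: v => v.
    rewrite inlU => vU /= uv; have := nbrU u' v u'U vU uv; have := zmax v.
    rewrite -hE ler_norml => ? ?; apply/andP; split; lra.
  move=> _ /= e; have : u' \in p.
    have : u' \in unzip1 (zip p r) by apply/mapP; exists (u', v).
    by rewrite unzip1_zip // spr.
  by rewrite -has_pred1 has_count pc dU // subnn.
have U'0 : U' != set0 by rewrite -card_gt0 cU'.
have cU'0 : ~: U' != set0 by apply/set0Pn; exists (inr b0); rewrite inE inrU.
have b0U : (inr b0 : g) \notin U' by rewrite inrU.
have b0d' : (deg (inr b0 : g) < d)%N by rewrite dr (negbTE b0r) addn0.
have [g' [y' [cg' conng' dg' [[v1 [v1d _]] hd] [s1 s2]]]] :=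
  top_replace d3 od cg hdg U'0 cU'0 cind yU slotsE j'l b0U b0d'.
have cn : #|g'| = n.
  rewrite cg' cardsCs setCK cU' /= card_sum ct cardG.
  by move: jE jn; clear; lia.
have := hmin cn conng' dg' (ex_intro _ v1 _) hd y'; rewrite v1d => /(_ b0d').
rewrite s1 => H1; have {H1 s2} := le_trans H1 s2; rewrite eng cU'.
have Sge : \sum_v x v ^+ 2 + 2 * Y * (\sum_v x v) - j%:R * (x z + Y) ^+ 2 <= \sum_(v in ~: U') y v ^+ 2.
  have E1 : \sum_(v : g) y v ^+ 2 = \sum_(v in ~: U') y v ^+ 2 + \sum_(v in U') y v ^+ 2.
    rewrite (bigID (mem U')) /= addrC; congr (_ + _).
    by apply: eq_bigl => v; rewrite inE.
  have E2 : \sum_(v in U') y v ^+ 2 <= j%:R * (x z + Y) ^+ 2.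
    rewrite -cU' -sum1_card natr_sum mulr_suml; apply: ler_sum => _ /imsetP[v _ ->] /=.
    rewrite mul1r ler_sqr ?nnegrE ?lerD2r // addr_ge0 ?(ltW (xpos _)) // YE mulr_ge0 //.
      by rewrite divr_ge0 // ltW.
    by rewrite divr_ge0 // ltW.
  have E3 : \sum_v x v ^+ 2 + 2 * Y * (\sum_v x v) <= \sum_(v : g) y v ^+ 2.
    rewrite big_sumType /= -[leLHS]addr0; apply: lerD; last first.
      by apply: sumr_ge0 => v _; rewrite sqr_ge0.
    rewrite mulr_sumr -big_split /=; apply: ler_sum => v _.
    by have := sqr_ge0 Y; lra.
  lra.
have := ler_wpM2l (ltW mu0) Sge.
have -> : mu * (\sum_v x v ^+ 2 + 2 * Y * \sum_v x v - j%:R * (x z + Y) ^+ 2) =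
  mu * (\sum_v x v ^+ 2) + 2 * Y * F0 - mu * (j%:R * (x z + Y) ^+ 2).
  rewrite /outflow; lra.
have -> : F0 / d.-1%:R * F0 * L = f * F0 * L by [].
lra.
Qed.

(* The vertices below a bridge are deleted and given back to the plateau, except for a leaf
   of potential [c] when parity requires it. *)
Lemma cut_at_bridge (T : {set G}) (a : G) (t c h : R) (k : bool) (j j' : nat) :
  0 <= t -> (forall v, v \in T -> t <= x v) ->
  (forall v w, v \in T -> w \notin T -> edge v w -> x w <= t) ->
  a \in T -> (forall v, v \in T -> (\sum_(w in T) edge v w + (v == a) = d)%N) ->
  (forall v, (v \notin T) || (v == a) -> x v < x z - mu * x z * (j ^ 2)%:R) ->
  (#|T| + k + j' = n + j)%N -> (0 < j)%N -> (j < n)%N -> odd j = odd j' ->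
  (2 * d + d.+1 * d + 1 <= j')%N -> 0 <= c -> (~~ k -> c = 0) ->
  h = mu * x z * (j.+1 ^ 2)%:R ->
  mu * (j'%:R * (x z - t + c - h) ^+ 2 - j%:R * (x z - t + c) ^+ 2) <=
    t * (mu * \sum_(v in T) (x v - t)) + (d%:R - 1) * c ^+ 2
     - 2 * c * (mu * \sum_(v in T) (x v - t)) + 3 * h ^+ 2 * (d * j)%:R.
Proof.
move=> t0 tT bT aT degT farT cn j0 jn ojj j'l c0 kc hE.
have dsplit (v : G) : (\sum_(w in T) edge v w + \sum_(w in ~: T) edge v w = deg v)%N.
  rewrite [RHS](bigID (mem T)) /=; congr (_ + _)%N.
  by apply: eq_bigl => w; rewrite inE.
have Tdeg v : v \in T -> v != a -> deg v = d.
  move=> vT va; apply/eqP; rewrite eqn_leq dG /= -(dsplit v) -{1}(degT v vT) (negbTE va).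
  by rewrite addn0 leq_addr.
have Tin v w : v \in T -> v != a -> edge v w -> w \in T.
  move=> vT va vw; apply: contraT => wT.
  have := dsplit v; rewrite (Tdeg v vT va) [X in (_ + X)%N](bigD1 w) ?inE //= vw.
  have := degT v vT; rewrite (negbTE va); clear; lia.
have jG : (j < #|G|)%N by rewrite cardG.
have [U [cU topU etaU]] := top_set jG.
have nbrU := top_set_nbr cU topU etaU.
have UT u : u \in U -> (u \in T) && (u != a).
  move=> uU; apply: contraT; rewrite negb_and negbK => /farT.
  by have := etaU u uU; lra.
have zT : z \in T.
  apply: contraT => zT; have := farT z; rewrite zT => /(_ isT).
  have : 0 <= mu * x z * (j ^ 2)%:R by rewrite !mulr_ge0 // ltW.
  lra.
have tz : t <= x z by exact: tT.
pose g := induced T.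
have dgE (v : g) : deg v = (\sum_(w in T) edge (val v) w)%N.
  by rewrite /deg -(big_sub T (fun w => edge (val v) w : nat)).
pose a' : g := exist _ a aT.
have va' (v : g) : (v == a') = (val v == a) by [].
have dg' (v : g) : (deg v + (v == a') = d)%N by rewrite dgE va' degT // (valP v).
have sdef (F : g -> R) : \sum_v (d%:R - (deg v)%:R) * F v = F a'.
  rewrite (bigD1 a') //= big1 ?addr0 => [|v /negbTE va].
    by rewrite -[in d%:R](dg' a') eqxx natrD addrAC subrr add0r mul1r.
  by rewrite -[in d%:R](dg' v) va addn0 subrr mul0r.
have dgd (v : g) : (deg v <= d)%N by rewrite -[X in (_ <= X)%N](dg' v) leq_addr.
have clo (S : {set g}) : S != set0 -> a' \notin S ->
    exists u v, [/\ u \in S, v \notin S, edge u v & x (val v) < x (val u)].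
  move=> S0 aS.
  have [||u [v [/imsetP[u' u'S ->] vS uv l]]] := @escape [set val v | v in S].
  - by case/set0Pn: S0 => s sS; apply/set0Pn; exists (val s); apply: imset_f.
  - move=> _ /imsetP[v vS ->]; apply: Tdeg; first exact: (valP v).
    by rewrite -va'; apply: contraNneq aS => <-.
  have vT : v \in T.
    apply: (Tin (val u') v) => //; first exact: (valP u').
    by rewrite -va'; apply: contraNneq aS => <-.
  exists u', (exist _ v vT); split => //; apply/negP => H; case/negP: vS.
  by apply/imsetP; exists (exist _ v vT).
have cg : conn g.
  pose fT : {set g} := setT.
  suff H (v : g) : connect edge a' v.
    by move=> u v; apply: (connect_trans _ (H v)); rewrite edge_connect_sym.
  apply: contraT => nv.
  have [||u [w [uS wS uw _]]] := clo [set w | ~~ connect edge a' w].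
  - by apply/set0Pn; exists v; rewrite inE.
  - by rewrite inE connect0.
  rewrite !inE negbK in uS wS; case/negP: uS.
  by apply: (connect_trans wS); apply: connect1; rewrite edge_sym.
pose U' : {set g} := [set v | val v \in U].
have cU' : #|U'| = j.
  rewrite -cU -(card_imset (mem U') val_inj); apply: eq_card => u.
  apply/imsetP/idP => [[v]|uU]; first by rewrite inE => vU ->.
  have /andP[uT _] := UT u uU.
  by exists (exist _ u uT) => //; rewrite inE.
have a'U : a' \notin U' by rewrite inE; apply/negP => /UT /=; rewrite eqxx andbF.
have cind : conn (induced (~: U')).
  apply: (@conn_induced _ _ a'); first by rewrite inE.
  move=> S SU S0 aS; have [u [v [uS vS uv l]]] := clo S S0 aS.
  exists u, v; split => //; rewrite inE vS inE /= inE; apply/negP => vU.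
  have uU : val u \notin U by have := subsetP SU u uS; rewrite !inE.
  by have := topU _ _ vU uU; lra.
have slotsE : odd j' = odd (\sum_(v in ~: U') \sum_(u in U') edge v u).
  rewrite odd_boundary (eq_bigr (fun=> d)).
    by rewrite sum_nat_const cU' oddM od andbT ojj.
  move=> u uU; rewrite -[RHS](dg' u) (_ : (u == a') = false) ?addn0 //.
  by apply: contraTF uU => /eqP ->.
pose y (v : g) := x (val v) - t + c.
have yU (u v : g) : u \in U' -> v \notin U' -> edge u v -> `|y v - (x z - t + c - h)| <= h.
  rewrite !inE => uU vU uv; have := nbrU _ _ uU vU uv; have := zmax (val v).
  rewrite -hE ler_norml /y => ? ?; apply/andP; split; lra.
have U'0 : U' != set0 by rewrite -card_gt0 cU'.
have cU'0 : ~: U' != set0 by apply/set0Pn; exists a'; rewrite inE.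
have a'd : (deg a' < d)%N by rewrite -[X in (_ < X)%N](dg' a') eqxx addn1.
have [g1 [y1 [cg1 conng1 dg1 [[v1 [v1d v1y]] hd] [s1 s2]]]] :=
  top_replace d3 od cg dgd U'0 cU'0 cind yU slotsE j'l a'U a'd.
have e1 : energy d y = energy d (fun v : g => x (val v) - t) + 2 * c * (x a - t) + c ^+ 2.
  rewrite (energy_shift d (fun v : g => x (val v) - t) c) sdef; congr (_ + _).
  have := sdef (fun=> 1); under eq_bigr => v _ do rewrite mulr1.
  by move=> ->; rewrite mulr1.
have e0 := delete t0 tT bT.
set S := \sum_(v in T) (x v - t) in e0 *.
set Q := \sum_(v in T) (x v - t) ^+ 2 in e0 *.
have ms : Q + 2 * c * S - j%:R * (x z - t + c) ^+ 2 <= \sum_(v in ~: U') y v ^+ 2.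
  have E1 : \sum_(v : g) y v ^+ 2 = \sum_(v in ~: U') y v ^+ 2 + \sum_(v in U') y v ^+ 2.
    rewrite (bigID (mem U')) /= addrC; congr (_ + _).
    by apply: eq_bigl => v; rewrite in_setC.
  have E2 : \sum_(v in U') y v ^+ 2 <= j%:R * (x z - t + c) ^+ 2.
    rewrite -cU' -sum1_card natr_sum mulr_suml; apply: ler_sum => v _.
    have := tT _ (valP v); have := zmax (val v); rewrite mul1r /y => ? ?.
    by rewrite ler_sqr ?nnegrE; lra.
  have E3 : Q + 2 * c * S <= \sum_(v : g) y v ^+ 2.
    rewrite (sum_induced T (fun v => (x v - t + c) ^+ 2)) /Q /S mulr_sumr -big_split /=.
    apply: ler_sum => v _; have := sqr_ge0 c; lra.
  lra.
have cc1 : #|g1| = (#|T| - j + j')%N by rewrite cg1 cardsCs setCK cU' card_induced.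
have jT : (j <= #|T|)%N.
  by rewrite -cU; apply: subset_leq_card; apply/subsetP => u /UT /andP[].
have fin (m e : R) : mu * m <= e -> Q + 2 * c * S - j%:R * (x z - t + c) ^+ 2 + j'%:R * (x z - t + c - h) ^+ 2 <= m ->
   e <= energy d (fun v : g => x (val v) - t) + (d%:R - 1) * c ^+ 2 + 3 * h ^+ 2 * (d * j)%:R ->
   mu * (j'%:R * (x z - t + c - h) ^+ 2 - j%:R * (x z - t + c) ^+ 2) <=
    t * (mu * S) + (d%:R - 1) * c ^+ 2 - 2 * c * (mu * S) + 3 * h ^+ 2 * (d * j)%:R.
  move=> H1 H2 H3; have := ler_wpM2l (ltW mu0) H2.
  rewrite (_ : mu * (Q + _ - _ + _) = mu * Q + 2 * c * (mu * S)
     + mu * (j'%:R * (x z - t + c - h) ^+ 2 - j%:R * (x z - t + c) ^+ 2)); last by lra.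
  lra.
rewrite e1 cU' in s2.
case: k cn kc => cn kc; last first.
  have cz : c = 0 by exact: kc.
  have cn1 : #|g1| = n by rewrite cc1; move: cn jT; clear; lia.
  have := hmin cn1 conng1 dg1 (ex_intro _ v1 _) hd y1; rewrite v1d => /(_ a'd) H.
  apply: (fin _ _ H); first by rewrite s1; lra.
  by apply: (le_trans s2); rewrite cz; lra.
have v1d' : (deg v1 < d)%N by rewrite v1d.
have [g2 [y2 [cg2 conng2 dg2 [hd2 hd2'] [s3 s4]]]] := add_leaf y1 c d3 conng1 dg1 v1d' hd.
have cn2 : #|g2| = n by rewrite cg2 cc1; move: cn jT; clear; lia.
have H := hmin cn2 conng2 dg2 hd2 hd2' y2.
apply: (fin _ _ H); first by rewrite s3 s1; have := sqr_ge0 c; lra.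
(* The terms in [x a - t] cancel: the shift by [c] adds [2 * c * (x a - t) + c ^+ 2] and the leaf
   adds [d * c ^+ 2 - 2 * c * (x a - t + c)], leaving [(d - 1) * c ^+ 2]. *)
rewrite s4 v1y /y /=; lra.
Qed.

(** Far from the ground the saving grows with the number of levels, so cruder surgery than in
    [cut_at_bridge] suffices: an even gadget is inserted in one edge at [z], and a leaf of potential
    0, worth nothing, settles parity. *)
Lemma cut_far (T : {set G}) (q : G) (t : R) (k : bool) (j : nat) :
  0 <= t -> (forall v, v \in T -> t <= x v) ->
  (forall v w, v \in T -> w \notin T -> edge v w -> x w <= t) ->
  conn (induced T) -> ~: T != set0 -> z \in T -> q \in T -> edge z q ->
  (#|T| + k + j = n)%N -> ~~ odd j -> (2 * d + 3 <= j)%N ->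
  mu * (j%:R * (x z - t) ^+ 2) <= t * (mu * \sum_(v in T) (x v - t)).
Proof.
move=> t0 tT bT cT T1 zT qT zq cn oj jl.
pose g := induced T.
have T0 : T != set0 by apply/set0Pn; exists z.
have [a [b [aT bT' ab]]] := conn_crossing cG T0 T1.
pose a' : g := exist _ a aT; pose z' : g := exist _ z zT; pose q' : g := exist _ q qT.
have a'd : (deg a' < d)%N.
  apply: leq_trans (dG a); rewrite -(deg_induced a') (bigD1 b) ?inE //= ab.
  by rewrite addnA addn1 addSn ltnS leq_addr.
have dgd (v : g) : (deg v <= d)%N by apply: leq_trans (dG (val v)); rewrite -(deg_induced v) leq_addr.
have [g1 [y1 [cg1 conng1 dg1 [[v1 [v1d v1y]] hd] [s1 s2]]]] :=
  insert_gadget a' (fun v : g => x (val v) - t) d3 od cT dgd (zq : @edge g z' q') oj jl.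
have v1d' : (deg v1 < d)%N by rewrite v1d.
have e0 := delete t0 tT bT.
rewrite (sum_induced T (fun v => (x v - t) ^+ 2)) /= in s1.
have fin (m e : R) : mu * m <= e ->
   m = \sum_(v in T) (x v - t) ^+ 2 + j%:R * (x z - t) ^+ 2 ->
   e = energy d (fun v : g => x (val v) - t) ->
   mu * (j%:R * (x z - t) ^+ 2) <= t * (mu * \sum_(v in T) (x v - t)).
  by move=> H mE eE; move: H; rewrite mE eE mulrDr; lra.
case: k cn => cn; last first.
  have cn1 : #|g1| = n by rewrite cg1 card_induced -[#|T|]addn0.
  have H := hmin cn1 conng1 dg1 (ex_intro _ v1 v1d') hd y1.
  exact: (fin _ _ H).
have [g2 [y2 [cg2 conng2 dg2 [hd2 hd2'] [s3 s4]]]] := add_leaf y1 0 d3 conng1 dg1 v1d' hd.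
have cn2 : #|g2| = n by rewrite cg2 cg1 card_induced -cn addn1.
have H := hmin cn2 conng2 dg2 hd2 hd2' y2.
apply: (fin _ _ H); first by rewrite s3 expr0n add0r.
by rewrite s4 expr0n /= !mulr0 mul0r addr0 subr0 s2.
Qed.

End Eigen.

(** Test graph: a chain of [J] near-cliques with a lump of [s] vertices at its top potential L. Its
    energy is linear in L and its squared norm at least [s L^2], so a long chain forces [mu * s] to
    be small. *)
Lemma small_gap (R : realFieldType) (d n : nat) (mu : R) (J s : nat) (k : bool) :
  minimal d n mu -> (3 <= d)%N -> odd d -> 0 <= mu ->
  n = (s + J * d.+1 + k)%N -> odd s -> (2 * d + 2 <= s)%N ->
  mu * s%:R * (d.-1 + J * d.+1)%:R <= d.-1%:R.
Proof.
move=> hmin d3 od mu0 nE os sl.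
have os0 : odd s = ~~ odd 0 by rewrite os.
have sl0 : (2 * d + 0 + 2 <= s)%N by rewrite addn0.
have [g [r [phi [[cg cong ur sr] dg [[b br bd] [v vd]] [_ en] ms]]]] :=
  bottom_gadget R J k d3 od os0 sl0.
have r0 : r = [::] by case: (r) sr.
have dg' (u : g) : (deg u <= d)%N by have := dg u; rewrite r0 addn0.
have vd' : deg v = d by have := vd; rewrite r0 addn0.
have := hmin g; rewrite cg -nE => /(_ erefl cong dg' (ex_intro _ b bd) (ex_intro _ v vd') phi).
rewrite en mul0r addr0; set L := (d.-1 + J * d.+1)%:R in ms *.
have L0 : 0 < L by rewrite ltr0n; lia.
move=> H; have H1 := le_trans (ler_wpM2l mu0 ms) H.
rewrite -(ler_pM2r L0); apply: le_trans H1.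
by rewrite le_eqVlt; apply/orP; left; apply/eqP; lra.
Qed.

(** * Growth of the levels *)

(** This covers a run of [d] levels starting at cut size [A], its second level left out. By [sep]
    the levels at distance 2 and [d - 1] have cut size at least [2 (d - 1) - A], and the [d - 4]
    levels between them at least [3 (d - 2) - A]. *)
Lemma single_bound (R : realFieldType) (D A : R) :
  5 <= D -> 2 <= A -> A <= D - 2 ->
  A^-1 + 2 * (2 * D - 2 - A)^-1 + (D - 4) * (3 * D - 6 - A)^-1 <= 1 - (50 * (D - 1))^-1.
Proof.
move=> D5 A2 AD.
have p1 : 0 < A by lra.
have p2 : 0 < 2 * D - 2 - A by lra.
have p3 : 0 < 3 * D - 6 - A by lra.
have p4 : 0 < 50 * (D - 1) by lra.
rewrite -subr_ge0; set X := (X in 0 <= X).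
pose Q := 50 * (D - 1) * A * (2 * D - 2 - A) * (3 * D - 6 - A).
have Q0 : 0 < Q by do 3 apply: mulr_gt0 => //.
(* With the denominators cleared, the first term is nonnegative for [2 <= A <= D - 2], the second
   because a cubic in [D] with factor 50 dominates a quadratic. *)
have XQ : X * Q = 50 * (D - 1) * (3 * D - 6 - A) * ((A - 2) * (D - 1 - A))
    + A * (50 * (D - 1) * (D - 4) ^+ 2 - (2 * D - 2 - A) * (3 * D - 6 - A)).
  have := mulKf (lt0r_neq0 p1) (50 * (D - 1) * (2 * D - 2 - A) * (3 * D - 6 - A)).
  have := mulKf (lt0r_neq0 p2) (50 * (D - 1) * A * (3 * D - 6 - A)).
  have := mulKf (lt0r_neq0 p3) (50 * (D - 1) * A * (2 * D - 2 - A) * (D - 4)).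
  have := mulKf (lt0r_neq0 p4) (A * (2 * D - 2 - A) * (3 * D - 6 - A)).
  rewrite /X /Q; lra.
rewrite -(pmulr_lge0 _ Q0) XQ addr_ge0 //.
- by rewrite !mulr_ge0 ?(ltW p3) ?(ltW p4) //; lra.
- rewrite mulr_ge0 ?(ltW p1) //; rewrite subr_ge0.
  have h1 : (2 * D - 2 - A) * (3 * D - 6 - A) <= (2 * D - 4) * (3 * D - 8).
    by rewrite ler_pM; lra.
  apply: (le_trans h1); set e := D - 5; have e0 : 0 <= e by rewrite /e; lra.
  rewrite (_ : D = e + 5); last by rewrite /e; lra.
  have := exprn_ge0 2 e0; have := exprn_ge0 3 e0; nra.
Qed.

Lemma pair_bound2 (R : realFieldType) (D : R) : 7 <= D ->
  2^-1 + 2 * (D - 2)^-1 + D^-1 + (D - 4) * (3 * D - 8)^-1 <= (D + 1 - 50^-1) / (D - 1).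
Proof.
move=> D7; set e := D - 7; have e0 : 0 <= e by rewrite /e; lra.
rewrite (_ : D = e + 7); last by rewrite /e; lra.
have p1 : 0 < e + 7 - 2 by lra.
have p2 : 0 < e + 7 by lra.
have p3 : 0 < 3 * (e + 7) - 8 by lra.
have p4 : 0 < e + 7 - 1 by lra.
rewrite -subr_ge0.
set X := (X in 0 <= X).
pose Q := (e + 7 - 1) * (e + 7 - 2) * (e + 7) * (3 * (e + 7) - 8).
have Q0 : 0 < Q by rewrite /Q !mulr_gt0.
have XQ : X * Q = (e + 8 - 50^-1) * ((e+5) * (e+7) * (3*e+13))
   - (e+6) * (2^-1 * ((e+5) * (e+7) * (3*e+13)) + 2 * ((e+7) * (3*e+13))
       + (e+5)*(3*e+13) + (e+3)*(e+5)*(e+7)).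
  have := mulKf (lt0r_neq0 p1) ((e + 7 - 1) * (e + 7) * (3 * (e + 7) - 8)).
  have := mulKf (lt0r_neq0 p2) ((e + 7 - 1) * (e + 7 - 2) * (3 * (e + 7) - 8)).
  have := mulKf (lt0r_neq0 p3) ((e + 7 - 1) * (e + 7 - 2) * (e + 7) * (e + 3)).
  have := mulKf (lt0r_neq0 p4) ((e + 8 - 50^-1) * (e + 7 - 2) * (e + 7) * (3 * (e + 7) - 8)).
  rewrite /X /Q; lra.
rewrite -(pmulr_lge0 _ Q0) XQ.
have := exprn_ge0 2 e0; have := exprn_ge0 3 e0; have := exprn_ge0 4 e0; nra.
Qed.

Lemma pair_bound3 (R : realFieldType) (D : R) : 7 <= D ->
  3^-1 + 2 * (D + 1)^-1 + 3 * D^-1 + (D - 4) * (2 * D - 4)^-1 <= (D + 1 - 50^-1) / (D - 1).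
Proof.
move=> D7; set e := D - 7; have e0 : 0 <= e by rewrite /e; lra.
rewrite (_ : D = e + 7); last by rewrite /e; lra.
have p1 : 0 < e + 7 + 1 by lra.
have p2 : 0 < e + 7 by lra.
have p3 : 0 < 2 * (e + 7) - 4 by lra.
have p4 : 0 < e + 7 - 1 by lra.
rewrite -subr_ge0.
set X := (X in 0 <= X).
pose Q := (e + 7 - 1) * (e + 7 + 1) * (e + 7) * (2 * (e + 7) - 4).
have Q0 : 0 < Q by rewrite /Q !mulr_gt0.
have XQ : X * Q = (e + 8 - 50^-1) * ((e+8) * (e+7) * (2*e+10))
   - (e+6) * (3^-1 * ((e+8) * (e+7) * (2*e+10)) + 2 * ((e+7) * (2*e+10))
       + 3 * ((e+8)*(2*e+10)) + (e+3)*(e+8)*(e+7)).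
  have := mulKf (lt0r_neq0 p1) ((e + 7 - 1) * (e + 7) * (2 * (e + 7) - 4)).
  have := mulKf (lt0r_neq0 p2) ((e + 7 - 1) * (e + 7 + 1) * (2 * (e + 7) - 4)).
  have := mulKf (lt0r_neq0 p3) ((e + 7 - 1) * (e + 7 + 1) * (e + 7) * (e + 3)).
  have := mulKf (lt0r_neq0 p4) ((e + 8 - 50^-1) * (e + 7 + 1) * (e + 7) * (2 * (e + 7) - 4)).
  rewrite /X /Q; lra.
rewrite -(pmulr_lge0 _ Q0) XQ.
have := exprn_ge0 2 e0; have := exprn_ge0 3 e0; have := exprn_ge0 4 e0; nra.
Qed.

(** Two consecutive small cut sizes in a run of [d + 1] levels. If [X = 2], then [D <= X + Y] forces
    [Y = D - 2], the case of [pair_bound2]; otherwise [X >= 3] and [Y >= (D + 1) / 2] suffice, by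
    [pair_bound3]. *)
Lemma pair_bound (R : realFieldType) (D X Y : R) : 7 <= D -> 2 <= X -> X <= Y -> Y <= D - 2 ->
  D <= X + Y -> X = 2 \/ 3 <= X -> (D + 1) / 2 <= Y ->
  X^-1 + Y^-1 + (2 * D - 2 - X)^-1 + (2 * D - 2 - Y)^-1
    + (2 * D - 2 - X)^-1 + (D - 4) * (3 * D - 6 - X)^-1 <= (D + 1 - 50^-1) / (D - 1).
Proof.
move=> D7 X2 XY YD XYD [X2'|X3] Yh.
  have YE : Y = D - 2 by lra.
  apply: le_trans (pair_bound2 D7); rewrite X2' YE.
  have -> : 2 * D - 2 - 2 = 2 * (D - 2) by lra.
  have -> : 2 * D - 2 - (D - 2) = D by lra.
  have -> : 3 * D - 6 - 2 = 3 * D - 8 by lra.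
  rewrite invfM; lra.
have dec (u v : R) : 0 < u -> u <= v -> v^-1 <= u^-1.
  by move=> u0 uv; rewrite lef_pV2 ?posrE //; apply: lt_le_trans uv.
have i1 : X^-1 <= 3^-1 by apply: dec.
have i2 : Y^-1 <= 2 * (D + 1)^-1.
  by rewrite -[2 * _]invrK invfM invrK mulrC; apply: dec => //; lra.
have i3 : (2 * D - 2 - X)^-1 <= D^-1 by apply: dec; lra.
have i4 : (2 * D - 2 - Y)^-1 <= D^-1 by apply: dec; lra.
have i5 : (D - 4) * (3 * D - 6 - X)^-1 <= (D - 4) * (2 * D - 4)^-1.
  by rewrite ler_wpM2l; [|lra|apply: dec; lra].
apply: le_trans (pair_bound3 D7); lra.
Qed.

Ltac nat_lia := repeat match goal with
  | H : is_true (@Order.le _ _ _ _) |- _ => clear H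
  | H : is_true (@Order.lt _ _ _ _) |- _ => clear H
  | H : forall _, _ |- _ => clear H
  | H : @eq (Num.RealField.sort _) _ _ |- _ => clear H
  end; lia.

(** * Growth rates from abstract cut sizes [c], passing edges [p] and gaps [g] *)

Section Levels.
Variables (R : realFieldType) (d N : nat) (c p : nat -> nat) (g : nat -> R).
Hypotheses (d3 : (3 <= d)%N) (od : odd d) (g0 : forall k, 0 <= g k).
Hypothesis step : forall k, (k < N)%N -> (c k + c k.+1 = 2 * p k + d)%N.
Hypothesis flow1 : forall k, (k <= N)%N -> (c k)%:R * g k <= 1.
Hypothesis flow2 : forall k, (k < N)%N -> (c k)%:R * g k + (p k)%:R * g k.+1 <= 1.
Hypothesis sep : forall i j, (i < j)%N -> (j <= N)%N -> (j - i <= d)%N ->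
  ((j - i) * (d.+1 - (j - i)) <= c i + c j)%N.

Let D : R := d%:R.

Lemma gap_le k m : (k <= N)%N -> (0 < m)%N -> (m <= c k)%N -> g k <= m%:R^-1.
Proof.
move=> kN m0 mc; rewrite -[leRHS]mul1r ler_pdivlMr ?ltr0n // mulrC.
by apply: le_trans (flow1 kN); rewrite ler_wpM2r // ler_nat.
Qed.

Lemma gap_le_real k (m : R) : (k <= N)%N -> 0 < m -> m <= (c k)%:R -> g k <= m^-1.
Proof.
move=> kN m0 mc; rewrite -[leRHS]mul1r ler_pdivlMr // mulrC.
by apply: le_trans (flow1 kN); rewrite ler_wpM2r.
Qed.

Lemma sep_off k i j : (i < j)%N -> (k + j <= N)%N -> (j - i <= d)%N ->
  ((j - i) * (d.+1 - (j - i)) <= c (k + i)%N + c (k + j)%N)%N.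
Proof.
by move=> ij kj jid; have := @sep (k + i) (k + j); rewrite ltn_add2l subnDl; apply.
Qed.

Definition run (k l : nat) : R := \sum_(0 <= i < l) g (k + i)%N.

Lemma run0 k : run k 0 = 0. Proof. by rewrite /run big_geq. Qed.
Lemma run1 k : run k 1 = g k. Proof. by rewrite /run big_nat1 addn0. Qed.
Lemma run_add k l m : run k (l + m) = run k l + run (k + l)%N m.
Proof.
rewrite /run (big_cat_nat (n := l)) ?leq_addr //=; congr (_ + _).
rewrite -{1}[l]add0n big_addn addKn; apply: eq_bigr => i _.
by rewrite addnC -addnA addnCA addnA addnC addnA.
Qed.

Lemma run_le k l (m : R) : (forall i, (i < l)%N -> g (k + i)%N <= m) -> run k l <= l%:R * m.
Proof.
move=> H; rewrite /run big_mkord.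
apply: (@le_trans _ _ (\sum_(i < l) m)); first by apply: ler_sum => i _; apply: H.
by rewrite sumr_const card_ord mulr_natl.
Qed.

(* A level with few crossing edges is steep, but by [sep] it is compensated by the
   [d - 1] levels above it. *)
Lemma small_level k : (k + d <= N)%N -> (2 <= c k)%N -> (2 <= c k.+1)%N -> (c k + 2 <= d)%N ->
  exists2 l, (d <= l <= d.+1)%N & run k l <= (l%:R - 50^-1) / (D - 1).
Proof.
move=> kN ck2 ck12 ckd.
have d5 : (5 <= d)%N by lia.
have D5 : 5 <= D by rewrite /D (ler_nat _ 5%N).
set a := c k in ck2 ckd *; set A : R := a%:R.
have A2 : 2 <= A by rewrite /A (ler_nat _ 2%N).
have AD : A <= D - 2 by rewrite lerBrDr /A /D -(natrD _ a 2%N) ler_nat.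
have sA i : (1 <= i)%N -> (i <= d)%N -> (i * (d.+1 - i) <= a + c (k + i)%N)%N.
  by move=> i1 id; have := @sep_off k 0 i i1; rewrite addn0 subn0; apply; lia.
have c2 : 2 * D - 2 - A <= (c (k + 2)%N)%:R.
  have H : (2 * d <= a + c (k + 2)%N + 2)%N by have := sA 2%N isT (ltnW d3); move: (d3); clear; lia.
  have : (2 * d)%N%:R <= (a + c (k + 2)%N + 2)%N%:R :> R by rewrite ler_nat.
  by rewrite natrM !natrD -/A -/D; lra.
(* [i * (d.+1 - i)] is concave in [i], so on [3 <= i <= d - 2] it is at least its end value
   [3 * (d - 2)]. *)
have mid i : (3 <= i)%N -> (i + 2 <= d)%N -> 3 * D - 6 - A <= (c (k + i)%N)%:R.
  move=> i3 id; have H : (3 * d <= a + c (k + i)%N + 6)%N.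
    have := sA i (ltnW (ltnW i3)) (leq_trans (leq_addr _ _) id).
    rewrite (_ : i * (d.+1 - i) = 3 * (d - 2) + (i - 3) * (d - 2 - i))%N; first by move=> H; have := leq_trans (leq_addr _ _) H; move: (d5); clear; lia.
    move: i3 id; clear => i3 id.
    have [e ->] : exists e, d = (e + i + 2)%N by exists (d - i - 2)%N; nat_lia.
    have [f ->] : exists f, i = (f + 3)%N by exists (i - 3)%N; nat_lia.
    rewrite (_ : (e + (f + 3) + 2).+1 - (f + 3) = e + 3)%N; last by nat_lia.
    rewrite (_ : (e + (f + 3) + 2 - 2) = e + f + 3)%N; last by nat_lia.
    rewrite (_ : (f + 3 - 3) = f)%N; last by nat_lia.
    rewrite (_ : (e + f + 3 - (f + 3)) = e)%N; last by nat_lia.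
    nia.
  have : (3 * d)%N%:R <= (a + c (k + i)%N + 6)%N%:R :> R by rewrite ler_nat.
  by rewrite natrM !natrD -/A -/D; lra.
have cl : 2 * D - 2 - A <= (c (k + d.-1)%N)%:R.
  have H : (2 * d <= a + c (k + d.-1)%N + 2)%N.
    have := sA d.-1; rewrite (_ : d.+1 - d.-1 = 2)%N; last by nat_lia.
    by rewrite leq_pred => /(_ _ isT) H; have := H (_ : 0 < d.-1)%N; move: d5; clear; lia.
  have : (2 * d)%N%:R <= (a + c (k + d.-1)%N + 2)%N%:R :> R by rewrite ler_nat.
  by rewrite natrM !natrD -/A -/D; lra.
have p1 : 0 < A by lra.
have p2 : 0 < 2 * D - 2 - A by lra.
have p3 : 0 < 3 * D - 6 - A by lra.
have gk : g k <= A^-1 by apply: gap_le; nat_lia.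
have g2 : g (k + 2)%N <= (2 * D - 2 - A)^-1 by apply: gap_le_real => //; nat_lia.
have gl : g (k + d.-1)%N <= (2 * D - 2 - A)^-1 by apply: gap_le_real => //; nat_lia.
have gm : run (k + 3)%N (d - 4) <= (D - 4) * (3 * D - 6 - A)^-1.
  have -> : D - 4 = (d - 4)%:R by rewrite natrB //; nat_lia.
  apply: run_le => i id; rewrite -addnA; apply: gap_le_real => //; first by nat_lia.
  by apply: mid; nat_lia.
have splt : run k d = g k + g k.+1 + g (k + 2)%N + run (k + 3)%N (d - 4) + g (k + d.-1)%N.
  have -> : run k d = run k (1 + 1 + 1 + (d - 4) + 1) by congr run; nat_lia.
  rewrite !run_add !run1 addn1 (_ : k + (1 + 1) = k + 2)%N // (_ : k + (1 + 1 + 1) = k + 3)%N //.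
  by rewrite (_ : k + (1 + 1 + 1 + (d - 4)) = k + d.-1)%N //; nat_lia.
have Dn : (d.-1)%:R = D - 1 by rewrite -subn1 natrB //; nat_lia.
have [ns|sm] := leqP d.-1 (c k.+1).
  exists d; first by rewrite leqnn ltnW.
  have g1 : g k.+1 <= (D - 1)^-1 by rewrite -Dn; apply: gap_le; nat_lia.
  have := single_bound D5 A2 AD.
  have -> : (D - 50^-1) / (D - 1) = 1 - (50 * (D - 1))^-1 + (D - 1)^-1.
    have D1 : D - 1 != 0 by rewrite gt_eqF //; lra.
    by rewrite invfM; have := mulfV D1; lra.
  rewrite splt; lra.
(* Now both levels are small. The run is extended to [d + 1] levels, so that the one compensating
   level [k.+1] is included, and [step] keeps [a + b] at least [d]. *)
set b := c k.+1 in ck12 sm *; set B : R := b%:R.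
have B2 : 2 <= B by rewrite /B (ler_nat _ 2%N).
have BD : B <= D - 2 by rewrite lerBrDr /B /D -(natrD _ b 2%N) ler_nat; nat_lia.
have ab : (a + b = 2 * p k + d)%N by apply: step; nat_lia.
have ABD : D <= A + B by rewrite /A /B /D -natrD ab ler_nat leq_addl.
have sB i : (2 <= i)%N -> (i <= d)%N -> (i.-1 * (d.+2 - i) <= b + c (k + i)%N)%N.
  move=> i1 id; have := @sep_off k 1 i i1; rewrite addn1 -/b.
  rewrite (_ : d.+1 - (i - 1) = d.+2 - i)%N ?subn1; first by apply; nat_lia.
  by nat_lia.
have g1 : g k.+1 <= B^-1 by apply: gap_le; nat_lia.
have cd : 2 * D - 2 - B <= (c (k + d)%N)%:R.
  have H : (2 * d <= b + c (k + d)%N + 2)%N.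
    have := sB d; rewrite (_ : d.+2 - d = 2)%N; last by nat_lia.
    by rewrite leqnn => /(_ _ isT) H; have := H (ltnW d3); move: d5; clear; lia.
  have : (2 * d)%N%:R <= (b + c (k + d)%N + 2)%N%:R :> R by rewrite ler_nat.
  by rewrite natrM !natrD -/B -/D; lra.
have q2 : 0 < 2 * D - 2 - B by lra.
have q3 : 0 < 3 * D - 6 - B by lra.
have gd : g (k + d)%N <= (2 * D - 2 - B)^-1 by apply: gap_le_real => //; nat_lia.
have midB i : (4 <= i)%N -> (i < d)%N -> 3 * D - 6 - B <= (c (k + i)%N)%:R.
  move=> i3 id; have H : (3 * d <= b + c (k + i)%N + 6)%N.
    have := sB i (ltnW (ltnW i3)) (ltnW id).
    rewrite (_ : i.-1 * (d.+2 - i) = 3 * (d - 2) + (i - 4) * (d - 1 - i))%N.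
      by move=> H; have := leq_trans (leq_addr _ _) H; move: (d5); clear; lia.
    move: i3 id; clear => i3 id.
    have [e ->] : exists e, d = (e + i + 1)%N by exists (d - i - 1)%N; nat_lia.
    have [f ->] : exists f, i = (f + 4)%N by exists (i - 4)%N; nat_lia.
    rewrite (_ : (e + (f + 4) + 1).+2 - (f + 4) = e + 3)%N; last by nat_lia.
    rewrite (_ : (e + (f + 4) + 1 - 2) = e + f + 3)%N; last by nat_lia.
    rewrite (_ : (f + 4 - 4) = f)%N; last by nat_lia.
    rewrite (_ : (e + (f + 4) + 1 - 1 - (f + 4)) = e)%N; last by nat_lia.
    rewrite (_ : (f + 4).-1 = f + 3)%N; last by nat_lia.
    nia.
  have : (3 * d)%N%:R <= (b + c (k + i)%N + 6)%N%:R :> R by rewrite ler_nat.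
  by rewrite natrM !natrD -/B -/D; lra.
have c3B : 2 * D - 2 - B <= (c (k + 3)%N)%:R.
  have H : (2 * d <= b + c (k + 3)%N + 2)%N by have := sB 3%N isT d3; move: d5; clear; lia.
  have : (2 * d)%N%:R <= (b + c (k + 3)%N + 2)%N%:R :> R by rewrite ler_nat.
  by rewrite natrM !natrD -/B -/D; lra.
have g3B : g (k + 3)%N <= (2 * D - 2 - B)^-1 by apply: gap_le_real => //; nat_lia.
have gmB : run (k + 4)%N (d - 4) <= (D - 4) * (3 * D - 6 - B)^-1.
  have -> : D - 4 = (d - 4)%:R by rewrite natrB //; nat_lia.
  apply: run_le => i id; rewrite -addnA; apply: gap_le_real => //; first by nat_lia.
  by apply: midB; nat_lia.
have splt1 : run k d.+1 = run k d + g (k + d)%N by rewrite -addn1 run_add run1.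
have spltB : run k d = g k + g k.+1 + g (k + 2)%N + g (k + 3)%N + run (k + 4)%N (d - 4).
  have -> : run k d = run k (1 + 1 + 1 + 1 + (d - 4)) by congr run; nat_lia.
  by rewrite !run_add !run1 addn1 (_ : k + (1 + 1) = k + 2)%N // (_ : k + (1 + 1 + 1) = k + 3)%N.
exists d.+1; first by rewrite leqnSn leqnn.
rewrite -natr1 -/D.
(* For [d = 5] the inequality of [pair_bound2] fails, so this case is computed by hand. The extra
   room comes from [flow2], where the edges passing both level [k.+1] and level [k + 2] bound a
   weighted sum of the two gaps. *)
have [d7|d7] := leqP 7 d; last first.
  have dE : d = 5%N by move: d5 d7 od; clear; lia.
  have DE : D = 5 by rewrite /D dE.
  have H2 := flow2 (_ : k.+1 < N)%N.
  have {}H2 : B * g k.+1 + (p k.+1)%:R * g (k + 2)%N <= 1 by rewrite addn2; apply: H2; nat_lia.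
  have pk : (b + c (k + 2)%N = 2 * p k.+1 + 5)%N by rewrite addn2 -dE; apply: step; nat_lia.
  have E6 : run k d.+1 = g k + g k.+1 + g (k + 2)%N + g (k + 3)%N + g (k + 4)%N + g (k + 5)%N.
    rewrite (_ : d.+1 = 1 + 1 + 1 + 1 + 1 + 1)%N ?dE // !run_add !run1 addn1.
    by rewrite (_ : 1 + 1 = 2)%N // (_ : 2 + 1 = 3)%N // (_ : 3 + 1 = 4)%N // (_ : 4 + 1 = 5)%N.
  rewrite E6 DE (_ : 5 - 1 = 4 :> R); last by lra.
  have abE : (a = 2%N /\ b = 3%N) \/ (a = 3%N /\ b = 2%N).
    by move: ab ckd sm ck2 ck12; rewrite dE; clear; lia.
  have c2' : (8 <= a + c (k + 2))%N by have := sA 2%N isT (ltnW d3); rewrite dE.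
  have c3' : (9 <= a + c (k + 3))%N by have := sA 3%N isT d3; rewrite dE.
  have c4' : (8 <= a + c (k + 4))%N by have := sA 4%N isT; rewrite dE; apply.
  have c4'' : (9 <= b + c (k + 4))%N by have := sB 4%N isT; rewrite dE; apply.
  have c5' : (8 <= b + c (k + 5))%N by have := sB 5%N isT; rewrite dE; apply.
  have kN' : (k + 5 <= N)%N by move: kN; rewrite dE.
  have kNi i : (i <= 5)%N -> (k + i <= N)%N by move=> i5; apply: leq_trans kN'; rewrite leq_add2l.
  have kN0 : (k <= N)%N by have := kNi 0%N isT; rewrite addn0.
  case: abE => -[aE bE]; rewrite aE in c2' c3' c4'; rewrite bE in c4'' c5'.
    have pp : (2 <= p k.+1)%N by move: pk c2'; rewrite bE; clear; lia.
    have ppR : 2 * g (k + 2)%N <= (p k.+1)%:R * g (k + 2)%N by rewrite ler_wpM2r // (ler_nat _ 2%N).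
    have BE : B = 3 by rewrite /B bE.
    rewrite BE in H2.
    have e0 : g k <= 2^-1 by apply: (@gap_le _ 2%N); rewrite // -/a aE.
    have e2 : g (k + 2)%N <= 6^-1 by apply: (@gap_le _ 6%N) => //; exact: kNi.
    have e3 : g (k + 3)%N <= 7^-1 by apply: (@gap_le _ 7%N) => //; exact: kNi.
    have e4 : g (k + 4)%N <= 6^-1 by apply: (@gap_le _ 6%N) => //; exact: kNi.
    have e5 : g (k + 5)%N <= 5^-1 by apply: (@gap_le _ 5%N) => //; exact: kNi.
    lra.
  have pp : (1 <= p k.+1)%N by move: pk c2'; rewrite bE; clear; lia.
  have ppR : 1 * g (k + 2)%N <= (p k.+1)%:R * g (k + 2)%N by rewrite ler_wpM2r // (ler_nat _ 1%N).
  have BE : B = 2 by rewrite /B bE.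
  rewrite BE in H2.
  have e0 : g k <= 3^-1 by apply: (@gap_le _ 3%N); rewrite // -/a aE.
  have e2 : g (k + 2)%N <= 5^-1 by apply: (@gap_le _ 5%N) => //; exact: kNi.
  have e3 : g (k + 3)%N <= 6^-1 by apply: (@gap_le _ 6%N) => //; exact: kNi.
  have e4 : g (k + 4)%N <= 7^-1 by apply: (@gap_le _ 7%N) => //; exact: kNi.
  have e5 : g (k + 5)%N <= 6^-1 by apply: (@gap_le _ 6%N) => //; exact: kNi.
  lra.
have D7 : 7 <= D by rewrite /D (ler_nat _ 7%N).
rewrite splt1.
(* the middle levels can be bounded from either of the two small levels; use the smaller *)
have sym (X Y S : R) : (X = A /\ Y = B) \/ (X = B /\ Y = A) -> X <= Y ->
    S <= X^-1 + Y^-1 + (2 * D - 2 - X)^-1 + (2 * D - 2 - Y)^-1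
       + (2 * D - 2 - X)^-1 + (D - 4) * (3 * D - 6 - X)^-1 ->
    S <= (D + 1 - 50^-1) / (D - 1).
  move=> XY leXY /le_trans; apply.
  have X2 : 2 <= X by case: XY => -[-> _].
  have YD : Y <= D - 2 by case: XY => -[_ ->].
  have XYD : D <= X + Y by case: XY => -[-> ->]; rewrite // addrC.
  apply: pair_bound => //.
    have H (m : nat) : (2 <= m)%N -> m%:R = 2 :> R \/ 3 <= m%:R :> R.
      rewrite leq_eqVlt => /orP[/eqP <-|m3]; first by left.
      by right; rewrite (ler_nat _ 3%N).
    by case: XY => -[-> _]; apply: H.
  have H (m m' : nat) : (d <= m + m')%N -> (m <= m')%N -> (D + 1) / 2 <= m'%:R.
    move=> H1 H2; have : (d + 1 <= 2 * m')%N by move: H1 H2 od; clear; lia.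
    by rewrite -(ler_nat R) natrM natrD -/D; lra.
  have abd : (d <= a + b)%N by rewrite ab leq_addl.
  case: XY leXY => -[-> ->]; rewrite ler_nat => ?; first exact: H abd _.
  by apply: H _; first by rewrite addnC in abd; exact: abd.
have [leAB|/ltW leBA] := lerP A B.
  apply: (sym A B) => //; first by left.
  rewrite splt; move: gk g1 g2 gm gl gd; lra.
apply: (sym B A) => //; first by right.
rewrite spltB; move: gk g1 g2 gmB g3B gd; lra.
Qed.

(* Any sufficiently small positive constant depending on [d] only would do. *)
Let eps : R := (50 * D)^-1.
Let D3 : 3 <= D. Proof. by rewrite /D (ler_nat _ 3%N). Qed.
Let Dn : (d.-1)%:R = D - 1. Proof. by rewrite -subn1 natrB //; nat_lia. Qed.

Let eps50 : eps <= 50^-1.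
Proof. by rewrite /eps lef_pV2 ?posrE; move: D3; lra. Qed.

Let eps_gt0 : 0 < eps.
Proof. by rewrite /eps invr_gt0; move: D3; lra. Qed.

Let epsD : D^-1 <= (1 - eps) / (D - 1).
Proof.
have p1 : 0 < D by move: D3; lra.
have p2 : 0 < D - 1 by move: D3; lra.
rewrite ler_pdivlMr // mulrBr mulr1 mulVf ?gt_eqF // lerB // /eps lef_pV2 ?posrE //; lra.
Qed.

Let small_level_eps k : (k + d <= N)%N -> (2 <= c k)%N -> (2 <= c k.+1)%N -> (c k + 2 <= d)%N ->
  exists2 l, (d <= l <= d.+1)%N & run k l <= (l%:R - eps) / (D - 1).
Proof.
move=> kN c1 c2 ck; have [l ld H] := small_level kN c1 c2 ck; exists l => //.
apply: le_trans H _; rewrite ler_pM2r ?invr_gt0; move: D3 eps50; lra.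
Qed.

(** A level with [c k >= d] saves by itself, and one with [c k <= d - 2] saves through
    [small_level]. Only [c k = d - 1] breaks even, and then [c k.+1] has the other parity, so the
    next level cannot break even as well. *)
Lemma block k : (k + d < N)%N -> (forall i, (i <= d.+1)%N -> (2 <= c (k + i))%N) ->
  exists2 l, (1 <= l <= d.+2)%N & run k l <= (l%:R - eps) / (D - 1).
Proof.
move=> kN c2.
have ck := c2 0%N isT; rewrite addn0 in ck.
have ck1 := c2 1%N isT; rewrite addn1 in ck1.
have ck2 := c2 2%N (ltnW (ltnW d3)); rewrite addn2 in ck2.
have [cd|cd] := leqP d (c k).
  exists 1%N => //; rewrite run1; apply: le_trans epsD.
  by apply: gap_le => //; nat_lia.
have [cs|cs] := leqP (c k + 2) d.
  have [l /andP[l1 l2] H] := small_level_eps (ltnW kN) ck ck1 cs.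
  by exists l => //; apply/andP; split; nat_lia.
have cE : c k = d.-1 by nat_lia.
have st := step (leq_ltn_trans (leq_addr d k) kN).
have gk : g k <= (D - 1)^-1 by rewrite -Dn; apply: gap_le => //; nat_lia.
have [cd'|cd'] := leqP d (c k.+1).
  exists 2%N => //; rewrite (_ : 2 = 1 + 1)%N // run_add !run1 addn1.
  have g1 : g k.+1 <= D^-1 by apply: gap_le => //; nat_lia.
  rewrite (_ : _ / _ = (D - 1)^-1 + (1 - eps) / (D - 1)); first by move: epsD; lra.
  rewrite natrD; lra.
have cs' : (c k.+1 + 2 <= d)%N by move: st cd' od d3; rewrite cE; clear; lia.
have kN' : (k.+1 + d <= N)%N by rewrite addSn.
have [l /andP[l1 l2] H] := small_level_eps kN' ck1 ck2 cs'.
exists l.+1; first by nat_lia.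
rewrite -add1n run_add run1 addn1 natrD.
rewrite (_ : _ / _ = (D - 1)^-1 + (l%:R - eps) / (D - 1)); first by lra.
lra.
Qed.

(** Going down from the bridge, [sep] with [c K = 1] gives each of the next [d] levels a cut size of
    at least [d - 1], so none exceeds the critical rate, and the second one at least [2 d - 3],
    which saves. From further down, one saving piece is combined with the bound for the remaining
    distance. *)
Lemma growth_bridge K : (2 <= K)%N -> (K <= N)%N -> c K = 1%N ->
  (forall i, (i < K)%N -> (2 <= c i)%N) -> run 0 K <= (K%:R - eps) / (D - 1).
Proof.
move=> K2 KN cK c2.
have p2 : 0 < D - 1 by move: D3; lra.
suff H r : (r <= K)%N -> run (K - r) r <= r%:R / (D - 1) /\
    ((2 <= r)%N -> run (K - r) r <= (r%:R - eps) / (D - 1)).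
  by have [_ /(_ K2)] := H K (leqnn K); rewrite subnn.
have le_eps (m : R) : (m - eps) / (D - 1) <= m / (D - 1).
  by rewrite ler_pM2r ?invr_gt0 //; move: eps_gt0; lra.
elim/ltn_ind: r => r IH rK.
have near s : (1 <= s)%N -> (s <= d)%N -> (s <= K)%N -> (s * (d.+1 - s) <= (c (K - s)).+1)%N.
  move=> s1 sd sK; have := @sep (K - s) K; rewrite cK addn1 subKn //; apply=> //.
  by move: s1 sK; clear; lia.
have near1 s : (1 <= s)%N -> (s <= d)%N -> (s <= K)%N -> g (K - s)%N <= (D - 1)^-1.
  move=> s1 sd sK; rewrite -Dn; apply: gap_le; [by nat_lia | by nat_lia|].
  have := near s s1 sd sK.
  have : (d <= s * (d.+1 - s))%N.
    have [e ->] : exists e, d = (e + s)%N by exists (d - s)%N; nat_lia.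
    by rewrite (_ : (e + s).+1 - s = e.+1)%N; nia.
  by clear; lia.
have [rd|rd] := leqP r d.
  have H0 : run (K - r) r <= r%:R / (D - 1).
    apply: run_le => i ir; rewrite (_ : K - r + i = K - (r - i))%N; last by nat_lia.
    by apply: near1; nat_lia.
  split=> // r2.
  have -> : run (K - r) r = run (K - r) (r - 2) + g (K - 2)%N + g (K - 1)%N.
    have -> : run (K - r) r = run (K - r) (r - 2 + 1 + 1) by congr run; move: r2; clear; lia.
    have q1 : (K - r + (r - 2) = K - 2)%N by move: r2 rK; clear; lia.
    have q2 : (K - r + (r - 2 + 1) = K - 1)%N by move: r2 rK; clear; lia.
    by rewrite !run_add !run1 q1 q2.
  have h1 : run (K - r) (r - 2) <= (r - 2)%:R / (D - 1).
    apply: run_le => i ir; rewrite (_ : K - r + i = K - (r - i))%N; last by nat_lia.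
    by apply: near1; nat_lia.
  have h2 : g (K - 1)%N <= (D - 1)^-1 by apply: near1; nat_lia.
  have h3 : g (K - 2)%N <= D^-1.
    apply: gap_le; [by nat_lia | by nat_lia|].
    by have := near 2%N isT (ltnW d3) K2; move: d3; clear; lia.
  have -> : (r%:R - eps) / (D - 1) = (r - 2)%:R / (D - 1) + (1 - eps) / (D - 1) + (D - 1)^-1.
    by rewrite natrB //; lra.
  by move: epsD; lra.
have use l : (0 < l)%N -> (l <= r)%N -> run (K - r) l <= (l%:R - eps) / (D - 1) ->
    run (K - r) r <= (r%:R - eps) / (D - 1).
  move=> l0 lr H.
  have rl1 : (r - l < r)%N by move: l0 lr; clear; lia.
  have rl2 : (r - l <= K)%N by move: rK; clear; lia.
  have [H1 _] := IH (r - l)%N rl1 rl2.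
  have -> : run (K - r) r = run (K - r) (l + (r - l)) by rewrite subnKC.
  rewrite run_add (_ : K - r + l = K - (r - l))%N; last by nat_lia.
  have -> : (r%:R - eps) / (D - 1) = (l%:R - eps) / (D - 1) + (r - l)%:R / (D - 1).
    by rewrite natrB //; lra.
  by rewrite lerD // H1 //; nat_lia.
suff fin : run (K - r) r <= (r%:R - eps) / (D - 1).
  by split => //; apply: le_trans fin (le_eps _).
(* [block] inspects [d + 2] levels, all of which must lie below the bridge; [r = d + 1] is one too
   few and is treated apart. *)
have [rd1|rd2] := leqP r d.+1; last first.
  have [||l l1 H] := @block (K - r).
  - by nat_lia.
  - by move=> i id; apply: c2; nat_lia.
  by apply: (use l) => //; nat_lia.
have rE : r = d.+1 by nat_lia.
have [cs|cs] := leqP (c (K - r) + 2) d.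
  have [||||l l1 H] := @small_level_eps (K - r) => //.
  - by nat_lia.
  - by apply: c2; nat_lia.
  - by apply: c2; nat_lia.
  by apply: (use l) => //; nat_lia.
have dr : (d < r)%N by rewrite rE.
have dK : (d <= K)%N by apply: leq_trans rK; exact: ltnW.
have [_ H1] := IH d dr dK.
have -> : run (K - r) r = g (K - r)%N + run (K - d) d.
  have -> : run (K - r) r = run (K - r) (1 + d) by congr run; nat_lia.
  by rewrite run_add run1; congr (_ + run _ _); nat_lia.
have h1 : g (K - r)%N <= (D - 1)^-1 by rewrite -Dn; apply: gap_le; nat_lia.
have -> : (r%:R - eps) / (D - 1) = (D - 1)^-1 + (d%:R - eps) / (D - 1).
  by rewrite rE -natr1; lra.
by rewrite lerD // H1 //; nat_lia.
Qed.

(** Each block has at most [d + 2] levels and saves [eps], hence [eps / (d + 2)] per level on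
    average. The additive constant absorbs the last incomplete block, where only [c >= 2] is
    used. *)
Lemma growth_linear M : (M + d < N)%N -> (forall i, (i <= M + d)%N -> (2 <= c i)%N) ->
  run 0 M <= (M%:R * (1 - eps / d.+2%:R) + (d * d.+2)%:R) / (D - 1).
Proof.
move=> MN c2.
have p2 : 0 < D - 1 by move: D3; lra.
have p3 : (0 : R) < d.+2%:R by rewrite ltr0n.
set q := eps / d.+2%:R.
have q0 : 0 < q by rewrite divr_gt0.
suff H m k : (k + m = M)%N -> run k m <= (m%:R * (1 - q) + (d * d.+2)%:R) / (D - 1).
  exact: H.
elim/ltn_ind: m k => m IH k kM.
have [md|md] := ltnP m d.+2.
  have h1 : run k m <= m%:R * 2^-1.
    by apply: run_le => i im; apply: (@gap_le _ 2%N) => //; [nat_lia | apply: c2; nat_lia].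
  apply: le_trans h1 _; rewrite ler_pdivlMr //.
  have h2 : m%:R * (D - 1) <= (d * d.+2)%:R.
    rewrite -Dn -natrM ler_nat mulnC; apply: leq_mul; first exact: leq_pred.
    exact: ltnW.
  have h3 : q <= 1.
    rewrite /q ler_pdivrMr // mul1r; apply: (le_trans eps50).
    by apply: le_trans (_ : 1 <= _); [lra | rewrite (ler_nat _ 1%N)].
  have : 0 <= m%:R * (1 - q) by rewrite mulr_ge0 ?ler0n //; lra.
  have : 0 <= (d * d.+2)%:R :> R by rewrite ler0n.
  lra.
have [||l /andP[l1 l2] H] := @block k.
- by nat_lia.
- move=> i id; have [iM|iM] := leqP (k + i) (M + d); first exact: c2.
  by nat_lia.
have lm : (l <= m)%N by nat_lia.
have ml : (m - l < m)%N by move: l1 lm; clear; lia.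
have := IH (m - l)%N ml (k + l)%N; rewrite -addnA subnKC // => /(_ kM) H2.
have -> : run k m = run k (l + (m - l)) by rewrite subnKC.
rewrite run_add.
have h4 : l%:R * q <= eps.
  rewrite /q mulrA ler_pdivrMr // mulrC ler_pM2l ?ler_nat //.
apply: (@le_trans _ _ ((l%:R - l%:R * q) / (D - 1) + ((m - l)%:R * (1 - q) + (d * d.+2)%:R) / (D - 1))).
  apply: lerD; last exact: H2.
  by apply: (le_trans H); rewrite ler_pM2r ?invr_gt0 //; lra.
rewrite -mulrDl ler_pM2r ?invr_gt0 // natrB //; lra.
Qed.

End Levels.

(** * Cuts of a graph along the order of increasing eigenvector entries *)

Section GraphLevels.
Variables (R : realFieldType) (d : nat) (G : graph) (x : G -> R) (mu : R) (z : G).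
Hypotheses (xpos : forall v, 0 < x v) (dG : forall v : G, (deg v <= d)%N) (cG : conn G).
Hypothesis eig : forall v, d%:R * x v - \sum_w (edge v w)%:R * x w = mu * x v.
Hypotheses (mu0 : 0 < mu) (zmax : forall v, x v <= x z).
Hypothesis F0pos : 0 < outflow x mu.
Local Notation F0 := (outflow x mu).
Let sub_outflow := sub_outflow xpos mu0.
Let flow := flow eig.

Definition ranking : seq G := sort (fun u v => x u <= x v) (enum G).

Let size_ranking : size ranking = #|G|.
Proof. by rewrite size_sort cardT. Qed.

Let mem_ranking v : v \in ranking.
Proof. by rewrite mem_sort mem_enum. Qed.

Let uniq_ranking : uniq ranking.
Proof. by rewrite sort_uniq enum_uniq. Qed.

Let sorted_ranking : sorted (fun u v => x u <= x v) ranking.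
Proof. by apply: sort_sorted => u v; exact: le_total. Qed.

Definition lower (k : nat) : {set G} := [set v | (index v ranking < k)%N].

(** [level 0] is the ground. The default [z] of [nth] keeps all levels beyond the last vertex at the
    largest entry, so the sequence is nondecreasing for all indices. *)
Definition level (k : nat) : R := if k is k'.+1 then x (nth z ranking k') else 0.

Lemma card_lower k : (k <= #|G|)%N -> #|lower k| = k.
Proof.
move=> kn; transitivity (size (take k ranking)); last by rewrite size_takel // size_ranking.
rewrite -(card_uniqP (take_uniq k uniq_ranking)); apply: eq_card => v.
by rewrite inE in_take.
Qed.

Lemma lower_sub i j : (i <= j)%N -> lower i \subset lower j.
Proof. by move=> ij; apply/subsetP => v; rewrite !inE => /leq_trans; apply. Qed.

Lemma ranking_le u v : (index u ranking <= index v ranking)%N -> x u <= x v.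
Proof.
move=> uv; rewrite -(nth_index z (mem_ranking u)) -(nth_index z (mem_ranking v)).
apply: (sorted_leq_nth (leT := fun a b => x a <= x b)) => //.
- by move=> a b e ab; exact: le_trans.
- by rewrite inE index_mem.
- by rewrite inE index_mem.
Qed.

Lemma level_upper k v : v \notin lower k -> level k.+1 <= x v.
Proof.
rewrite inE -leqNgt /= => kv; apply: ranking_le; rewrite index_uniq //.
by apply: leq_ltn_trans kv _; rewrite index_mem.
Qed.

Lemma level_lower k v : v \in lower k -> x v <= level k.
Proof.
rewrite inE; case: k => // k; rewrite ltnS => vk /=.
have [kn|kn] := ltnP k (size ranking).
  by apply: ranking_le; rewrite (index_uniq _ kn uniq_ranking).
by rewrite nth_default.
Qed.

Lemma level_le k : level k <= level k.+1.
Proof.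
case: k => [|k] /=; first exact: ltW.
have [kn|kn] := ltnP k.+1 (size ranking); last by rewrite (nth_default _ kn).
apply: ranking_le; rewrite !index_uniq //; exact: ltnW.
Qed.

Lemma level_ge0 k : 0 <= level k.
Proof. by elim: k => // k /le_trans; apply; exact: level_le. Qed.

Definition cut (A B : {set G}) : nat := (\sum_(v in B) (d - deg v + \sum_(w in A) edge v w))%N.

Definition cutsize k := cut (lower k) (~: lower k).
(* the part of the cut that also crosses the next level *)
Definition passing k := cut (lower k) (~: lower k.+1).
Definition gap k : R := (level k.+1 - level k) / F0.

Lemma gap_ge0 k : 0 <= gap k.
Proof. by rewrite divr_ge0 ?(ltW F0pos) // subr_ge0 level_le. Qed.

Lemma run_gap k : run gap 0 k = level k / F0.
Proof.
elim: k => [|k IH]; first by rewrite run0 mul0r.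
by rewrite -addn1 run_add run1 IH add0n addn1 /gap -mulrDl; congr (_ / _); lra.
Qed.

(** Every edge or missing edge across cut [k] drops at least by the gap there, and those counted by
    [passing] drop by the next gap as well. Their total current is at most F. *)
Lemma flow_levels k :
  (cutsize k)%:R * (level k.+1 - level k) + (passing k)%:R * (level k.+2 - level k.+1) <= F0.
Proof.
apply: le_trans (sub_outflow (~: lower k)); rewrite flow setCK.
rewrite -big_split /= /cutsize /passing /cut !natr_sum !mulr_suml.
have sub v : v \in ~: lower k.+1 -> v \in ~: lower k.
  by rewrite !in_setC; apply: contra; apply: subsetP; exact: lower_sub.
pose b v : R := (v \in ~: lower k.+1)%:R.
have -> : \sum_(v in ~: lower k.+1) (d - deg v + \sum_(w in lower k) edge v w)%:R * (level k.+2 - level k.+1)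
   = \sum_(v in ~: lower k) b v * ((d - deg v + \sum_(w in lower k) edge v w)%:R * (level k.+2 - level k.+1)).
  rewrite [RHS]big_mkcond [LHS]big_mkcond /=; apply: eq_bigr => v _; rewrite /b.
  case: (boolP (v \in ~: lower k.+1)) => [/sub ->|_]; first by rewrite mul1r.
  by rewrite mul0r if_same.
rewrite -big_split /=; apply: ler_sum => v vk.
have xv : level k.+1 - level k + b v * (level k.+2 - level k.+1) <= x v - level k.
  rewrite /b; case: (boolP (v \in ~: lower k.+1)) => [|_].
    by rewrite mul1r in_setC => /level_upper; lra.
  by rewrite mul0r; move: vk; rewrite in_setC => /level_upper; lra.
have k0 := level_ge0 k.
pose dd : R := (d - deg v)%:R.
have ddE : d%:R - (deg v)%:R = dd :> R by rewrite /dd natrB.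
have dd0 : 0 <= dd by rewrite /dd.
have H1 : dd * (level k.+1 - level k + b v * (level k.+2 - level k.+1)) <= dd * x v.
  by rewrite ler_wpM2l //; lra.
have H2 : (\sum_(w in lower k) edge v w)%:R * (level k.+1 - level k + b v * (level k.+2 - level k.+1))
   <= \sum_(w in lower k) (edge v w)%:R * (x v - x w).
  rewrite natr_sum mulr_suml; apply: ler_sum => w wk; rewrite ler_wpM2l //.
  have := level_lower wk; lra.
rewrite ddE; apply: le_trans (lerD H1 H2).
by rewrite natrD -/(level k.+1) -/(level k.+2) le_eqVlt; apply/orP; left; apply/eqP; lra.
Qed.

Lemma gap_flow2 k : (cutsize k)%:R * gap k + (passing k)%:R * gap k.+1 <= 1.
Proof.
by rewrite /gap !mulrA -mulrDl ler_pdivrMr // mul1r; exact: flow_levels.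
Qed.

Lemma gap_flow1 k : (cutsize k)%:R * gap k <= 1.
Proof.
apply: le_trans (gap_flow2 k); rewrite lerDl mulr_ge0 ?gap_ge0 //.
Qed.

Lemma split_deg (A : {set G}) (v : G) :
  (\sum_(w in A) edge v w + \sum_(w in ~: A) edge v w = deg v)%N.
Proof.
rewrite [RHS](bigID (mem A)) /=; congr (_ + _)%N.
by apply: eq_bigl => w; rewrite inE.
Qed.

(** Passing one vertex exchanges its downward edges for its upward ones. Together with its missing
    degree these make up [d], and all other cut edges are counted twice; for odd [d] this is the
    change of parity. *)
Lemma cutsize_step k : (k < #|G|)%N -> (cutsize k + cutsize k.+1 = 2 * passing k + d)%N.
Proof.
move=> kn; have [v v_k] : exists v, lower k.+1 = v |: lower k /\ v \notin lower k.
  have ks : (k < size ranking)%N by rewrite size_ranking.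
  exists (nth z ranking k); split; last by rewrite inE index_uniq // ltnn.
  apply/setP => u; rewrite !inE ltnS leq_eqVlt; congr (_ || _).
  apply/eqP/eqP => [<-|->]; first by rewrite nth_index.
  by rewrite index_uniq.
case: v_k => Lk vk.
have Uk : ~: lower k = v |: ~: lower k.+1.
  rewrite Lk; apply/setP => u; rewrite in_setU1 !in_setC in_setU1.
  by case: eqVneq => [->|_] //=; rewrite vk.
have vk1 : v \notin ~: lower k.+1 by rewrite Lk in_setC in_setU1 eqxx.
have c1 : cutsize k = (d - deg v + \sum_(w in lower k) edge v w + passing k)%N.
  by rewrite /cutsize /cut Uk (big_setU1 _ vk1) /=.
have c2 : cutsize k.+1 = (passing k + \sum_(w in ~: lower k.+1) edge v w)%N.
  rewrite /cutsize /passing /cut -big_split /=; apply: eq_bigr => u _.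
  have -> : (\sum_(w in lower k.+1) edge u w = edge v u + \sum_(w in lower k) edge u w)%N.
    by rewrite Lk (big_setU1 _ vk) /= edge_sym.
  by clear; lia.
have c3 : (\sum_(w in lower k) edge v w + \sum_(w in ~: lower k.+1) edge v w = deg v)%N.
  rewrite -(split_deg (lower k)) Uk; congr (_ + _)%N.
  by rewrite (big_setU1 _ vk1) /= edge_irr.
have := dG v; move: c1 c2 c3; clear; lia.
Qed.

(** Each of the [j - i] vertices between the two cuts has fewer than [j - i] neighbours among them,
    so at least [d.+1 - (j - i)] of its [d] edges, missing ones included, cross one of the cuts. *)
Lemma cutsize_sep i j : (i < j)%N -> (j <= #|G|)%N -> (j - i <= d)%N ->
  ((j - i) * (d.+1 - (j - i)) <= cutsize i + cutsize j)%N.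
Proof.
move=> ij jn jid; pose W := lower j :\: lower i.
have cW : #|W| = (j - i)%N.
  rewrite cardsD (setIidPr (lower_sub (ltnW ij))) !card_lower //.
  exact: leq_trans (ltnW ij) jn.
have H1 : (\sum_(v in W) (d - deg v + \sum_(w in lower i) edge v w) <= cutsize i)%N.
  rewrite /cutsize /cut [leqRHS](bigID (mem W)) /= -[leqLHS]addn0 leq_add //.
  rewrite leq_eqVlt; apply/orP; left; apply/eqP; apply: eq_bigl => v.
  by rewrite !inE; case: (_ < i)%N; rewrite ?andbF ?andbT.
have H2 : (\sum_(v in W) \sum_(w in ~: lower j) edge v w <= cutsize j)%N.
  rewrite exchange_big /cutsize /cut /=; apply: leq_sum => v vj.
  apply: leq_trans (leq_addl _ _).
  rewrite [leqRHS](bigID (mem W)) /= -[leqLHS]addn0 leq_add //.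
  rewrite leq_eqVlt; apply/orP; left; apply/eqP; apply: eq_big => w.
    by rewrite !inE; case: (_ < i)%N; rewrite ?andbF ?andbT ?andbb.
  by rewrite edge_sym.
have H3 v : v \in W -> (d.+1 - #|W| <= d - deg v + \sum_(w in lower i) edge v w + \sum_(w in ~: lower j) edge v w)%N.
  move=> vW.
  have H4 : (deg v = \sum_(w in lower i) edge v w + \sum_(w in W) edge v w + \sum_(w in ~: lower j) edge v w)%N.
    rewrite -(split_deg (lower j)); congr (_ + _)%N.
    rewrite (big_setID (lower i)) /= (setIidPr (lower_sub (ltnW ij))) //.
  have H5 : (\sum_(w in W) edge v w < #|W|)%N.
    rewrite -sum1_card (bigD1 v) //= [ltnRHS](bigD1 v) //= edge_irr add0n add1n ltnS.
    by apply: leq_sum => w _; case: (edge v w).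
  have := dG v; move: H4 H5; clear; lia.
apply: (@leq_trans (\sum_(v in W) (d - deg v + \sum_(w in lower i) edge v w + \sum_(w in ~: lower j) edge v w))%N).
  by rewrite -cW -sum_nat_const; apply: leq_sum => v vW; exact: H3.
by rewrite big_split /= leq_add.
Qed.

Lemma cutsize0 : cutsize 0 = deficit d G.
Proof.
rewrite /cutsize /cut /deficit (eq_bigl xpredT) => [|v]; last by rewrite !inE.
by apply: eq_bigr => v _; rewrite big1 ?addn0 // => w; rewrite inE.
Qed.

Lemma cutsize_gt0 k : (0 < k)%N -> (k < #|G|)%N -> (0 < cutsize k)%N.
Proof.
move=> k0 kn.
have ck := card_lower (ltnW kn).
have [||u [v [uk vk uv]]] := @conn_crossing G (lower k) cG.
- by rewrite -card_gt0 ck.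
- by rewrite -card_gt0 cardsCs setCK ck subn_gt0.
rewrite /cutsize /cut (bigD1 v) ?inE //=; last by move: vk; rewrite inE.
by rewrite (bigD1 u) //= edge_sym uv addnA addnAC addn1 addSn.
Qed.

(** Connectivity makes the single unit of the cut a real edge, ending in [a]. So no degree is
    missing above the bridge, and in the induced graph [a] alone is deficient, by one. *)
Lemma bridge_vertex k : (0 < k)%N -> (k < #|G|)%N -> cutsize k = 1%N ->
  exists2 a, a \in ~: lower k &
   forall v, v \in ~: lower k -> (\sum_(w in ~: lower k) edge v w + (v == a) = d)%N.
Proof.
move=> k0 kn c1.
have ck := card_lower (ltnW kn).
have [||u [a [uk ak ua]]] := @conn_crossing G (lower k) cG.
- by rewrite -card_gt0 ck.
- by rewrite -card_gt0 cardsCs setCK ck subn_gt0.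
have aU : a \in ~: lower k by rewrite inE.
exists a => // v vU.
pose f v := (d - deg v + \sum_(w in lower k) edge v w)%N.
have fa : (0 < f a)%N by rewrite /f (bigD1 u) //= edge_sym ua addnA addnAC addn1.
have {}c1 : (\sum_(v in ~: lower k) f v = 1)%N by [].
have fv : f v = (v == a) :> nat.
  move: c1; rewrite (bigD1 a) //=.
  case: (eqVneq v a) => [->|va] /=; first by move: fa; clear; lia.
  by rewrite (bigD1 v) ?vU //=; move: fa; clear; lia.
have := split_deg (lower k) v; have := dG v; rewrite -fv /f; clear; lia.
Qed.

End GraphLevels.

(** * Bridges in large extremal graphs *)

(* The [x]-data of an extremal graph; [mu] is [d - lambda_1] and [x z] the largest entry. *)
Record perron (R : realFieldType) (d n : nat) (G : graph) (x : G -> R) (mu : R) (z : G) : Prop :=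
  Perron {
    perron_pos : forall v, 0 < x v;
    perron_deg : forall v : G, (deg v <= d)%N;
    perron_conn : conn G;
    perron_eig : forall v, d%:R * x v - \sum_w (edge v w)%:R * x w = mu * x v;
    perron_max : forall v, x v <= x z;
    perron_min : minimal d n mu;
    perron_card : #|G| = n;
    perron_hasd : exists v : G, deg v = d;
    perron_defect : (0 < deficit d G)%N;
    perron_mu : 0 < mu }.

Section Quantitative.
Variables (R : realFieldType) (d : nat).
Hypotheses (d3 : (3 <= d)%N) (od : odd d).
Let D : R := d%:R.

Let D3 : 3 <= D. Proof. by rewrite /D (ler_nat _ 3%N). Qed.

Lemma outflow_gt0 n (G : graph) (x : G -> R) mu z : perron d n x mu z -> 0 < outflow x mu.
Proof.
move=> P; rewrite /outflow mulr_gt0 ?(perron_mu P) // (bigD1 z) //= ltr_pwDl ?(perron_pos P) //.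
by apply: sumr_ge0 => v _; rewrite ltW ?(perron_pos P).
Qed.

(** The chain in [small_gap] gets the fixed length [2 * E], while its lump takes at least half of
    all vertices; hence [mu * n * E <= 1], and F is at most [mu * n * x z]. *)
Lemma small_data (E : nat) : exists n1, forall n (G : graph) (x : G -> R) mu z,
  (n1 <= n)%N -> perron d n x mu z -> mu * E%:R <= 1 /\ outflow x mu * E%:R <= x z.
Proof.
pose J := (2 * E)%N.
exists (2 * (J * d.+1 + 2 * d + 3))%N => n G x mu z nl P.
have mu0 := perron_mu P; have Xp := perron_pos P z.
have [k [s [nE os sl sn]]] : exists (k : bool) (s : nat),
    [/\ n = (s + J * d.+1 + k)%N, odd s, (2 * d + 2 <= s)%N & (n <= 2 * s)%N].
  have oJ : odd (J * d.+1) = false by rewrite /J -mulnA oddM.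
  exists (~~ odd n), (n - J * d.+1 - ~~ odd n)%N.
  move: nl oJ; move: (J * d.+1)%N => A nl oA.
  by split; case on : (odd n); rewrite /= ?subn0 ?addn0 ?addn1; move: nl oA on; clear; lia.
have := small_gap (perron_min P) d3 od (ltW mu0) nE os sl.
have d1 : (0 : R) < d.-1%:R by rewrite ltr0n; move: d3; clear; lia.
have JE : 2 * E%:R * d.-1%:R <= (d.-1 + J * d.+1)%:R :> R.
  rewrite -natrM -natrM ler_nat /J; apply: leq_trans (leq_addl _ _).
  by rewrite leq_mul2l; apply/orP; right; rewrite ltnW // ltnS leq_pred.
move=> H; have H1 : mu * s%:R * (2 * E%:R * d.-1%:R) <= d.-1%:R.
  by apply: le_trans H; rewrite ler_wpM2l // mulr_ge0 // ltW.
have H2 : mu * s%:R * (2 * E%:R) <= 1.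
  rewrite -(ler_pM2r d1) mul1r; apply: le_trans H1.
  by rewrite le_eqVlt; apply/orP; left; apply/eqP; lra.
have H3 : mu * n%:R * E%:R <= 1.
  apply: le_trans H2; have -> : mu * s%:R * (2 * E%:R) = mu * (2 * s)%N%:R * E%:R by rewrite natrM; lra.
  by rewrite ler_wpM2r // ler_wpM2l ?(ltW mu0) // ler_nat.
have n0 : (1 <= n)%N by move: nl; clear; lia.
split.
  apply: le_trans H3; rewrite ler_wpM2r // ler_peMr ?(ltW mu0) //.
  by rewrite (ler_nat _ 1%N).
have sx : \sum_v x v <= n%:R * x z.
  rewrite -(perron_card P) -sum1_card natr_sum mulr_suml; apply: ler_sum => v _.
  by rewrite mul1r (perron_max P).
rewrite /outflow; apply: (@le_trans _ _ (mu * (n%:R * x z) * E%:R)).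
  by rewrite ler_wpM2r // ler_wpM2l // ltW.
have -> : mu * (n%:R * x z) * E%:R = mu * n%:R * E%:R * x z by lra.
by rewrite ler_piMl // ltW.
Qed.

(** All correction terms in [extend_bottom] contain a factor [mu] or [Y / X], hence [e] times a
    constant. Together they are worth at most one more plateau vertex, the final [+ 1]. *)
Lemma balance_num (X mu F L H N j j' e Y h : R) :
  0 < X -> 0 < mu -> 0 <= F -> 0 <= L -> 0 <= H -> 0 <= N -> 0 <= j' -> j' <= j ->
  mu <= e -> F <= e * X -> 0 <= e -> e * L <= 1 ->
  e * (3 * H ^+ 2 * N + 3 * (j - j') * L + 4 * j' * H) <= 1 ->
  Y = F / (D - 1) * L -> h = mu * X * H ->
  F / (D - 1) * F * L <= 3 * h ^+ 2 * N + mu * (j * (X + Y) ^+ 2 - j' * (X + Y - h) ^+ 2) ->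
  F / (D - 1) * F * L <= mu * X ^+ 2 * (j - j' + 1).
Proof.
move=> X0 mu0 F0 L0 H0 N0 j0 jj mue FX e0 eL small YE hE /le_trans; apply.
have [y [YX y0 y1 yL]] : exists y, [/\ Y = y * X, 0 <= y, y <= 1 & y <= e * L].
  have q1 : F / (D - 1) <= e * X.
    rewrite ler_pdivrMr; last by move: D3; lra.
    by apply: (le_trans FX); rewrite ler_peMr ?mulr_ge0 ?(ltW X0) //; move: D3; lra.
  have q2 : Y / X <= e * L.
    by rewrite ler_pdivrMr // YE [e * L * X]mulrAC ler_wpM2r.
  exists (Y / X); split=> //; first by rewrite divfK // gt_eqF.
    rewrite divr_ge0 ?(ltW X0) // YE mulr_ge0 // divr_ge0 //; move: D3; lra.
  exact: le_trans q2 eL.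
rewrite YX hE.
have -> : 3 * (mu * X * H) ^+ 2 * N + mu * (j * (X + y * X) ^+ 2 - j' * (X + y * X - mu * X * H) ^+ 2) =
  mu * X ^+ 2 * (3 * mu * H ^+ 2 * N + (j - j') * (1 + y) ^+ 2 + 2 * j' * (1 + y) * (mu * H) - j' * (mu * H) ^+ 2).
  by lra.
rewrite ler_wpM2l //; first by rewrite mulr_ge0 ?sqr_ge0 // ltW.
have t1 : mu * (H ^+ 2 * N) <= e * (H ^+ 2 * N) by rewrite ler_wpM2r // mulr_ge0 ?sqr_ge0.
have t2 : (j - j') * (1 + y) ^+ 2 <= (j - j') * (1 + 3 * (e * L)).
  by rewrite ler_wpM2l ?subr_ge0 //; nra.
have t3 : j' * (1 + y) * (mu * H) <= j' * 2 * (e * H).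
  apply: ler_pM; rewrite ?mulr_ge0 //; [lra | exact: ltW | |].
    by rewrite ler_wpM2l //; lra.
  by rewrite ler_wpM2r.
have t4 : 0 <= j' * (mu * H) ^+ 2 by rewrite mulr_ge0 ?sqr_ge0.
lra.
Qed.

(** The quantitative form of (1), with [(E + 1) / E] for [1 + o(1)]. A chain of [J] units takes
    [J * d.+1] plateau vertices plus an overhead of at most [sm.+1]; with [J = E * sm.+1] the
    overhead is at most the fraction [1 / E]. *)
Lemma balance (E : nat) : exists n2, forall n (G : graph) (x : G -> R) mu z,
  (n2 <= n)%N -> perron d n x mu z ->
  E%:R * outflow x mu ^+ 2 <= (E%:R + 1) * (D - 1) * (mu * x z ^+ 2).
Proof.
pose sm := (2 * d + d.+1 * d + 4)%N.
pose J := (E * sm.+1)%N.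
pose j' := (2 * d + d.+1 * d + 1)%N.
pose jm := (j' + sm + J * d.+1)%N.
pose L := (d.-1 + J * d.+1)%N.
pose H := (jm.+1 ^ 2)%N.
pose E1 := (3 * H ^ 2 * (d * jm) + 3 * jm * L + 4 * j' * H + L + 2 * H + 2)%N.
have [n1 small] := small_data E1.
exists (maxn n1 jm.+1) => n G x mu z; rewrite geq_max => /andP[n1n jn] P.
have [muE FE] := small n G x mu z n1n P.
have mu0 := perron_mu P; have X0 := perron_pos P z.
have F0 := ltW (outflow_gt0 P).
set F := outflow x mu in FE F0 *; set X := x z in FE X0 *.
have defl := deficit_le (perron_pos P) (perron_deg P) (perron_conn P) (perron_eig P) mu0 (perron_min P) (perron_card P) d3 od (perron_hasd P).
(* [s] gets the parity opposite to the deficit, as the gadget demands, and [k] then makes [s + k]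
   even, so that the plateau changes by an even number of vertices. *)
pose s := (2 * d + d.+1 * d + 2 + ~~ (odd (d.+1 * d) (+) odd (deficit d G)))%N.
have oddd : odd (d.+1 * d) = false by rewrite oddM /= od.
have os : odd s = ~~ odd (deficit d G).
  rewrite /s; move: oddd; move: (d.+1 * d)%N => A oA; rewrite !oddD oA. by rewrite od; case: (odd (deficit _ _)).
have sl : (2 * d + deficit d G + 2 <= s)%N.
  by rewrite /s; move: defl; clear; move: (~~ _); lia.
pose k := odd s.
pose j := (j' + s + J * d.+1 + k)%N.
have ssm : (s + k <= sm)%N.
  by rewrite /s /sm /k; case: (odd s); case: (~~ _); move: (d.+1 * d)%N; clear; lia.
have jjm : (j <= jm)%N.
  rewrite /j /jm; move: ssm; move: (J * d.+1)%N (k : nat); clear; lia.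
have ojj : odd j = odd j'.
  have oJ : odd (J * d.+1) = false by rewrite oddM /= od andbF.
  by rewrite /j /k; move: oJ; move: (J * d.+1)%N (s) (j'); clear => A s j' oA; rewrite !oddD oA addbF oddb -addbA addbb addbF.
have jn' : (j < n)%N by apply: leq_ltn_trans jjm jn.
pose e : R := E1%:R^-1.
have E10 : (0 : R) < E1%:R by rewrite ltr0n /E1 addn2.
have e0 : 0 < e by rewrite invr_gt0.
have mue : mu <= e by rewrite /e -[_^-1]mul1r ler_pdivlMr.
have FX : F <= e * X by rewrite /e mulrC ler_pdivlMr.
have le_e (m : nat) : (m <= E1)%N -> e * m%:R <= 1.
  by move=> mE; rewrite /e mulrC ler_pdivrMr // mul1r ler_nat.
have HH : (j.+1 ^ 2 <= H)%N by rewrite leq_exp2r.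
have H2e : e * (2 * (j ^ 2).+1)%N%:R <= 1.
  apply: le_e; have j1 : ((j ^ 2).+1 <= H)%N by apply: leq_trans HH; rewrite ltn_exp2r.
  rewrite /E1; move: j1; clear; move: (j ^ 2)%N (3 * H ^ 2 * (d * jm))%N (3 * jm * L)%N (4 * j' * H)%N; lia.
have farU v : (deg v < d)%N -> x v < X - mu * X * (j ^ 2)%:R.
  move=> vd; have xv := deficient_le_outflow (perron_pos P) (perron_deg P) (perron_eig P) vd.
  rewrite -/F in xv; rewrite natrM -[(_ ^ _).+1%:R]natr1 in H2e.
  have q0 : 0 <= (j ^ 2)%:R :> R by [].
  have m1 : mu * (j ^ 2)%:R <= e * (j ^ 2)%:R by rewrite ler_wpM2r.
  have e2 : (e + mu * (j ^ 2)%:R) * X < 1 * X by rewrite ltr_pM2r //; lra.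
  lra.
pose Y := F / d.-1%:R * L%:R; pose h := mu * X * (j.+1 ^ 2)%:R.
have ext := extend_bottom (perron_pos P) (perron_deg P) (perron_conn P) (perron_eig P) mu0
  (perron_max P) (perron_min P) (perron_card P) d3 od (perron_defect P) os sl (leqnn j')
  (erefl j) ojj jn' farU (erefl L%:R) (erefl Y) (erefl h).
have dD : d.-1%:R = D - 1 :> R by rewrite /D -[in RHS](@prednK d) -?natr1 ?addrK //; move: d3; clear; lia.
have jj' : (j' <= j)%N by rewrite /j; move: (J * d.+1)%N (k : nat) (s) (j'); clear; lia.
have Hj : (j.+1 ^ 2)%:R <= H%:R :> R by rewrite ler_nat.
have jdj : (j - j' <= jm)%N by apply: leq_trans jjm; exact: leq_subr.
have := @balance_num X mu F L%:R (j.+1 ^ 2)%:R (d * j)%:R j%:R j'%:R e Y h X0 mu0 F0 _ _ _ _ _ mue FX (ltW e0).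
rewrite -dD !ler0n ler_nat => /(_ isT isT isT isT jj') bal.
have {bal} := bal _ _ (erefl _) (erefl _) ext.
rewrite -natrB //.
have c1 : e * L%:R <= 1.
  apply: le_e; rewrite /E1.
  by move: (3 * H ^ 2 * (d * jm))%N (3 * jm * L)%N (4 * j' * H)%N (L) (2 * H)%N; clear; lia.
have c2 : e * (3 * (j.+1 ^ 2)%:R ^+ 2 * (d * j)%:R + 3 * (j - j')%:R * L%:R + 4 * j'%:R * (j.+1 ^ 2)%:R) <= 1.
  rewrite -natrX -!natrM -!natrD; apply: le_e; rewrite /E1.
  have b1 : (3 * (j.+1 ^ 2) ^ 2 * (d * j) <= 3 * H ^ 2 * (d * jm))%N by rewrite !leq_mul // leq_exp2r.
  have b2 : (3 * (j - j') * L <= 3 * jm * L)%N by rewrite !leq_mul.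
  have b3 : (4 * j' * j.+1 ^ 2 <= 4 * j' * H)%N by rewrite leq_mul.
  apply: leq_trans (leq_add (leq_add b1 b2) b3) _.
  by move: (3 * H ^ 2 * (d * jm) + 3 * jm * L + 4 * j' * H)%N (L) (2 * H)%N; clear; lia.
move=> /(_ c1 c2) fin.
have D1 : 0 < D - 1 by move: D3; lra.
have A0 : (0 : R) <= (J * d.+1)%:R by [].
have P0 : 0 <= F / d.-1%:R * F by rewrite dD mulr_ge0 ?divr_ge0 // ltW.
have Q0 : 0 <= mu * X ^+ 2 by rewrite mulr_ge0 ?sqr_ge0 // ltW.
have LA : (J * d.+1)%:R <= L%:R :> R by rewrite ler_nat leq_addl.
have jA : (j - j')%:R + 1 <= (J * d.+1)%:R + sm.+1%:R :> R.
  rewrite natr1 -natrD ler_nat /j; move: ssm; move: (J * d.+1)%N (k : nat); clear; lia.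
have AB : E%:R * sm.+1%:R <= (J * d.+1)%:R :> R.
  by rewrite -natrM ler_nat /J leq_pmulr.
have main : F / d.-1%:R * F * (J * d.+1)%:R <= mu * X ^+ 2 * ((J * d.+1)%:R + sm.+1%:R).
  apply: le_trans (ler_wpM2l P0 LA) _; apply: le_trans fin _; exact: ler_wpM2l.
have FE2 : F ^+ 2 = F / d.-1%:R * F * (D - 1) by rewrite dD mulrAC divfK ?gt_eqF.
have [E0|Ep] := posnP E.
  by rewrite E0 mul0r mulr_ge0 // mulr_ge0 ?addr_ge0 // ltW.
have Ep' : (0 : R) < E%:R by rewrite ltr0n.
have sm0 : (0 : R) < sm.+1%:R by [].
have Ap : (0 : R) < (J * d.+1)%:R by apply: lt_le_trans AB; rewrite mulr_gt0.
rewrite {}FE2; move: main P0 Q0 fin; move: (F / _ * F) (mu * X ^+ 2) => p q main P0 Q0 fin; rewrite dD.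
have -> : E%:R * (p * (D - 1)) = (D - 1) * (E%:R * p) by lra.
have -> : (E%:R + 1) * (D - 1) * q = (D - 1) * ((E%:R + 1) * q) by lra.
rewrite ler_pM2l // -(ler_pM2r Ap).
apply: le_trans (_ : E%:R * (q * ((J * d.+1)%:R + sm.+1%:R)) <= _).
  by rewrite -mulrA ler_pM2l.
have := ler_wpM2l Q0 AB; lra.
Qed.
End Quantitative.

Ltac quick_lra := first
  [ solve [repeat match goal with H : ?P |- _ => match type of P with Prop => clear H end end; lra]
  | lra ].

(** Returning [K] vertices is worth about [K * mu * X ^+ 2], while [W] is at most [1 + 1/E] times
    [(K - eps) * mu * X ^+ 2]. As [E * eps >= M + 2], the factor [1 + 1/E] cannot make up for the
    saving [eps], and the errors stay below [1/E]. *)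
Lemma cut_num (R : realFieldType) (X mu e H N j K M E eps w W0 u W h : R) :
  0 < X -> 0 < mu -> mu <= e -> 0 <= H -> 0 <= N -> 0 <= j -> eps <= K -> K <= M ->
  0 < eps -> 0 < E -> M + 2 <= E * eps -> 0 <= w -> X * (1 - w) <= u -> 0 <= u -> u <= 2 * X ->
  w <= e * W0 -> E * (e * (2 * M * W0 + 4 * (j + M) * H + 3 * H ^+ 2 * N)) <= 1 ->
  E * W <= (E + 1) * (K - eps) * (mu * X ^+ 2) ->
  h = mu * X * H ->
  mu * ((j + K) * (u - h) ^+ 2 - j * u ^+ 2) <= W + 3 * h ^+ 2 * N -> False.
Proof.
move=> X0 mu0 mue H0 N0 j0 eK KM eps0 E0 Ee w0 uw u0 u2 wW small WE hE.
have [y [uE y0 y2 yw]] : exists y, [/\ u = y * X, 0 <= y, y <= 2 & 1 - w <= y].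
  exists (u / X); split; first by rewrite divfK // gt_eqF.
  - by rewrite divr_ge0 // ltW.
  - by rewrite ler_pdivrMr.
  - by rewrite ler_pdivlMr // mulrC.
rewrite uE hE => main.
have Q0 : 0 < mu * X ^+ 2 by rewrite mulr_gt0 // exprn_gt0.
have m1 : E * ((j + K) * (y - mu * H) ^+ 2 - j * y ^+ 2 - 3 * mu * H ^+ 2 * N) <= (E + 1) * (K - eps).
  rewrite -(ler_pM2r Q0); apply: le_trans WE; rewrite -[leLHS]mulrA ler_pM2l //.
  apply: le_trans (_ : mu * ((j + K) * (y * X - mu * X * H) ^+ 2 - j * (y * X) ^+ 2) - 3 * (mu * X * H) ^+ 2 * N <= _).
    by rewrite le_eqVlt; apply/orP; left; apply/eqP; quick_lra.
  by rewrite lerBlDr.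
have K0 : 0 <= K by apply: le_trans eK; exact: ltW.
have e0 : 0 <= e by apply: le_trans mue; exact: ltW.
have muH : mu * H <= e * H by rewrite ler_wpM2r.
have muH0 : 0 <= mu * H by rewrite mulr_ge0 // ltW.
have y21 : 1 - 2 * w <= y ^+ 2 by nra.
have t1 : K * (1 - 2 * w) <= K * y ^+ 2 by rewrite ler_wpM2l.
have t2 : (j + K) * (y * (mu * H)) <= (j + M) * (2 * (e * H)).
  apply: ler_pM; rewrite ?addr_ge0 ?mulr_ge0 ?(ltW mu0) //; first quick_lra.
  by apply: ler_pM; rewrite ?mulr_ge0 ?(ltW mu0).
have t3 : K * w <= M * (e * W0) by apply: ler_pM.
have t4 : mu * (H ^+ 2 * N) <= e * (H ^+ 2 * N) by rewrite ler_wpM2r // mulr_ge0 ?sqr_ge0.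
have t5 : 0 <= (j + K) * (mu * H) ^+ 2 by rewrite mulr_ge0 ?sqr_ge0 ?addr_ge0.
have low : K - e * (2 * M * W0 + 4 * (j + M) * H + 3 * H ^+ 2 * N) <=
  (j + K) * (y - mu * H) ^+ 2 - j * y ^+ 2 - 3 * mu * H ^+ 2 * N by quick_lra.
have := ler_wpM2l (ltW E0) low; quick_lra.
Qed.

(** The margin 4 in [r <= M - 4] is spent on one vertex lost to parity, one for [u] being smaller
    than [X], and two for the factor [1 + 1/E], since [M <= 2 * E]. *)
Lemma far_num (R : realFieldType) (X mu M E w u W j r : R) :
  0 < X -> 0 < mu -> 0 < E -> 0 <= w -> X * (1 - w) <= u -> 0 <= u -> M - 1 <= j -> 1 <= M ->
  2 * w * M <= 1 -> r <= M - 4 -> M <= 2 * E ->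
  E * W <= (E + 1) * r * (mu * X ^+ 2) -> mu * (j * u ^+ 2) <= W -> False.
Proof.
move=> X0 mu0 E0 w0 uw u0 jM M1 wM rM ME WE main.
have Q0 : 0 < mu * X ^+ 2 by rewrite mulr_gt0 // exprn_gt0.
have [y [uE y0 yw]] : exists y, [/\ u = y * X, 0 <= y & 1 - w <= y].
  exists (u / X); split; first by rewrite divfK // gt_eqF.
  - by rewrite divr_ge0 // ltW.
  - by rewrite ler_pdivlMr // mulrC.
have y21 : 1 - 2 * w <= y ^+ 2 by nra.
have m1 : E * (j * y ^+ 2) <= (E + 1) * r.
  rewrite -(ler_pM2r Q0); apply: le_trans WE; rewrite -[leLHS]mulrA ler_pM2l //.
  apply: le_trans main; rewrite uE le_eqVlt; apply/orP; left; apply/eqP; quick_lra.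
have m2 : M - 2 <= j * y ^+ 2.
  apply: le_trans (_ : (M - 1) * y ^+ 2 <= _); last by rewrite ler_wpM2r ?sqr_ge0.
  by have := @ler_wpM2l _ (M - 1) _ _ _ y21; quick_lra.
have := ler_wpM2l (ltW E0) m2.
have := @ler_wpM2l _ (E + 1) _ _ _ rM; quick_lra.
Qed.

Section Bridges.
Variables (R : realFieldType) (d : nat).
Hypotheses (d3 : (3 <= d)%N) (od : odd d).
Let D : R := d%:R.

Let D3 : 3 <= D. Proof. by rewrite /D (ler_nat _ 3%N). Qed.

(** By [growth_bridge] the deletion of the [K] lowest vertices costs at most
    [F^2 (K - eps) / (d - 1)], which by [balance] is less than the worth of the vertices returned to
    the plateau. For odd [K] one deleted vertex comes back as a leaf, and both sides drop by one
    vertex. *)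
Lemma no_low_bridge (M : nat) : exists n3, forall n (G : graph) (x : G -> R) mu z K,
  (n3 <= n)%N -> perron d n x mu z -> (2 <= K <= M)%N ->
  cutsize d x K = 1%N -> (forall i, (i < K)%N -> (2 <= cutsize d x i)%N) -> False.
Proof.
(* [E * eps = M + 2] for [eps = 1 / (50 d)], as [cut_num] requires. [C] collects its error terms,
   and [j] is the least plateau size that [top_replace] can rebuild. *)
pose E := (50 * d * (M + 2))%N; pose j := (2 * d + d.+1 * d + 1)%N.
pose H := (j.+1 ^ 2)%N; pose N := (d * j)%N.
pose C := (2 * M * M + 4 * (j + M) * H + 3 * H ^ 2 * N)%N.
pose E1 := (E * C + (M + 1 + j ^ 2) + 1)%N.
have [n1 small] := small_data R d3 od E1.
have [n2 bal] := balance R d3 od E.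
exists (maxn (maxn n1 n2) (M + j).+1)%N => n G x mu z K.
rewrite !geq_max -andbA => /and3P[nn1 nn2 nMj] P /andP[K2 KM] cK ci.
have [muE FE] := small n G x mu z nn1 P.
have {bal} bal := bal n G x mu z nn2 P.
have mu0 := perron_mu P; have X0 := perron_pos P z; have F0 := outflow_gt0 P.
have cardG := perron_card P.
have Kn : (K < n)%N by move: KM nMj; clear; lia.
have KG : (K < #|G|)%N by rewrite cardG.
pose k := odd K; pose t := level x z K; pose T := ~: lower x K.
have [a aT degT] := bridge_vertex (perron_deg P) (perron_conn P) (ltnW K2) KG cK.
have t0 : 0 <= t := level_ge0 (perron_pos P) (perron_max P) K.
have tle : t <= outflow x mu * (K%:R - (50 * D)^-1) / (D - 1).
  have := growth_bridge d3 od (gap_ge0 (perron_pos P) (perron_max P) F0)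
    (fun k kn => cutsize_step x z (perron_deg P) (leq_trans kn (eq_leq (esym cardG))))
    (fun k _ => gap_flow1 (perron_pos P) (perron_deg P) (perron_eig P) mu0 (perron_max P) F0 k)
    (fun k _ => gap_flow2 (perron_pos P) (perron_deg P) (perron_eig P) mu0 (perron_max P) F0 k)
    (fun i j ij jn => cutsize_sep x (perron_deg P) ij (leq_trans jn (eq_leq (esym cardG))))
    K2 (ltnW Kn) cK ci.
  by rewrite run_gap ler_pdivrMr // -/t -/D [leRHS]mulrC mulrA.
pose S := mu * \sum_(v in T) (x v - t).
have tT v : v \in T -> t <= x v.
  by rewrite inE => /(level_upper z); apply: le_trans; exact: (level_le (perron_pos P) (perron_max P)).
have bT v w : v \in T -> w \notin T -> edge v w -> x w <= t.
  by move=> _; rewrite inE negbK => wK _; exact: (level_lower (perron_max P)).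
have S0 : 0 <= S.
  by rewrite mulr_ge0 ?(ltW mu0) // sumr_ge0 // => v /tT; rewrite subr_ge0.
have SF : S <= outflow x mu.
  apply: le_trans (sub_outflow (perron_pos P) mu0 T); rewrite ler_wpM2l ?(ltW mu0) //.
  by apply: ler_sum => v _; move: t0; quick_lra.
set F := outflow x mu in F0 FE bal tle SF; set X := x z in X0 FE bal.
pose e : R := E1%:R^-1; pose eps : R := (50 * D)^-1.
have E10 : (0 : R) < E1%:R by rewrite ltr0n /E1 addn1.
have e0 : 0 < e by rewrite invr_gt0.
have mue : mu <= e by rewrite /e -[_^-1]mul1r ler_pdivlMr.
have FX : F <= e * X by rewrite /e mulrC ler_pdivlMr.
have eps0 : 0 < eps by rewrite invr_gt0 mulr_gt0 //; move: D3; quick_lra.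
have eps1 : eps <= 1 by rewrite invf_le1 ?mulr_gt0 //; move: D3; quick_lra.
have D1 : 0 < D - 1 by move: D3; quick_lra.
have K2R : 2 <= K%:R :> R by rewrite (ler_nat _ 2).
have KMR : K%:R <= M%:R :> R by rewrite ler_nat.
have tFM : t <= F * M%:R.
  apply: le_trans tle _; rewrite ler_pdivrMr // -[leRHS]mulrA ler_pM2l //.
  by move: D3 (ler_wpM2l (ler0n R M) D3); rewrite -/eps; quick_lra.
have e1 : e * (M + 1 + j ^ 2)%N%:R < 1.
  rewrite /e mulrC ltr_pdivrMr // mul1r ltr_nat /E1; move: (E * C)%N (M + 1 + j ^ 2)%N; clear; lia.
have aF : x a <= t + F.
  have [ad|ad] := ltnP (deg a) d.
    by have := deficient_le_outflow (perron_pos P) (perron_deg P) (perron_eig P) ad; rewrite -/F; quick_lra.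
  have [w wT aw] : exists2 w, w \notin T & edge a w.
    have : (0 < \sum_(w in ~: T) edge a w)%N.
      have := degT a aT; rewrite eqxx -/T; have := split_deg T a; move: ad; clear.
      by move: (\sum_(w in T) _)%N (\sum_(w in ~: T) _)%N => s1 s2; lia.
    rewrite lt0n sum_nat_eq0 negb_forall => /existsP[w].
    by rewrite negb_imply inE eqb0 negbK => /andP[]; exists w.
  have := flow_edge (perron_pos P) (perron_deg P) (perron_eig P) aT wT aw.
  move=> /(_ (fun u v uT vT uv => le_trans (bT u v uT vT uv) (tT u uT))).
  have := sub_outflow (perron_pos P) mu0 T; have := bT a w aT wT aw; rewrite -/F; quick_lra.
have farT v : (v \notin T) || (v == a) -> x v < X - mu * X * (j ^ 2)%:R.
  move=> vT; have xv : x v <= t + F.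
    case/orP: vT => [|/eqP -> //]; rewrite inE negbK => /(level_lower (perron_max P)); rewrite -/t.
    by move: F0; quick_lra.
  rewrite natrD natrD in e1.
  have j0 : 0 <= (j ^ 2)%:R :> R by [].
  have m1 : mu * (j ^ 2)%:R <= e * (j ^ 2)%:R by rewrite ler_wpM2r.
  have m2 : (e * (M%:R + 1) + mu * (j ^ 2)%:R) * X < 1 * X by rewrite ltr_pM2r //; move: m1 e1; quick_lra.
  have m3 : F * (M%:R + 1) <= e * X * (M%:R + 1) by rewrite ler_wpM2r // addr_ge0.
  move: m2 m3 tFM xv; quick_lra.
(* The minimizer of [(D - 1) * c ^+ 2 - 2 * c * S]; the leaf then saves [S ^+ 2 / (D - 1)]. *)
pose c := if k then S / (D - 1) else 0.
have c0 : 0 <= c by rewrite /c; case: (k) => //; rewrite divr_ge0 // ltW.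
have kc : ~~ k -> c = 0 by rewrite /c; case: (k).
have kK : (k <= K)%N by rewrite /k; case: (odd K) => //; exact: ltnW.
pose j' := (j + (K - k))%N.
have cT : #|T| = (n - K)%N by rewrite cardsCs setCK card_lower ?cardG // ltnW.
have cn : (#|T| + k + j' = n + j)%N.
  by rewrite cT /j'; move: Kn kK; move: (k : nat) (j); clear; lia.
have ojj : odd j = odd j'.
  by rewrite /j'; move: kK; move: (j) => j0 kK; rewrite oddD oddB // oddb addbb addbF.
have jn : (j < n)%N by move: nMj; clear; lia.
have j0 : (0 < j)%N by rewrite /j addn1.
have main := cut_at_bridge (perron_pos P) (perron_deg P) (perron_conn P) (perron_eig P) mu0
  (perron_max P) (perron_min P) cardG d3 od t0 tT bT aT degT farT cn
  j0 jn ojj (leq_addr _ _) c0 kc (erefl _).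
set h := mu * x z * _ in main.
pose r : R := (K - k)%:R - eps.
pose W := t * S + (D - 1) * c ^+ 2 - 2 * c * S.
have KkM : (K - k)%:R <= M%:R :> R by rewrite ler_nat (leq_trans (leq_subr _ _)).
have epsK : eps <= (K - k)%:R.
  apply: le_trans eps1 _; rewrite (ler_nat _ 1) subn_gt0 /k; case: (odd K) => //.
  exact: ltnW.
have Q0 : 0 < mu * X ^+ 2 by rewrite mulr_gt0 // exprn_gt0.
have Wle : W <= F ^+ 2 * (r / (D - 1)).
  rewrite mulrA ler_pdivlMr //.
  have tD : t * (D - 1) <= F * (K%:R - eps) by rewrite -ler_pdivlMr.
  have tS : S * (t * (D - 1)) <= S * (F * (K%:R - eps)) by rewrite ler_wpM2l.
  have kap : 0 <= K%:R - eps by move: K2R eps1; quick_lra.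
  rewrite /W /c /r natrB // /k; case oK: (odd K); last first.
    have : S * (F * (K%:R - eps)) <= F * (F * (K%:R - eps)).
      by rewrite ler_wpM2r // mulr_ge0 // ltW.
    by move: tS; rewrite subr0; quick_lra.
  have -> : (t * S + (D - 1) * (S / (D - 1)) ^+ 2 - 2 * (S / (D - 1)) * S) * (D - 1) =
     S * (t * (D - 1)) - S ^+ 2.
    by have := divfK (lt0r_neq0 D1) S; move: (S / (D - 1)) => q <-; quick_lra.
  (* For [K >= 3] the expression [S * (F * (K - eps) - S)] is largest on [0 <= S <= F] at [S = F],
     where it equals [F ^+ 2 * (K - eps - 1)]. *)
  have K3 : 3 <= K%:R :> R by rewrite (ler_nat _ 3); move: K2 oK; clear; lia.
  have FS : 0 <= F - S by rewrite subr_ge0.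
  have q1 : S <= F * (K%:R - eps - 1).
    by apply: le_trans SF _; rewrite ler_peMr ?(ltW F0) //; move: K3; quick_lra.
  have := @mulr_ge0 _ (F - S) (F * (K%:R - eps - 1) - S) FS; rewrite subr_ge0 => /(_ q1).
  by rewrite (_ : (nat_of_bool true)%:R = 1 :> R) //; move: tS; quick_lra.
have EW : E%:R * W <= (E%:R + 1) * r * (mu * X ^+ 2).
  apply: le_trans (ler_wpM2l (ler0n R E) Wle) _; rewrite [leLHS]mulrA.
  have r0 : 0 <= r / (D - 1) by rewrite divr_ge0 ?(ltW D1) // /r subr_ge0.
  apply: le_trans (ler_wpM2r r0 bal) _; rewrite le_eqVlt; apply/orP; left; apply/eqP.
  by have := mulKf (lt0r_neq0 D1) ((E%:R + 1) * r * (mu * X ^+ 2)); quick_lra.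
have Ep : (0 : R) < E%:R by rewrite ltr0n /E !muln_gt0 addn_gt0 orbT /= andbT; move: d3; clear; lia.
have Eeps : M%:R + 2 <= E%:R * eps.
  rewrite /E natrM natrD natrM -/D /eps le_eqVlt; apply/orP; left; apply/eqP.
  have D50 : 50 * D != 0 by rewrite gt_eqF //; move: D3; quick_lra.
  by have := mulKf D50 (M%:R + 2); quick_lra.
have cF : c <= F.
  rewrite /c; case: (k) => //; last exact: ltW.
  by rewrite ler_pdivrMr //; apply: le_trans SF _; rewrite ler_peMr ?(ltW F0) //; move: D3; quick_lra.
have FX1 : F <= X.
  apply: le_trans FX _; rewrite ler_piMl ?(ltW X0) // /e invf_le1 // (ler_nat _ 1) /E1 addn1 //.
have w1 : t / X <= e * M%:R.
  rewrite ler_pdivrMr // mulrAC; apply: le_trans tFM _; exact: ler_wpM2r.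
have tX : t <= X.
  by have := tT a aT; have := perron_max P a; rewrite -/X; quick_lra.
apply: (@cut_num R X mu e H%:R N%:R j%:R (K - k)%:R M%:R E%:R eps (t / X) M%:R (X - t + c) W h) => //.
- by rewrite divr_ge0 // ltW.
- by rewrite mulrBr mulr1 mulrC divfK ?gt_eqF //; move: c0; quick_lra.
- by move: tX c0; quick_lra.
- by move: t0 FX1 cF; quick_lra.
- rewrite -natrX -!natrM -!natrD -!natrM -!natrD.
  rewrite mulrCA -natrM /e mulrC ler_pdivrMr // mul1r ler_nat.
  apply: (@leq_trans (E * C)%N); first by rewrite /C.
  by rewrite /E1; move: (E * C)%N (M + 1 + j ^ 2)%N; clear; lia.
- move: main; rewrite -natrD -/j' -/X -/S /W /N -/D natrM; quick_lra.
Qed.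
(** Over [M] levels without a bridge [growth_linear] saves the rise of at least 4 vertices, enough
    to pay for the crude exchange in [cut_far]. *)
Lemma bridge_exists : exists M n4, forall n (G : graph) (x : G -> R) mu z,
  (n4 <= n)%N -> perron d n x mu z -> ~ (forall i, (i <= M)%N -> (2 <= cutsize d x i)%N).
Proof.
(* The first summand makes [M * eps / (d + 2)] at least [d * d.+2 + 4], the constant of
   [growth_linear] plus the margin of [far_num]. The rest leaves room for a gadget of at least
   [2 * d + 3] vertices. *)
pose M := (50 * d * d.+2 * (d * d.+2 + 4) + 2 * d + 4)%N.
pose E1 := (2 * M * M + M + 2)%N.
have [n1 small] := small_data R d3 od E1.
have [n2 bal] := balance R d3 od M.
exists (M + d)%N, (maxn (maxn n1 n2) (M + d).+1)%N => n G x mu z.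
rewrite !geq_max -andbA => /and3P[nn1 nn2 nMd] P ci.
have [muE FE] := small n G x mu z nn1 P.
have {bal} bal := bal n G x mu z nn2 P.
have mu0 := perron_mu P; have X0 := perron_pos P z; have F0 := outflow_gt0 P.
have cardG := perron_card P.
pose t := level x z M.
have t0 : 0 <= t := level_ge0 (perron_pos P) (perron_max P) M.
set F := outflow x mu in F0 FE bal; set X := x z in X0 FE bal.
have D1 : 0 < D - 1 by move: D3; quick_lra.
have tle : t <= F * (M%:R - 4) / (D - 1).
  have := growth_linear d3 od (gap_ge0 (perron_pos P) (perron_max P) F0)
    (fun k kn => cutsize_step x z (perron_deg P) (leq_trans kn (eq_leq (esym cardG))))
    (fun k _ => gap_flow1 (perron_pos P) (perron_deg P) (perron_eig P) mu0 (perron_max P) F0 k)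
    (fun k _ => gap_flow2 (perron_pos P) (perron_deg P) (perron_eig P) mu0 (perron_max P) F0 k)
    (fun i j ij jn => cutsize_sep x (perron_deg P) ij (leq_trans jn (eq_leq (esym cardG))))
    nMd ci.
  rewrite run_gap ler_pdivrMr // -/t -/D mulrC => /le_trans; apply.
  rewrite -mulrA ler_pM2l // ler_pM2r ?invr_gt0 //.
  have dd0 : (0 : R) < 50 * D * d.+2%:R by rewrite !mulr_gt0 //; move: D3; quick_lra.
  have : (d * d.+2 + 4)%:R <= M%:R * ((50 * D)^-1 / d.+2%:R) :> R.
    rewrite -invfM ler_pdivlMr ?(mulrC d.+2%:R) // /D -!natrM ler_nat /M.
    by rewrite mulnC -!addnA leq_addr.
  rewrite mulrBr mulr1.
  move: (M%:R * _) => Mq; rewrite natrD; quick_lra.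
pose e : R := E1%:R^-1.
have E10 : (0 : R) < E1%:R by rewrite ltr0n /E1 addn2.
have e0 : 0 < e by rewrite invr_gt0.
have mue : mu <= e by rewrite /e -[_^-1]mul1r ler_pdivlMr.
have FX : F <= e * X by rewrite /e mulrC ler_pdivlMr.
have M8 : 8 <= M%:R :> R by rewrite (ler_nat _ 8) /M; move: d3; clear; move: (50 * d * d.+2 * _)%N; lia.
have le_e (m : nat) : (m <= E1)%N -> e * m%:R <= 1.
  by move=> mE; rewrite /e mulrC ler_pdivrMr // mul1r ler_nat.
have e1 : e * (2 * M * M)%N%:R <= 1 by apply: le_e; rewrite /E1 -addnA leq_addr.
have e2 : e * (M + 2)%N%:R <= 1 by apply: le_e; rewrite /E1 -addnA leq_addl.
have tFM : t <= F * M%:R.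
  apply: le_trans tle _; rewrite ler_pdivrMr // -[leRHS]mulrA ler_pM2l //.
  by move: D3 (ler_wpM2l (ler0n R M) D3); move: M8; quick_lra.
have tX : t + mu * X < X.
  have m1 : mu * X <= e * X by rewrite ler_pM2r.
  have m2 : F * M%:R <= e * X * M%:R by rewrite ler_wpM2r.
  have m3 : e * (M + 2)%:R * X <= 1 * X by rewrite ler_pM2r.
  have m4 : 0 < e * X by rewrite mulr_gt0.
  by move: tFM m1 m2 m3 m4; rewrite natrD; quick_lra.
pose A := lower x M.
(* The vertices above level [M] need not induce a connected graph, so only the component of [z] is
   kept. All deleted vertices return in the gadget, up to parity. *)
pose T : {set G} := [set v | connect [rel u w | edge u w && (w \notin A)] z v].
have mux0 : 0 < mu * X by rewrite mulr_gt0.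
have zA : z \notin A.
  by apply/negP => /(level_lower (perron_max P)); rewrite -/t -/X; move: tX mux0; quick_lra.
have TA v : v \in T -> v \notin A.
  rewrite inE => /connectP[p]; case/lastP: p => [_ -> //|p w].
  by rewrite rcons_path last_rcons => /andP[_ /andP[_ wA]] ->.
have [q zq qA] : exists2 q, edge z q & q \notin A.
  apply/exists_inP; apply: contraT; rewrite negb_exists => /forallP zn.
  have nt w : (edge z w)%:R * x w <= (edge z w)%:R * t.
    have := zn w; rewrite negb_and; case: (edge z w) => /=; last by rewrite !mul0r.
    by rewrite negbK !mul1r => /(level_lower (perron_max P)).
  have := perron_eig P z; rewrite -/D -/X.
  have : \sum_w (edge z w)%:R * x w <= D * t.
    apply: le_trans (ler_sum _ (fun w _ => nt w)) _.
    rewrite -mulr_suml -natr_sum ler_wpM2r // ler_nat; exact: perron_deg P z.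
  have : (X - t) * 1 <= (X - t) * D.
    by rewrite ler_wpM2l //; [move: tX mux0; quick_lra | move: D3; quick_lra].
  by move: tX; quick_lra.
have zT : z \in T by rewrite inE connect0.
have qT : q \in T by rewrite inE; apply: connect1; rewrite /= zq.
have bT v w : v \in T -> w \notin T -> edge v w -> x w <= t.
  move=> vT wT vw; apply: (level_lower (perron_max P)); apply: contraR wT => wA.
  by rewrite inE; apply: connect_trans (_ : connect _ v w); [rewrite inE in vT | apply: connect1; rewrite /= vw].
have tT v : v \in T -> t <= x v.
  move=> /TA /(level_upper z); apply: le_trans; exact: (level_le (perron_pos P) (perron_max P)).
have MG : (M < #|G|)%N by rewrite cardG; move: nMd; clear; lia.
have AT : A \subset ~: T by apply/subsetP => v vA; rewrite inE; apply: contraL vA; exact: TA.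
have mM : (M <= #|~: T|)%N by rewrite -(card_lower x (ltnW MG)) subset_leq_card.
have cT : conn (induced T).
  apply: (conn_induced zT) => S ST /set0Pn[s sS] zS.
  have : s \in T by apply: (subsetP ST).
  rewrite inE => /connectP[p pp sE]; move: sS; rewrite sE.
  have : z \in T :\: S by rewrite inE zS.
  elim: p (z) pp {sE} => [|b p IH] a /=; first by rewrite inE => _ /andP[/negP].
  case/andP=> /andP[ab bA] pp aT lS; have [bS|bS] := boolP (b \in S).
    by exists b, a; rewrite edge_sym.
  apply: (IH b pp _ lS); move: aT; rewrite !inE bS => /andP[_ za] /=.
  by apply: connect_trans za _; apply: connect1; rewrite /= ab.
pose m := #|~: T|; pose k := odd m; pose j := (m - k)%N.
have km : (k <= m)%N by rewrite /k; case: (m) => // m'; exact: leq_trans (leq_b1 _) _.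
have T0 : ~: T != set0 by rewrite -card_gt0; apply: leq_trans mM; rewrite /M addn4.
have cn : (#|T| + k + j = n)%N.
  by rewrite -addnA /j subnKC // /m cardsC cardG.
have oj : ~~ odd j by rewrite /j oddB // oddb addbb.
have jl : (2 * d + 3 <= j)%N.
  rewrite /j /k; move: mM; rewrite -/m /M; case: (odd m) => /=; move: (m) (50 * d * d.+2 * _)%N; clear; lia.
have main := cut_far (perron_deg P) (perron_conn P) (perron_eig P) (perron_min P) d3 od
  t0 tT bT cT T0 zT qT zq cn oj jl.
have jM : M%:R - 1 <= j%:R :> R.
  rewrite lerBlDr natr1 ler_nat /j /k; move: mM; rewrite -/m; case: (odd m) => /=; clear; lia.
apply: (@far_num R X mu M%:R M%:R (t / X) (X - t) (t * F) j%:R (M%:R - 4)) => //.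
- by move: M8; quick_lra.
- by rewrite divr_ge0 // ltW.
- by rewrite mulrBr mulr1 mulrC divfK ?gt_eqF.
- by move: tX mux0; quick_lra.
- by move: M8; quick_lra.
- apply: le_trans e1; rewrite !natrM.
  have : t / X <= e * M%:R.
    rewrite ler_pdivrMr // mulrAC; apply: le_trans tFM _; exact: ler_wpM2r.
  by move=> /(ler_wpM2r (ler0n R M)); quick_lra.
- by move: M8; quick_lra.
- have r0 : 0 <= (M%:R - 4) / (D - 1) by rewrite divr_ge0 ?(ltW D1) //; move: M8; quick_lra.
  have t1 : t * F <= F ^+ 2 * ((M%:R - 4) / (D - 1)).
    have := ler_wpM2r (ltW F0) tle; quick_lra.
  apply: le_trans (ler_wpM2l (ler0n R M) t1) _; rewrite [leLHS]mulrA.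
  apply: le_trans (ler_wpM2r r0 bal) _; rewrite le_eqVlt; apply/orP; left; apply/eqP.
  by have := mulKf (lt0r_neq0 D1) ((M%:R + 1) * (M%:R - 4) * (mu * X ^+ 2)); quick_lra.
- apply: le_trans main _; rewrite ler_wpM2l //.
  apply: le_trans (sub_outflow (perron_pos P) mu0 T); rewrite ler_wpM2l ?(ltW mu0) //.
  by apply: ler_sum => v _; move: t0; quick_lra.
Qed.
End Bridges.

Lemma deficient_vertex (R : realFieldType) (d : nat) : (3 <= d)%N -> odd d ->
  exists n0, forall n (G : graph) (x : G -> R) mu z, (n0 <= n)%N -> perron d n x mu z ->
  exists v0 : G, deg v0 = (if odd n then d.-1 else 1%N) /\ forall v, v != v0 -> deg v = d.
Proof.
move=> d3 od; have [M [n4 hM]] := bridge_exists R d3 od.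
have [n3 hK] := no_low_bridge R d3 od M.
exists (maxn (maxn n3 n4) (M + 2))%N => n G x mu z.
rewrite !geq_max -andbA => /and3P[nn3 nn4 nM] P.
have cardG := perron_card P; have dG := perron_deg P; have cG := perron_conn P.
have oD := odd_deficit dG cardG od.
have [i0 iM ci] : exists2 i, (i <= M)%N & (cutsize d x i < 2)%N.
  have [/existsP[i ci]|] := boolP [exists i : 'I_M.+1, (cutsize d x i < 2)%N].
    by exists (i : nat); rewrite ?ltnS // -ltnS.
  rewrite negb_exists => /forallP H; case: (hM n G x mu z nn4 P) => i iM.
  by have := H (Ordinal (iM : (i < M.+1)%N)); rewrite -leqNgt.
case: (@ex_minnP (fun i => (cutsize d x i < 2)%N)); first by exists i0.
move=> K cK minK; have KM : (K <= M)%N by apply: leq_trans iM; exact: minK.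
have KG : (K < #|G|)%N by rewrite cardG; move: KM nM; clear; lia.
have dsub (v : G) : deg v = (d - (d - deg v))%N by rewrite subKn.
have [K0|Kp] := posnP K.
  have def1 : deficit d G = 1%N.
    by have := perron_defect P; move: cK; rewrite K0 cutsize0; clear; case: deficit => [|[]].
  have /eqP/sum_nat_eq1[v0 [_ v1 vr]] := def1.
  exists v0; rewrite -oD def1 /= dsub v1 subn1; split=> // v vv0.
  by rewrite dsub (vr v vv0) // subn0.
have cK1 : cutsize d x K = 1%N.
  by have := cutsize_gt0 d x cG Kp KG; move: cK; clear; case: cutsize => [|[]].
have [K2|K1] := ltnP 1 K.
  case: (hK n G x mu z K nn3 P _ cK1); first by rewrite K2.
  by move=> i iK; rewrite leqNgt; apply/negP => /minK; rewrite leqNgt iK.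
have {K1} K1 : K = 1%N by apply/eqP; rewrite eqn_leq K1.
have [v0 low] : exists v0, lower x 1 = [set v0].
  by apply/cards1P; rewrite card_lower // -K1 ltnW.
have deg0 : (0 < deg v0)%N.
  have [u [v [uS _ uv]]] : exists u v, [/\ u \in [set v0], v \notin [set v0] & edge u v].
    apply: (conn_crossing cG); apply/set0Pn; first by exists v0; rewrite inE.
    have /subsetPn[v _ v0v] : ~~ (G \subset [set v0]).
      by apply/negP => /subset_leq_card; rewrite cards1 cardG; move: nM; clear; lia.
    by exists v; rewrite inE.
  move: uS; rewrite inE => /eqP uE; rewrite /deg (bigD1 v) //= -uE uv //.
(* For [K = 1] the cut consists of the edges at [v0] and the missing degrees of all others, so
   connectivity makes [v0] a leaf and all others full. *)
have c1 : (\sum_(v in ~: [set v0]) (d - deg v) + deg v0 = 1)%N.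
  rewrite -[RHS]cK1 K1 /cutsize /cut low big_split /=; congr (_ + _)%N.
  rewrite /deg (bigD1 v0) //= edge_irr add0n.
  apply: eq_big => [v|v _]; first by rewrite !inE.
  by rewrite big_set1 edge_sym.
have deg1 : deg v0 = 1%N by move: c1 deg0; clear; lia.
have v0d (v : G) : v != v0 -> deg v = d.
  move=> vv0; have /eqP := c1; rewrite deg1 -[X in _ == X]add0n eqn_add2r sum_nat_eq0.
  by move=> /forallP/(_ v); rewrite !inE vv0 => /eqP dv; rewrite dsub dv subn0.
exists v0; split=> //; rewrite -oD deg1.
(* This deficit is even since [d] is odd, so [odd_deficit] makes [n] even; in the case [K = 0] the
   deficit is 1 and [n] is odd. *)
have -> : deficit d G = d.-1.
  rewrite /deficit (bigD1 v0) //= deg1 subn1 big1 ?addn0 // => v /v0d ->; exact: subnn.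
by move: od; case: (d) => //= d' /negbTE ->.
Qed.

(** * Perron vectors and the spectral radius *)

From mathcomp Require Import topology normedtype derive.
Import numFieldNormedType.Exports.

Section QuadraticForm.
Local Open Scope classical_set_scope.

Lemma continuous_sum (R : realType) (T : topologicalType) (I : Type) (r : seq I) (f : I -> T -> R) :
  (forall i, continuous (f i)) -> continuous (fun t => \sum_(i <- r) f i t).
Proof.
by move=> cf; apply: continuous_big => //; exact: add_continuous.
Qed.

Lemma continuous_mul (R : realType) (T : topologicalType) (f g : T -> R) :
  continuous f -> continuous g -> continuous (fun t => f t * g t).
Proof. by move=> cf cg t; exact: cvgM (cf t) (cg t). Qed.

Definition quad (R : realFieldType) (I : finType) (A : I -> I -> R) (u : I -> R) : R :=
  \sum_i \sum_j A i j * (u i * u j).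

(** The unit sphere is compact, so the form attains its maximum there; scaling gives the bound for
    all vectors. *)
Lemma quad_max_rV (R : realType) (n : nat) (A : 'I_n.+1 -> 'I_n.+1 -> R) :
  exists y : 'I_n.+1 -> R, \sum_i y i ^+ 2 = 1 /\
    forall u, quad A u <= quad A y * \sum_i u i ^+ 2.
Proof.
pose sq (v : 'rV[R]_n.+1) := \sum_i v ord0 i ^+ 2.
have csq : continuous sq.
  apply: (continuous_sum (f := fun i (v : 'rV[R]_n.+1) => v ord0 i ^+ 2)) => i.
  by apply: continuous_mul; exact: coord_continuous.
have cq : continuous (fun v : 'rV[R]_n.+1 => quad A (v ord0)).
  apply: (continuous_sum (f := fun i (v : 'rV[R]_n.+1) => \sum_j A i j * (v ord0 i * v ord0 j))) => i.
  apply: (continuous_sum (f := fun j (v : 'rV[R]_n.+1) => A i j * (v ord0 i * v ord0 j))) => j.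
  apply: continuous_mul; first exact: cst_continuous.
  by apply: continuous_mul; exact: coord_continuous.
pose S : set 'rV[R]_n.+1 := sq @^-1` [set 1].
have S0 : S !=set0.
  exists (delta_mx ord0 ord0); rewrite /S /sq /= (bigD1 ord0) //= mxE !eqxx expr1n big1 ?addr0 // => i i0.
  by rewrite mxE (negbTE i0) expr0n.
have cS : closed S by apply: preimage_closed => //; exact: closed1.
have bS : bounded_set S.
  exists 1; split=> // M M1 v; rewrite /S /sq /= => v1.
  rewrite (_ : `|v| = mx_norm v) // mx_normrE; apply/bigmax_leP; split=> [|[i j] _ /=].
    by apply: ltW; apply: lt_trans M1.
  apply: le_trans (ltW M1); rewrite -(ler_pXn2r (n := 2%N)) ?nnegrE // expr1n -v1 (bigD1 j) //=.
  by rewrite ord1 real_normK ?num_real // lerDl sumr_ge0 // => k _; exact: sqr_ge0.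
have [|c cS' cmax] := @EVT_max_rV R _ (fun v : 'rV[R]_n.+1 => quad A (v ord0)) S S0 (bounded_closed_compact bS cS).
  exact: continuous_subspaceT.
exists (c ord0); split; first exact: (set_mem cS').
move=> u; have [u0|u0] := eqVneq (\sum_i u i ^+ 2) 0.
  have uz i : u i = 0.
    apply/eqP; rewrite -sqrf_eq0; apply/eqP; move: i (erefl true).
    by apply/psumr_eq0P => // i _; exact: sqr_ge0.
  by rewrite u0 mulr0 /quad big1 // => i _; rewrite big1 // => j _; rewrite uz mul0r mulr0.
have sp : 0 < \sum_i u i ^+ 2.
  by rewrite lt_neqAle eq_sym u0 sumr_ge0 // => i _; exact: sqr_ge0.
pose s := Num.sqrt (\sum_i u i ^+ 2).
have s2 : s ^+ 2 = \sum_i u i ^+ 2 by rewrite sqr_sqrtr // ltW.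
have s0 : s != 0 by rewrite gt_eqF // sqrtr_gt0.
have := fun t tS => cmax t (mem_set (A := S) tS); move=> /(_ (\row_i (u i / s))).
have -> : quad A ((\row_i (u i / s)) ord0) = quad A u / s ^+ 2.
  rewrite /quad mulr_suml; apply: eq_bigr => i _; rewrite mulr_suml; apply: eq_bigr => j _.
  by rewrite !mxE expr2 invfM; lra.
rewrite -s2 ler_pdivrMr ?exprn_gt0 ?sqrtr_gt0 //; apply.
rewrite /S /sq /= -[RHS](divff (expf_neq0 2 s0)) {1}s2 mulr_suml.
by apply: eq_bigr => i _; rewrite mxE expr_div_n.
Qed.

End QuadraticForm.

(** First variation: moving [y] in coordinate [i] cannot push the Rayleigh quotient above its
    maximum [l]. *)
Lemma quad_eig (R : realFieldType) (I : finType) (A : I -> I -> R) (l : R) (y : I -> R) :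
  (forall i j, A i j = A j i) -> (forall u, quad A u <= l * \sum_i u i ^+ 2) ->
  quad A y = l * \sum_i y i ^+ 2 -> forall i, \sum_j A i j * y j = l * y i.
Proof.
move=> sA qA qy i; pose dl (k : I) : R := (k == i)%:R.
have sdl (F : I -> R) : \sum_k dl k * F k = F i.
  rewrite (bigD1 i) //= /dl eqxx mul1r big1 ?addr0 // => k /negbTE ->; exact: mul0r.
pose r := \sum_j A i j * y j.
have qE t : quad A (fun k => y k + t * dl k) = quad A y + 2 * t * r + t ^+ 2 * A i i.
  transitivity (\sum_a (\sum_b A a b * (y a * y b) + (dl a * (t * \sum_b A a b * y b) +
      (t * \sum_b dl b * (A a b * y a) + dl a * (t ^+ 2 * \sum_b dl b * A a b))))).
    apply: eq_bigr => a _; rewrite !mulr_sumr -!big_split /=; apply: eq_bigr => b _; lra.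
  rewrite !big_split /= !sdl -/r.
  have -> : \sum_a t * (\sum_b dl b * (A a b * y a)) = t * r.
    by rewrite -mulr_sumr; congr (_ * _); apply: eq_bigr => a _; rewrite sdl sA.
  by rewrite /quad; lra.
have sE t : \sum_k (y k + t * dl k) ^+ 2 = \sum_k y k ^+ 2 + 2 * t * y i + t ^+ 2.
  transitivity (\sum_k (y k ^+ 2 + dl k * (2 * t * y k + t ^+ 2 * dl k))).
    by apply: eq_bigr => k _; lra.
  by rewrite big_split /= sdl (_ : dl i = 1) ?/dl ?eqxx //; lra.
have main t : 0 <= 2 * t * (l * y i - r) + t ^+ 2 * (l - A i i).
  by have := qA (fun k => y k + t * dl k); rewrite qE sE qy; lra.
have c0 : 0 <= l - A i i by have := main 1; have := main (-1); lra.
pose b := l * y i - r; pose c := l - A i i; apply/esym/eqP; rewrite -subr_eq0 -/r -/b.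
apply: contraT => b0; have b2 : 0 < b ^+ 2 by rewrite exprn_even_gt0.
have c1 : 0 < c + 1 by rewrite /c; lra.
(* [c + 1] replaces the optimal denominator [c], which may be 0; the value is still negative unless
   [b = 0]. *)
have := main (- b / (c + 1)); rewrite -/b -/c.
have -> : 2 * (- b / (c + 1)) * b + (- b / (c + 1)) ^+ 2 * c = - (b ^+ 2 * (c + 2)) / (c + 1) ^+ 2.
  rewrite -exprVn; have := mulKf (lt0r_neq0 c1) (b ^+ 2 * (c + 1)^-1); lra.
rewrite ler_pdivlMr ?exprn_gt0 // mul0r oppr_ge0 leNgt mulr_gt0 //.
by rewrite /c; lra.
Qed.

Lemma quad_abs (R : realFieldType) (I : finType) (A : I -> I -> R) (y : I -> R) :
  (forall i j, 0 <= A i j) -> quad A y <= quad A (fun i => `|y i|).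
Proof.
move=> A0; apply: ler_sum => i _; apply: ler_sum => j _.
by rewrite ler_wpM2l // -normrM ler_norm.
Qed.

(** Taking absolute values does not decrease the form, so the result is again a maximizer and hence
    an eigenvector. A zero entry would spread along edges to the whole connected graph. *)
Lemma perron_vector (R : realFieldType) (I : finType) (e : rel I) (l : R) (y : I -> R) :
  symmetric e -> (forall u v, connect e u v) -> \sum_i y i ^+ 2 = 1 ->
  quad (fun i j => (e i j)%:R) y = l ->
  (forall u, quad (fun i j => (e i j)%:R) u <= l * \sum_i u i ^+ 2) ->
  exists x : I -> R, (forall i, 0 < x i) /\ forall i, \sum_j (e i j)%:R * x j = l * x i.
Proof.
move=> se ce y1 qy qe; pose x i := `|y i|.
have x1 : \sum_i x i ^+ 2 = 1.
  by rewrite -y1; apply: eq_bigr => i _; rewrite /x real_normK // num_real.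
have xe : forall i, \sum_j (e i j)%:R * x j = l * x i.
  apply: quad_eig => // [i j|]; first by rewrite se.
  apply/le_anti/andP; split; first exact: qe.
  by rewrite x1 mulr1 -qy; apply: quad_abs.
exists x; split=> // i; rewrite lt_neqAle normr_ge0 andbT eq_sym.
apply/negP => /eqP xi.
have step a b : e a b -> x a = 0 -> x b = 0.
  move=> ab xa; have := xe a; rewrite xa mulr0 => /psumr_eq0P s0.
  by have := s0 (fun k _ => mulr_ge0 (ler0n _ _) (normr_ge0 _)) b isT; rewrite ab mul1r.
have all0 j : x j = 0.
  have /connectP[p pp ->] := ce i j.
  elim: p i xi pp => [|b p IH] a xa //= /andP[ab pp]; exact: IH (step a b ab xa) pp.
move: x1; rewrite big1 => [/esym/eqP|k _]; last by rewrite all0 expr0n.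
by rewrite oner_eq0.
Qed.

Lemma largest_eq (R : realType) (A : set R) (a : R) : A a -> ubound A a -> largest A = a.
Proof.
move=> Aa ua; apply: xget_unique => // b [Ab ub].
by apply/le_anti; rewrite ua //= ub.
Qed.

Definition adjacency (R : realType) (n : nat) (G : sgraph n) (i j : 'I_n) : R := (G i j)%:R.

Lemma lambda1_quad (R : realType) (n : nat) (G : sgraph n.+1) :
  (forall u, quad (adjacency R G) u <= lambda1 R G * \sum_i u i ^+ 2) /\
  exists2 y, \sum_i y i ^+ 2 = 1 & quad (adjacency R G) y = lambda1 R G.
Proof.
have [y [y1 ymax]] := quad_max_rV (adjacency R G).
have yeig : forall i, \sum_j adjacency R G i j * y j = quad (adjacency R G) y * y i.
  apply: quad_eig => //; last by rewrite y1 mulr1.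
  by move=> i j; rewrite /adjacency adj_sym.
have -> : lambda1 R G = quad (adjacency R G) y; last by split; last exists y.
apply: largest_eq => [|a] /=.
  apply/eigenvalueP; exists (\row_i y i).
    apply/rowP => i; rewrite !mxE -yeig; apply: eq_bigr => j _.
    by rewrite !mxE mulrC /adjacency adj_sym.
  apply/eqP => /rowP v0; move: y1; rewrite big1 => [/esym/eqP|i _]; first by rewrite oner_eq0.
  by have := v0 i; rewrite !mxE => ->; rewrite expr0n.
case/eigenvalueP => v va v0; have /rowP va' := va.
have s0 : 0 < \sum_i v ord0 i ^+ 2.
  rewrite lt_neqAle sumr_ge0 ?andbT => [|i _]; last exact: sqr_ge0.
  rewrite eq_sym; apply: contra v0 => /eqP /psumr_eq0P s0; apply/eqP/rowP => i.
  by rewrite mxE; apply/eqP; rewrite -sqrf_eq0 s0 // => j _; exact: sqr_ge0.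
rewrite -(ler_pM2r s0); apply: le_trans (ymax (v ord0)).
rewrite mulr_sumr le_eqVlt; apply/orP; left; apply/eqP; apply: eq_bigr => i _.
have := va' i; rewrite !mxE => vi; rewrite expr2 mulrA -vi mulr_suml; apply: eq_bigr => j _.
by rewrite !mxE /adjacency adj_sym; lra.
Qed.

(** [rho] is an attained maximum, not the default value of [largest], because there are finitely
    many graphs on ['I_n]; adjacency functions serve as codes in a finite type. *)
Lemma lambda1_le_rho (R : realType) (n d : nat) (H : sgraph n) :
  graph_family n d H -> lambda1 R H <= rho R n d.
Proof.
move=> HF; pose code (G : sgraph n) : {ffun 'I_n * 'I_n -> bool} := [ffun p => G p.1 p.2].
pose val (f : {ffun 'I_n * 'I_n -> bool}) : R :=
  largest [set a | eigenvalue (\matrix_(i, j) (f (i, j))%:R : 'M[R]_n) a]%classic.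
have codeE G : val (code G) = lambda1 R G.
  rewrite /val; have -> // : (\matrix_(i, j) (code G (i, j))%:R : 'M[R]_n) = adjacency_matrix R G.
  by apply/matrixP => i j; rewrite !mxE ffunE.
pose P f := `[< exists2 G, graph_family n d G & code G = f >].
have PH : P (code H) by apply/asboolP; exists H.
have [m /asboolP[G GF GE] mmax] := arg_maxP val PH.
have rhoE : rho R n d = val m.
  apply: largest_eq; first by exists G => //; rewrite -codeE GE.
  by move=> a [K KF <-]; rewrite -codeE; apply: mmax; apply/asboolP; exists K.
by rewrite rhoE -codeE; exact: mmax.
Qed.

Definition simple_graph (n : nat) (G : sgraph n) : graph := Graph (@adj_sym n G) (@adj_irrefl n G).

Lemma degE (n : nat) (G : sgraph n) (v : 'I_n) : degree G v = deg (v : simple_graph G).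
Proof.
rewrite /degree -sum1_card big_mkcond; apply: eq_bigr => w _.
by rewrite inE /=; case: (G v w).
Qed.

Lemma sum_ord_enum (R : nmodType) (T : finType) (n : nat) (nT : n = #|T|) (F : T -> R) :
  \sum_(i < n) F (enum_val (cast_ord nT i)) = \sum_v F v.
Proof.
rewrite [RHS](reindex (fun i : 'I_n => enum_val (cast_ord nT i))) //.
exists (fun v => cast_ord (esym nT) (enum_rank v)) => v _.
  by rewrite enum_valK cast_ordK.
by rewrite cast_ordKV enum_rankK.
Qed.

Lemma max_degreeP (n d : nat) (G : sgraph n) : (0 < n)%N ->
  max_degree G = d <-> (forall v, (degree G v <= d)%N) /\ exists v, degree G v = d.
Proof.
move=> n0; split=> [<-|[dle [v vd]]].
  split=> [v|]; first exact: leq_bigmax.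
  by have [|v vE] := @bigop.eq_bigmax _ (degree G); [rewrite card_ord | exists v; rewrite -vE].
apply/eqP; rewrite eqn_leq; apply/andP; split; first by apply/bigmax_leqP => w _; exact: dle.
by rewrite -vd; exact: leq_bigmax.
Qed.

(** A competitor renumbered by ['I_n.+1] belongs to the family, so its own largest eigenvalue is at
    most [rho], and its Rayleigh bound gives the inequality. *)
Lemma minimal_of_extremal (R : realType) (n d : nat) (G : sgraph n.+1) :
  extremal R d G -> minimal d n.+1 (d%:R - lambda1 R G).
Proof.
move=> [GF GE] g cg conng dg [v1 v1d] [v2 v2d] y.
pose f (i : 'I_n.+1) : g := enum_val (cast_ord (esym cg) i).
pose f' (v : g) : 'I_n.+1 := cast_ord cg (enum_rank v).
have f'K v : f (f' v) = v by rewrite /f /f' cast_ordK enum_rankK.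
have fK i : f' (f i) = i by rewrite /f /f' enum_valK cast_ordKV.
pose H := @SGraph n.+1 (fun i j => edge (f i) (f j)) (fun i j => edge_sym _ _) (fun i => edge_irr _).
have degH i : degree H i = deg (f i) by rewrite degE /deg -(sum_ord_enum (esym cg)).
have HF : graph_family n.+1 d H.
  split.
  - move=> i j; rewrite -(fK i) -(fK j); have /connectP[p pp ->] := conng (f i) (f j).
    elim: p (f i) pp => [|b p IH] a //= /andP[ab pp].
    by apply: connect_trans (IH b pp); apply: connect1; rewrite /= !f'K.
  - move=> [k rk]; have := rk (f' v1); have := rk (f' v2); rewrite !degH !f'K v2d => <-.
    by move=> v1k; move: v1d; rewrite v1k ltnn.
  - apply/max_degreeP => //; split=> [i|]; first by rewrite degH.
    by exists (f' v2); rewrite degH f'K.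
have lHG : lambda1 R H <= lambda1 R G by rewrite GE; exact: lambda1_le_rho.
have [qH _] := lambda1_quad R H.
have := qH (y \o f).
rewrite /quad (sum_ord_enum (esym cg) (fun v => y v ^+ 2)).
rewrite (sum_ord_enum (esym cg) (fun v => \sum_j (edge v (f j))%:R * (y v * y (f j)))).
under eq_bigr => v _ do rewrite (sum_ord_enum (esym cg) (fun w => (edge v w)%:R * (y v * y w))).
move=> qy; rewrite /energy mulrBl lerD2l lerN2; apply: le_trans qy _.
by rewrite ler_wpM2r // sumr_ge0 // => v _; exact: sqr_ge0.
Qed.

Lemma perron_of_extremal (R : realType) (n d : nat) (G : sgraph n.+1) : extremal R d G ->
  exists (x : simple_graph G -> R) z, perron d n.+1 x (d%:R - lambda1 R G) z.
Proof.
move=> Gext; have [[cG nreg] /(max_degreeP d G (ltn0Sn n))[dG hasd] GE] := Gext.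
have [lq [y y1 yl]] := lambda1_quad R G.
have [x [xpos xeig]] := perron_vector (@adj_sym _ G) cG y1 yl lq.
have eig (v : simple_graph G) :
    d%:R * x v - \sum_w (edge v w)%:R * x w = (d%:R - lambda1 R G) * x v.
  by rewrite mulrBl -xeig.
have dle (v : simple_graph G) : (deg v <= d)%N by rewrite -degE.
have def0 : (0 < deficit d (simple_graph G))%N.
  rewrite lt0n /deficit sum_nat_eq0; apply/negP => /forallP H; apply: nreg; exists d => v.
  apply/eqP; rewrite eqn_leq dG /= degE; exact: (H v).
have [z _ zmax] := arg_maxP x (isT : xpredT (ord0 : 'I_n.+1)).
exists x, z; split=> //.
- by move=> v; exact: zmax.
- exact: minimal_of_extremal.
- exact: card_ord.
- by case: hasd => v vd; exists v; rewrite -degE.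
(* Positivity of [mu]: the outflow, [mu] times this sum, equals the sum of all missing degrees
   weighted by [x], and some vertex is deficient. *)
have S0 : 0 < \sum_v x v.
  by rewrite (bigD1 z) //= ltr_pwDl // sumr_ge0 // => v _; exact: ltW.
rewrite -(pmulr_lgt0 _ S0) -/(outflow (G := simple_graph G) x _) (outflowE eig).
move: def0; rewrite lt0n sum_nat_eq0 negb_forall => /existsP[v].
rewrite implyTb subn_eq0 -ltnNge => vd; rewrite (bigD1 v) //= ltr_pwDl //.
  by rewrite mulr_gt0 // subr_gt0 ltr_nat.
by apply: sumr_ge0 => w _; rewrite mulr_ge0 ?(ltW (xpos _)) // subr_ge0 ler_nat.
Qed.

Lemma degree_sequence_single (n d e : nat) (G : sgraph n) (v0 : 'I_n) :
  (e <= d)%N -> degree G v0 = e -> (forall v, v != v0 -> degree G v = d) ->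
  degree_sequence G = rcons (nseq n.-1 d) e.
Proof.
move=> ed v0e vd.
have geq_trans : transitive geq by move=> a b c /= ba ac; exact: leq_trans ac ba.
have srt : sorted geq (rcons (nseq n.-1 d) e).
  by case: (n.-1) => //= m; rewrite rcons_path /=; elim: m => [|m IH] /=; rewrite ?ed ?leqnn.
rewrite /degree_sequence -[RHS](sorted_sort geq_trans srt); apply/perm_sortP => //.
- by move=> a b /=; exact: leq_total.
- by move=> a b /=; rewrite andbC => /anti_leq.
apply: (@perm_trans _ [seq degree G x | x <- rcons (rem v0 (enum 'I_n)) v0]).
  rewrite perm_map // perm_sym perm_rcons perm_sym perm_to_rem // mem_enum //.
rewrite map_rcons v0e (_ : [seq _ | _ <- rem _ _] = nseq n.-1 d) //.
have <- : size [seq degree G x | x <- rem v0 (enum 'I_n)] = n.-1.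
  by rewrite size_map size_rem ?mem_enum // size_enum_ord.
apply/all_pred1P; apply/allP => _ /mapP[v vr ->]; apply/eqP/vd.
by move: vr; rewrite mem_rem_uniq ?enum_uniq // inE => /andP[].
Qed.

Theorem theorem1p8 (R : realType) (d : nat) (hd : (3 <= d)%N)
    (hodd : odd d) :
  exists n0 : nat, forall (n : nat) (G : sgraph n),
    (n0 <= n)%N -> extremal R d G ->
    degree_sequence G = rcons (nseq n.-1 d) (if odd n then d.-1 else 1%N).
Proof.
have [n0 main] := deficient_vertex R hd hodd.
exists n0.+1 => n; case: n => // n G nl Gext.
have [x [z P]] := perron_of_extremal Gext.
have [v0 [v0e vd]] := main _ _ _ _ _ (ltnW nl) P.
apply: (@degree_sequence_single _ _ _ _ v0).
- by case: (odd _); [exact: leq_pred | apply: leq_trans hd].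
- by rewrite degE.
- by move=> v vv0; rewrite degE vd.
Qed.
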